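(* Consider the pure no-flux case $\Gamma^D=\emptyset$ (so $\mathcal E_{\rm ext}^D=\emptyset$). For every $p\in[1,2]$ there exists a constant $\nu_p>0$, depending only on $p$, the domain $\Omega$, the mesh regularity parameter $\zeta$, the potential $V$, and (only in the case $p=1$) the mass $M^1=\int_\Omega u_0\,d\boldsymbol x$, such that every solution $(\boldsymbol u^n)_{n\ge 0}$ of the nonlinear TPFA scheme satisfies $$\mathbb E_p^n\le (1+\nu_p\,\Delta t)^{-n}\,\mathbb E_p^0\qquad\text{for all } n\ge 0 .$$ Consequently, for any $k>0$, if $\Delta t\le k$, then $\mathbb E_p^n\le e^{-\tilde\nu_p t^n}\,\mathbb E_p^0$ for all $n\ge0$, where $\tilde\nu_p=\log(1+\nu_p k)/k$ and $t^n=n\Delta t$.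
   Context: **Data.** $\Omega\subset\mathbb R^2$ is a polygonal connected open bounded set, $V\in C^1(\overline\Omega,\mathbb R)$, $u_0\in L^2(\Omega)$, $u_0\ge0$, $M^1:=\int_\Omega u_0\,d\boldsymbol x>0$. The scheme discretizes $\partial_t u-\mathrm{div}(\nabla u+u\nabla V)=0$ with no-flux condition on all of $\partial\Omega$ and initial datum $u_0$. **Mesh.** An admissible mesh $(\mathcal T,\mathcal E,\mathcal P)$ of $\Omega$: $\mathcal T$ is a finite family of disjoint open convex polygonal control volumes $K\subset\Omega$ whose closures cover $\overline\Omega$; $\mathcal E$ is a finite family of edges (segments of positive length); for each $K$, $\mathcal E_K\subset\mathcal E$ is the set of its edges, $\partial K=\bigcup_{\sigma\in\mathcal E_K}\overline\sigma$, and $\mathcal E=\bigcup_K\mathcal E_K$; for $K\ne L$ either $\overline K\cap\overline L$ has zero length or $\overline K\cap\overline L=\overline\sigma$ for some $\sigma\in\mathcal E$, denoted $\sigma=K|L$ (interior edges, $\sigma\in\mathcal E_{\rm int}$); the other edges lie on $\partial\Omega$ (exterior edges, $\mathcal E_{\rm ext}$). $\mathcal P=(\boldsymbol x_K)_{K\in\mathcal T}$ with $\boldsymbol x_K\in K$; for $\sigma=K|L$, $\boldsymbol x_K\neq \boldsymbol x_L$ and the line through $\boldsymbol x_K,\boldsymbol x_L$ is orthogonal to $\sigma$; for exterior $\sigma\in\mathcal E_K$, the line through $\boldsymbol x_K$ orthogonal to $\sigma$ meets $\sigma$. Denote by $\mathrm m_K$ the area of $K$, $\mathrm m_\sigma$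 the length of $\sigma$, $d(\boldsymbol x_K,\sigma)$ the distance from $\boldsymbol x_K$ to its orthogonal projection on the line containing $\sigma$, $\mathrm d_\sigma=|\boldsymbol x_K-\boldsymbol x_L|$ if $\sigma=K|L$ and $\mathrm d_\sigma=d(\boldsymbol x_K,\sigma)$ if $\sigma\in\mathcal E_K\cap\mathcal E_{\rm ext}$, and $\tau_\sigma=\mathrm m_\sigma/\mathrm d_\sigma$. Regularity: $\zeta>0$ is such that $d(\boldsymbol x_K,\sigma)\ge\zeta\,\mathrm d_\sigma$ for all $K\in\mathcal T$, $\sigma\in\mathcal E_K$. $\Delta t>0$ is the time step. **Function $r$.** $r:(0,\infty)^2\to(0,\infty)$ is monotonically increasing (non-strictly) in each variable, $r(x,x)=x$, $r(x,y)=r(y,x)$, $r(\lambda x,\lambda y)=\lambda r(x,y)$ for all $\lambda>0$, and $\frac{x-y}{\log x-\log y}\le r(x,y)\le\max(x,y)$ for $x\ne y$. **Scheme (no-flux case).** Put $V_K=V(\boldsymbol x_K)$ and $u_K^0=\frac1{\mathrm m_K}\int_K u_0\,d\boldsymbol x$. A solution is a sequence $\boldsymbol u^n=(u^n_K)_{K\in\mathcal T}$, $n\ge0$, with $u_K^{n}>0$ for all $K\in\mathcal T$ and $n\ge1$, such that for all $n\ge0$ and $K\in\mathcal T$ $$\mathrm m_K\frac{u_K^{n+1}-u_K^n}{\Delta t}-\sum_{\sigma=K|L\in\mathcal E_K\cap\mathcal E_{\rm int}}\tau_\sigma\, r(u_K^{n+1},u_L^{n+1})\,\big(\log u_L^{n+1}+V_L-\log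 u_K^{n+1}-V_K\big)=0 .$$ **Steady state.** $u_K^\infty=\rho e^{-V_K}$ with $\rho=M^1\big(\sum_{K\in\mathcal T}\mathrm m_Ke^{-V_K}\big)^{-1}$. **Relative entropies.** $\mathbb E_p^n=\sum_{K\in\mathcal T}\mathrm m_K u_K^\infty\,\Phi_p(u_K^n/u_K^\infty)$, where $\Phi_1(s)=s\log s-s+1$ (with $0\log0=0$) and $\Phi_p(s)=\frac{s^p-ps}{p-1}+1$ for $p\in(1,2]$. *)

(* Defs.v *)
From HB Require Import structures.
From mathcomp Require Import all_boot all_order all_algebra.
From mathcomp Require Import all_classical all_reals all_analysis.

Set Implicit Arguments.
Unset Strict Implicit.
Unset Printing Implicit Defensive.

Import Order.TTheory GRing.Theory Num.Theory.
Import numFieldNormedType.Exports.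

Local Open Scope classical_set_scope.
Local Open Scope ring_scope.

(* The library norm on R * R is the sup norm, hence the explicit Euclidean
   structure. Topological notions do not depend on this choice. *)
Definition dot (R : realType) (x y : R * R) : R := x.1 * y.1 + x.2 * y.2.

Definition edist (R : realType) (x y : R * R) : R :=
  Num.sqrt (dot (x - y) (x - y)).

Definition leb2 (R : realType) :
    {measure set (measurableTypeR R * measurableTypeR R) -> \bar R} :=
  ((@lebesgue_measure R) \x (@lebesgue_measure R))%E.

Definition bdry (R : realType) (A : set (R * R)) : set (R * R) :=
  closure A `\` A°.

Definition segment (R : realType) (a b : R * R) : set (R * R) :=
  [set a + t *: (b - a) | t in `[0, 1]].

Definition orth_proj (R : realType) (a b x : R * R) : R * R :=
  a + (dot (x - a) (b - a) / dot (b - a) (b - a)) *: (b - a).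

(* One-dimensional Hausdorff measure zero. *)
Definition zero_length (R : realType) (A : set (R * R)) : Prop :=
  forall eps : R, 0 < eps ->
  exists (c : nat -> R * R) (rad : nat -> R),
    [/\ forall i, 0 <= rad i,
        A `<=` \bigcup_i [set x | edist (c i) x <= rad i]
      & (\sum_(0 <= i <oo) (rad i)%:E <= eps%:E)%E].

Definition polygonal (R : realType) (A : set (R * R)) : Prop :=
  exists s : seq ((R * R) * (R * R)),
    (forall e, e \in s -> e.1 != e.2) /\
    bdry A = \bigcup_(e in [set` s]) segment e.1 e.2.

Definition polygonal_domain (R : realType) (Omega : set (R * R)) : Prop :=
  [/\ polygonal Omega, connected Omega, open Omega & bounded_set Omega].

(* V is C^1 on the closure of Omega: V is continuous there, differentiable in
   Omega, and its gradient has a continuous extension g to the closure. *)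
Definition C1_closure (R : realType) (Omega : set (R * R)) (V : R * R -> R)
    : Prop :=
  {within closure Omega, continuous V} /\
  exists g : R * R -> R * R,
    {within closure Omega, continuous g} /\
    forall x, Omega x ->
      [/\ differentiable V x,
          'D_((1, 0) : R * R) V x = (g x).1
        & 'D_((0, 1) : R * R) V x = (g x).2].

Record mesh (R : realType) := Mesh {
  Tidx : finType;
  Eidx : finType;
  cell : Tidx -> set (R * R);
  edge_a : Eidx -> R * R;
  edge_b : Eidx -> R * R;
  edges_of : Tidx -> {set Eidx};
  center : Tidx -> R * R
}.

(* Closed segment carried by an edge. *)
Definition edge_seg (R : realType) (M : mesh R) (s : Eidx M) : set (R * R) :=
  segment (edge_a s) (edge_b s).

(* s = K|L *)
Definition is_interface (R : realType) (M : mesh R) (s : Eidx M)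
    (K L : Tidx M) : bool :=
  (K != L) && `[< closure (cell K) `&` closure (cell L) = edge_seg s >].

Definition exterior_edge (R : realType) (M : mesh R) (s : Eidx M) : Prop :=
  forall K L : Tidx M, ~~ is_interface s K L.

Definition area (R : realType) (M : mesh R) (K : Tidx M) : R :=
  fine (leb2 R (cell K)).

Definition edge_length (R : realType) (M : mesh R) (s : Eidx M) : R :=
  edist (edge_a s) (edge_b s).

(* d(x_K, s) *)
Definition dist_to_edge (R : realType) (M : mesh R) (K : Tidx M) (s : Eidx M)
    : R :=
  edist (center K) (orth_proj (edge_a s) (edge_b s) (center K)).

(* d_s, for an edge s of K: on the side of K, the cell L with s = K|L is unique
   when it exists. *)
Definition edge_dist (R : realType) (M : mesh R) (K : Tidx M) (s : Eidx M)
    : R :=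
  if [pick L | is_interface s K L] is Some L then edist (center K) (center L)
  else dist_to_edge K s.

Definition transmissibility (R : realType) (M : mesh R) (K : Tidx M)
    (s : Eidx M) : R :=
  edge_length s / edge_dist K s.

Record admissible_mesh (R : realType) (Omega : set (R * R)) (M : mesh R)
    : Prop := {
  cell_open : forall K : Tidx M, open (cell K);
  cell_convex : forall K : Tidx M, convex_set (cell K);
  cell_polygonal : forall K : Tidx M, polygonal (cell K);
  cell_sub : forall K : Tidx M, cell K `<=` Omega;
  cell_disjoint : forall K L : Tidx M, K != L -> cell K `&` cell L = set0;
  cell_cover : closure Omega = \bigcup_(K in [set: Tidx M]) closure (cell K);
  edge_nondegenerate : forall s : Eidx M, edge_a s != edge_b s;
  edge_seg_inj : injective (@edge_seg R M);
  edge_bdry : forall K : Tidx M,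
    bdry (cell K) = \bigcup_(s in [set s | s \in edges_of K]) edge_seg s;
  edge_cover : forall s : Eidx M, exists K : Tidx M, s \in edges_of K;
  cell_inter : forall K L : Tidx M, K != L ->
    zero_length (closure (cell K) `&` closure (cell L)) \/
    exists s : Eidx M,
      [/\ is_interface s K L, s \in edges_of K & s \in edges_of L];
  exterior_sub : forall s : Eidx M, exterior_edge s ->
    edge_seg s `<=` bdry Omega;
  center_in : forall K : Tidx M, cell K (center K);
  interface_orth : forall (s : Eidx M) (K L : Tidx M), is_interface s K L ->
    center K != center L /\
    dot (center L - center K) (edge_b s - edge_a s) = 0;
  exterior_orth : forall (s : Eidx M) (K : Tidx M),
    s \in edges_of K -> exterior_edge s ->
    exists2 y, edge_seg s y & dot (y - center K) (edge_b s - edge_a s) = 0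
}.

Definition mesh_regular (R : realType) (zeta : R) (M : mesh R) : Prop :=
  forall (K : Tidx M) (s : Eidx M), s \in edges_of K ->
    zeta * edge_dist K s <= dist_to_edge K s.

Record admissible_mean (R : realType) (r : R -> R -> R) : Prop := {
  mean_pos : forall x y, 0 < x -> 0 < y -> 0 < r x y;
  mean_mono_l : forall x x' y, 0 < x -> 0 < y -> x <= x' -> r x y <= r x' y;
  mean_mono_r : forall x y y', 0 < x -> 0 < y -> y <= y' -> r x y <= r x y';
  mean_diag : forall x, 0 < x -> r x x = x;
  mean_sym : forall x y, 0 < x -> 0 < y -> r x y = r y x;
  mean_homog : forall l x y, 0 < l -> 0 < x -> 0 < y ->
    r (l * x) (l * y) = l * r x y;
  mean_bounds : forall x y, 0 < x -> 0 < y -> x != y ->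
    (x - y) / (ln x - ln y) <= r x y <= Num.max x y
}.

Record initial_datum (R : realType) (Omega : set (R * R)) (u0 : R * R -> R)
    : Prop := {
  datum_L2 : (u0 \_ Omega : R * R -> R) \in Lfun (leb2 R) 2%:E;
  datum_ge0 : {ae leb2 R, forall x, Omega x -> 0 <= u0 x};
}.

Definition mass (R : realType) (Omega : set (R * R)) (u0 : R * R -> R) : R :=
  \int[leb2 R]_(x in Omega) u0 x.

Record scheme_solution (R : realType) (V : R * R -> R) (M : mesh R)
    (r : R -> R -> R) (u0 : R * R -> R) (dt : R) (u : nat -> Tidx M -> R)
    : Prop := {
  scheme_init : forall K,
    u 0%N K = (area K)^-1 * \int[leb2 R]_(x in cell K) u0 x;
  scheme_pos : forall n K, 0 < u n.+1 K;
  scheme_eq : forall n K,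
    area K * ((u n.+1 K - u n K) / dt)
    - \sum_(s in edges_of K) \sum_(L | is_interface s K L)
        transmissibility K s * r (u n.+1 K) (u n.+1 L) *
        (ln (u n.+1 L) + V (center L) - ln (u n.+1 K) - V (center K)) = 0
}.

Definition steady_state (R : realType) (V : R * R -> R) (M : mesh R) (M1 : R)
    (K : Tidx M) : R :=
  M1 / (\sum_(L : Tidx M) area L * expR (- V (center L)))
  * expR (- V (center K)).

(* ln 0 = 0 in the library, so Phi 1 0 = 1; and 0 `^ p = 0 for p != 0. *)
Definition Phi (R : realType) (p s : R) : R :=
  if p == 1 then s * ln s - s + 1
  else (s `^ p - p * s) / (p - 1) + 1.

Definition rel_entropy (R : realType) (V : R * R -> R) (M : mesh R) (M1 p : R)
    (v : Tidx M -> R) : R :=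
  \sum_(K : Tidx M) area K * steady_state V M1 K *
    Phi p (v K / steady_state V M1 K).

(* Main.v *)
(* With h = u / u^oo the relative entropy is a convex functional of h, so one
   step of the implicit scheme loses at least dt times its dissipation, which
   the lower bound on r by the logarithmic mean turns into the sum over the
   interfaces of tau (h_K - h_L) (Phi_p'(h_K) - Phi_p'(h_L)), up to the factor
   min u^oo.  By the variational (Holley-Stroock) form of the entropy, bounding
   the entropy by this dissipation reduces to the unweighted case V = 0.

   There, w = h^(p/2) has Dirichlet energy D at most the dissipation.  A
   discrete isoperimetric inequality |A| <= C Per(A)^2 for the smaller of a
   union A of cells and its complement gives, by coarea, an L^1 -> L^2 Sobolev
   inequality; applied to (w - c)_+^2 and (w - c)_-^2 for a median c of w it
   yields sum m (w - c)^4 <= C D^2, using sum_s m_s d_s <= C m_K on each cell.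
   This gives the Beckner inequality for p > 1 and, comparing h with the
   constant c^2 + O(D), the logarithmic Sobolev inequality for p = 1; no
   constant depends on the mass.

   Isoperimetry is proved first in parallelograms: the rows and columns that
   avoid the interface set between A and its complement are monochromatic, and
   any such row crosses any such column, so one of the two colours is confined
   to X x Y with |X|, |Y| <= C Per(A).  It passes to unions that overlap in
   positive measure.  Near each point of its closure the polygonal domain is
   covered by finitely many parallelograms spanned by consecutive boundary
   directions, and compactness and connectedness conclude. *)
Require Import Defs.
From HB Require Import structures.
From mathcomp Require Import all_boot all_order all_algebra.
From mathcomp Require Import all_classical all_reals all_analysis.
From mathcomp Require Import measurable_realfun ring lra.

Set Implicit Arguments.
Unset Strict Implicit.
Unset Printing Implicit Defensive.

Import Order.TTheory GRing.Theory Num.Theory.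
Import numFieldNormedType.Exports.
(* The library has another [edist], in urysohn. *)
Import Defs.

Local Open Scope ring_scope.

(** * Sobolev inequalities on a weighted graph *)

(** The obstacle is uniformity: the constants may see the mesh only through [zeta], so functional
    inequalities for smooth functions do not transfer directly to cellwise constant ones. All
    information on [Omega] is therefore put into a single inequality between sets, quantified over
    every admissible mesh, where the mesh is seen only through projections of its interfaces. The
    square of the perimeter is the scaling of the plane. It makes the Sobolev exponent 2, so that
    testing with squares controls fourth moments. This is what p = 1 requires: there h = w^2, the
    Bregman divergence is bounded by (h - k)^2 / k, and (h - k)^2 is quartic in w - c. The
    regularity [zeta] enters through the comparison of the edges of a cell with its area, and the
    potential through a bound [Vb] of its absolute value. The mass disappears because r is
    homogeneous of degree one: for a fixed ratio h, the bounds on the entropy and on its dissipation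
    are both proportional to rho. *)

Lemma cauchy_schwarz_sum (R : realFieldType) (I : finType) (w a b : I -> R) :
  (forall i, 0 <= w i) ->
  (\sum_i w i * (a i * b i)) ^+ 2 <=
  (\sum_i w i * a i ^+ 2) * (\sum_i w i * b i ^+ 2).
Proof.
move=> w0; set C := \sum_i _; set A := \sum_i _; set B := \sum_i _.
have A0 : 0 <= A by apply: sumr_ge0 => i _; rewrite mulr_ge0 ?sqr_ge0.
have gen x y : \sum_i w i * (x * b i - y * a i) ^+ 2 =
    x ^+ 2 * B - 2 * x * y * C + y ^+ 2 * A.
  rewrite /A /B /C !mulr_sumr -sumrN -!big_split /=.
  by apply: eq_bigr => i _; ring.
(* The usual discriminant argument, evaluated at x = A and y = C; if A = 0, every term of C
   vanishes. *)
have H : 0 <= A * (A * B - C ^+ 2).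
  have -> : A * (A * B - C ^+ 2) = \sum_i w i * (A * b i - C * a i) ^+ 2.
    by rewrite gen; ring.
  by apply: sumr_ge0 => i _; rewrite mulr_ge0 ?sqr_ge0.
have [Ap|Ap] := ltP 0 A; first by rewrite -subr_ge0 -(pmulr_rge0 _ Ap).
have {Ap} AE : A = 0 by apply/eqP; rewrite eq_le Ap A0.
have -> : C = 0.
  apply: big1 => i _; have := AE => /eqP.
  rewrite psumr_eq0 => [/allP/(_ i (mem_index_enum i))/=|j _]; last first.
    by rewrite mulr_ge0 ?sqr_ge0.
  by rewrite mulf_eq0 sqrf_eq0 => /orP[/eqP->|/eqP->]; rewrite ?mul0r ?mulr0.
by rewrite AE mul0r expr0n.
Qed.

Lemma sqr_max0_le (R : realFieldType) (a b : R) :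
  (Num.max a 0 - Num.max b 0) ^+ 2 <= (a - b) ^+ 2.
Proof.
have [h1|h1] := leP a 0; have [h2|h2] := leP b 0; rewrite ?subr0 ?sub0r ?sqrrN//.
- by rewrite expr0n sqr_ge0.
- have : 0 <= - a * b by apply: mulr_ge0; lra.
  by have := sqr_ge0 a; rewrite sqrrB; lra.
- have : 0 <= a * - b by apply: mulr_ge0; lra.
  by have := sqr_ge0 b; rewrite sqrrB; lra.
Qed.

Section discrete_sobolev.
Variables (R : realFieldType) (T : finType) (m : T -> R) (l d : T -> T -> R).
Variables (C0 C1 : R).
Hypotheses (m0 : forall K, 0 < m K) (l0 : forall K L, 0 <= l K L).
Hypotheses (lC : forall K L, l K L = l L K) (dC : forall K L, d K L = d L K).
Hypothesis d0 : forall K L, l K L != 0 -> 0 < d K L.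
Hypotheses (C0_ge0 : 0 <= C0) (C1_ge0 : 0 <= C1).

Let per (A : {set T}) := \sum_(K in A) \sum_(L in ~: A) l K L.

Hypothesis iso : forall A : {set T},
  \sum_(K in A) m K <= C0 * per A ^+ 2 \/
  \sum_(K in ~: A) m K <= C0 * per A ^+ 2.
Hypothesis ld : forall K, \sum_L l K L * d K L <= C1 * m K.

(** Keeping positive parts counts each unordered pair once; the indicator function of A has total
    variation [per A]. *)
Definition total_variation (v : T -> R) : R :=
  \sum_K \sum_L l K L * Num.max (v K - v L) 0.

Lemma total_variation_ge0 v : 0 <= total_variation v.
Proof.
by do 2 (apply: sumr_ge0 => ? _); rewrite mulr_ge0// le_max lexx orbT.
Qed.

(* Coarea formula, peeling off the lowest positive level of [v] at each step. *)
Lemma sobolev_of_isoperimetry (v : T -> R) : (forall K, 0 <= v K) ->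
  (forall A : {set T}, (forall K, K \in A -> 0 < v K) ->
    \sum_(K in A) m K <= C0 * per A ^+ 2) ->
  \sum_K m K * v K ^+ 2 <= C0 * total_variation v ^+ 2.
Proof.
have [n] := ubnP #|[set K | 0 < v K]|; elim: n v => // n IH v.
rewrite ltnS => cn v0 isov; set S := [set K | 0 < v K] in cn.
have [S0|[K0 K0S]] := set_0Vmem S.
  rewrite big1; first by apply: mulr_ge0 => //; exact: sqr_ge0.
  move=> K _; have : K \notin S by rewrite S0 inE.
  by rewrite inE lt_def v0 andbT negbK => /eqP ->; rewrite expr0n mulr0.
case: (arg_minP v K0S) => /= K1 K1S vmin; set e := v K1 in vmin.
have {}K1S : K1 \in S by [].
have {}vmin K : K \in S -> e <= v K by exact: vmin.
have e0 : 0 < e by move: K1S; rewrite inE.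
(* Cutting off the level e removes at least K1 from the support, so the induction on its cardinality
   applies. *)
pose v' K := if K \in S then v K - e else 0.
have v'0 K : 0 <= v' K.
  by rewrite /v'; case: ifPn => // KS; rewrite subr_ge0; exact: vmin.
have vE K : v K = v' K + e * (K \in S)%:R.
  rewrite /v'; case: ifPn => KS; first by rewrite mulr1 subrK.
  by move: KS; rewrite inE lt_def v0 andbT negbK => /eqP ->; rewrite mulr0 addr0.
have sub K : 0 < v' K -> K \in S :\ K1.
  rewrite /v' in_setD1; case: ifPn => [KS|]; last by rewrite ltxx.
  rewrite subr_gt0 => h; rewrite andbT.
  by apply: contraTneq h => ->; rewrite ltxx.
have IH' : \sum_K m K * v' K ^+ 2 <= C0 * total_variation v' ^+ 2.
  apply: IH => //.
  - apply: leq_trans cn; rewrite (cardsD1 K1 S) K1S ltnS; apply: subset_leq_card.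
    by apply/fintype.subsetP => K; rewrite inE => /sub.
  - by move=> A HA; apply: isov => K /HA/sub; rewrite !inE => /andP[].
set X := total_variation v' in IH'; set P := per S.
have X0 : 0 <= X := total_variation_ge0 _.
have P0 : 0 <= P by do 2 (apply: sumr_ge0 => ? _).
have TVE : total_variation v = e * P + X.
  rewrite /P /per /X /total_variation mulr_sumr [X in X + _]big_mkcond -big_split/=.
  apply: eq_bigr => K _; case: ifPn => KS; last first.
    rewrite add0r; apply: eq_bigr => L _; congr (_ * _).
    have v'K : v' K = 0 by rewrite /v' (negbTE KS).
    have vK : v K = 0 by rewrite vE v'K (negbTE KS) mulr0 addr0.
    by rewrite vK v'K !sub0r !max_r ?oppr_le0.
  rewrite mulr_sumr [X in X + _]big_mkcond -big_split/=; apply: eq_bigr => L _.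
  rewrite inE; case: ifPn => LS.
    rewrite !vE KS (negbTE LS) mulr1 mulr0 addr0.
    have -> : v' L = 0 by rewrite /v' (negbTE LS).
    by rewrite !subr0 !max_l ?addr_ge0// ?ltW//; ring.
  rewrite add0r !vE KS; move: LS; rewrite negbK => ->; congr (_ * Num.max _ _); ring.
have mS : \sum_(K in S) m K <= C0 * P ^+ 2 by apply: isov => K; rewrite inE.
set Y := \sum_K m K * v' K ^+ 2 in IH'.
set Z := \sum_(K in S) m K * v' K.
have Z0 : 0 <= Z by apply: sumr_ge0 => K _; rewrite mulr_ge0// ltW.
have LHSE : \sum_K m K * v K ^+ 2 = e ^+ 2 * (\sum_(K in S) m K) + 2 * e * Z + Y.
  have E (g : T -> R) : \sum_(K in S) g K = \sum_K (K \in S)%:R * g K.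
    by rewrite big_mkcond; apply: eq_bigr => K _; case: ifP; rewrite ?mul1r ?mul0r.
  rewrite /Z /Y !E !mulr_sumr -!big_split/=; apply: eq_bigr => K _.
  by rewrite vE; case: (K \in S) => /=; ring.
(* Cauchy-Schwarz, then isoperimetry for S and the induction hypothesis for v'. *)
have Zle : Z <= C0 * (P * X).
  have ms0 : 0 <= \sum_(K in S) m K by apply: sumr_ge0 => K _; exact: ltW.
  have := cauchy_schwarz_sum (fun K => (K \in S)%:R) v' (fun K => ltW (m0 K)).
  have -> : \sum_i m i * ((i \in S)%:R * v' i) = Z.
    by rewrite /Z [RHS]big_mkcond; apply: eq_bigr => K _; case: ifP; rewrite ?mul1r// mul0r mulr0.
  have -> : \sum_i m i * (i \in S)%:R ^+ 2 = \sum_(K in S) m K.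
    by rewrite [RHS]big_mkcond; apply: eq_bigr => K _; case: ifP; rewrite ?expr1n ?mulr1// expr0n mulr0.
  rewrite -/Y => h; rewrite -(ler_pXn2r (n := 2)) ?nnegrE ?mulr_ge0//.
  apply: le_trans h _.
  apply: le_trans (ler_pM ms0 _ mS IH') _; last by rewrite le_eqVlt; apply/orP; left; apply/eqP; ring.
  by apply: sumr_ge0 => K _; rewrite mulr_ge0 ?sqr_ge0// ltW.
(* The three terms are compared with those of C0 (e P + X)^2 one by one, so C0 does not deteriorate
   along the induction. *)
rewrite LHSE TVE.
have : e ^+ 2 * (\sum_(K in S) m K) <= e ^+ 2 * (C0 * P ^+ 2) by rewrite ler_wpM2l ?sqr_ge0.
have : 2 * e * Z <= 2 * e * (C0 * (P * X)) by rewrite ler_wpM2l// mulr_ge0// ltW.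
by move: IH'; rewrite (_ : C0 * (e * P + X) ^+ 2 = e ^+ 2 * (C0 * P ^+ 2) +
  2 * e * (C0 * (P * X)) + C0 * X ^+ 2); [lra|ring].
Qed.

Definition dirichlet (w : T -> R) : R := \sum_K \sum_L l K L / d K L * (w K - w L) ^+ 2.

Let a0 K L : 0 <= l K L / d K L.
Proof.
have [->|lKL] := eqVneq (l K L) 0; first by rewrite mul0r.
by rewrite divr_ge0// ltW// d0.
Qed.

Lemma dirichlet_ge0 w : 0 <= dirichlet w.
Proof. by do 2 (apply: sumr_ge0 => ? _); rewrite mulr_ge0 ?sqr_ge0. Qed.

(** Let f = (w - c)_+, Q = sum m f^4 and N = sum m f^2. The Sobolev inequality for f^2 gives Q <= B
    N with B = 4 C0 C1 D, and N^2 <= Q sum m; eliminating N bounds Q. *)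
Lemma fourth_moment_pos (w : T -> R) (c : R) :
  \sum_(K | c < w K) m K <= \sum_(K | w K <= c) m K ->
  \sum_K m K * Num.max (w K - c) 0 ^+ 4 <=
  (4 * C0 * C1 * dirichlet w) ^+ 2 * \sum_K m K.
Proof.
move=> half; pose f K := Num.max (w K - c) 0.
have f0 K : 0 <= f K by rewrite le_max lexx orbT.
set Q := \sum_K _; set D := dirichlet w; have D0 : 0 <= D := dirichlet_ge0 w.
have step1 : Q <= C0 * total_variation (fun K => f K ^+ 2) ^+ 2.
  rewrite /Q (eq_bigr (fun K => m K * (f K ^+ 2) ^+ 2)); last first.
    by move=> K _; rewrite -exprM.
  apply: sobolev_of_isoperimetry => [K|A HA]; first exact: sqr_ge0.
  have wA K : K \in A -> c < w K.
    move=> /HA; rewrite lt_def sqrf_eq0 => /andP[fn _].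
    have : 0 < f K by rewrite lt_def fn f0.
    by rewrite /f lt_max ltxx orbF subr_gt0.
  (* If [iso] bounds the complement instead, A is no heavier: it lies in {w > c}, which weighs at
     most as much as {w <= c}, a part of the complement. *)
  case: (iso A) => // h; apply: le_trans h; apply: le_trans (le_trans _ half) _.
    rewrite [leLHS]big_mkcond [leRHS]big_mkcond; apply: ler_sum => K _.
    by case: ifPn => [/wA ->//|_]; case: ifP => // _; exact: ltW.
  rewrite [leLHS]big_mkcond [leRHS]big_mkcond; apply: ler_sum => K _.
  rewrite inE; case: ifPn => wc; last by case: ifP => // _; exact: ltW.
  by case: ifPn => //; rewrite negbK => /wA; rewrite ltNge wc.
pose N := \sum_K m K * f K ^+ 2.
have N0 : 0 <= N by apply: sumr_ge0 => K _; rewrite mulr_ge0 ?sqr_ge0// ltW.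
(* Cauchy-Schwarz over ordered pairs with weight l / d, with factors |f_K - f_L| and d (f_K + f_L).
   The 4 comes from (x + y)^2 <= 2 x^2 + 2 y^2 and the symmetry of l d. *)
have step2 : total_variation (fun K => f K ^+ 2) ^+ 2 <= D * (4 * C1 * N).
  have CS := @cauchy_schwarz_sum R (T * T)%type (fun p => l p.1 p.2 / d p.1 p.2)
     (fun p => `|f p.1 - f p.2|) (fun p => d p.1 p.2 * (f p.1 + f p.2))
     (fun p => a0 p.1 p.2).
  apply: (@le_trans _ _ ((\sum_(p : T * T) l p.1 p.2 / d p.1 p.2 *
      (`|f p.1 - f p.2| * (d p.1 p.2 * (f p.1 + f p.2)))) ^+ 2)).
    rewrite ler_pXn2r ?nnegrE ?total_variation_ge0//; last first.
      apply: sumr_ge0 => p _; have [->|lp] := eqVneq (l p.1 p.2) 0.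
        by rewrite !mul0r.
      by rewrite mulr_ge0// mulr_ge0// mulr_ge0 ?addr_ge0// ltW// d0.
    rewrite /total_variation pair_bigA/=; apply: ler_sum => p _.
    have [->|lp] := eqVneq (l p.1 p.2) 0; first by rewrite !mul0r.
    have dp := d0 lp.
    rewrite (_ : _ / _ * _ = l p.1 p.2 * (`|f p.1 - f p.2| * (f p.1 + f p.2))); last first.
      by field; rewrite gt_eqF.
    rewrite ler_wpM2l// subr_sqr ge_max mulr_ge0 ?addr_ge0// andbT.
    by rewrite ler_wpM2r ?addr_ge0// ler_norm.
  apply: le_trans CS _; apply: ler_pM.
  - by apply: sumr_ge0 => p _; rewrite mulr_ge0 ?sqr_ge0.
  - by apply: sumr_ge0 => p _; rewrite mulr_ge0 ?sqr_ge0.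
  - rewrite /D /dirichlet pair_bigA/=; apply: ler_sum => p _.
    rewrite ler_wpM2l// real_normK ?num_real// /f.
    by rewrite (le_trans (sqr_max0_le _ _))// opprB addrA subrK.
  - have symE : \sum_K \sum_L l K L * d K L * f L ^+ 2 =
        \sum_K \sum_L l K L * d K L * f K ^+ 2.
      rewrite exchange_big /=; apply: eq_bigr => K _; apply: eq_bigr => L _.
      by rewrite lC dC.
    apply: (@le_trans _ _ (2 * (\sum_K \sum_L l K L * d K L * f K ^+ 2) +
        2 * (\sum_K \sum_L l K L * d K L * f L ^+ 2))).
      rewrite !pair_bigA/= !mulr_sumr -big_split /=; apply: ler_sum => p _.
      have [->|lp] := eqVneq (l p.1 p.2) 0; first by rewrite !mul0r !mulr0 addr0.
      have dp := d0 lp.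
      rewrite (_ : _ / _ * _ = l p.1 p.2 * d p.1 p.2 * (f p.1 + f p.2) ^+ 2); last first.
        by field; rewrite gt_eqF.
      rewrite (_ : 2 * _ + _ = l p.1 p.2 * d p.1 p.2 * (2 * f p.1 ^+ 2 + 2 * f p.2 ^+ 2)); last by ring.
      rewrite ler_wpM2l ?mulr_ge0 ?(ltW dp)//.
      move: (f p.1) (f p.2) => x y; have := sqr_ge0 (x - y).
      by rewrite sqrrB sqrrD; lra.
    rewrite symE -mulrDl (_ : 2 + 2 = 4) -?mulrA; last by ring.
    rewrite ler_wpM2l// /N mulr_sumr; apply: ler_sum => K _.
    by rewrite -mulr_suml mulrA ler_wpM2r ?sqr_ge0.
have step3 : N ^+ 2 <= Q * \sum_K m K.
  have := cauchy_schwarz_sum (fun K => f K ^+ 2) (fun=> 1) (fun K => ltW (m0 K)).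
  rewrite (eq_bigr (fun K => m K * f K ^+ 2)); last by move=> K _; rewrite mulr1.
  rewrite -/N (eq_bigr (fun K => m K * f K ^+ 4)); last first.
    by move=> K _; rewrite -exprM.
  by rewrite -/Q (eq_bigr m)// => K _; rewrite expr1n mulr1.
have Q0 : 0 <= Q.
  by apply: sumr_ge0 => K _; apply: mulr_ge0; [exact: ltW|exact: (exprn_ge0 4 (f0 K))].
set S := \sum_K m K in step3 *.
have S0 : 0 <= S by apply: sumr_ge0 => K _; exact: ltW.
pose B := 4 * C0 * C1 * D; have B0 : 0 <= B by rewrite !mulr_ge0.
have QB : Q <= B * N.
  apply: le_trans step1 _; rewrite (_ : B * N = C0 * (D * (4 * C1 * N))); last first.
    by rewrite /B; ring.
  by rewrite ler_wpM2l.
have [Qp|] := ltP 0 Q; last by move=> /le_trans; apply; rewrite mulr_ge0// sqr_ge0.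
rewrite -(ler_pM2l Qp) -/B.
apply: (@le_trans _ _ ((B * N) ^+ 2)); first by rewrite -expr2 ler_pXn2r ?nnegrE// mulr_ge0.
rewrite exprMn (_ : Q * (B ^+ 2 * S) = B ^+ 2 * (Q * S)); last by ring.
by rewrite ler_wpM2l ?sqr_ge0.
Qed.

(** K1 has the highest level for which the second inequality holds. That inequality fails at the
    next level K4, and since no value lies strictly between the two levels, its failure is the first
    inequality at K1. *)
Lemma weighted_median (w : T -> R) (K0 : T) :
  exists K1, \sum_(K | w K1 < w K) m K <= \sum_(K | w K <= w K1) m K /\
    \sum_(K | w K < w K1) m K <= \sum_(K | w K1 <= w K) m K.
Proof.
pose P := [set J | \sum_(K | w K < w J) m K <= \sum_(K | w J <= w K) m K].
have [K2 K2P] : exists K2, K2 \in P.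
  have K0T : K0 \in [set: T] by rewrite inE.
  case: (arg_minP w K0T) => K2 _ K2min; exists K2; rewrite inE big_pred0.
    by apply: sumr_ge0 => K _; exact: ltW.
  by move=> K; apply/negbTE; rewrite -leNgt; exact: (K2min K (finset.in_setT K)).
case: (arg_maxP w K2P) => K1 K1P K1max; exists K1.
have {}K1P : K1 \in P by [].
split; last by move: K1P; rewrite inE.
have [H0|[K3 K3H]] := set_0Vmem [set K | w K1 < w K].
  rewrite big_pred0; first by apply: sumr_ge0 => K _; exact: ltW.
  by move=> K; have := finset.in_set0 K; rewrite -H0 inE.
case: (arg_minP w K3H) => K4 K4H K4min'.
have K4min K : w K1 < w K -> w K4 <= w K.
  by move=> h; apply: K4min'; have : K \in [set K | w K1 < w K] by rewrite inE.
have {}K4H : K4 \in [set K | w K1 < w K] by [].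
have : K4 \notin P.
  apply: contraTN K4H => K4P; rewrite inE -leNgt; exact: K1max.
rewrite inE -ltNge => /ltW; rewrite inE in K4H.
rewrite (eq_bigl (fun K => w K1 < w K)); last first.
  move=> K /=; apply/idP/idP => [|h]; first exact: lt_le_trans.
  by exact: K4min.
rewrite [X in _ <= X -> _](eq_bigl (fun K => w K <= w K1))// => K /=.
rewrite leNgt; apply/idP/negP => [h1 h2|h]; last first.
  by rewrite (le_lt_trans _ K4H)// leNgt; apply/negP.
by move: h1; rewrite ltNge => /negP; apply; exact: K4min.
Qed.

Lemma fourth_moment (w : T -> R) (K0 : T) : exists K1,
  \sum_K m K * (w K - w K1) ^+ 4 <=
  2 * ((4 * C0 * C1 * dirichlet w) ^+ 2 * \sum_K m K).
Proof.
have [K1 [h1 h2]] := weighted_median w K0; exists K1.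
have DN : dirichlet (fun K => - w K) = dirichlet w.
  apply: eq_bigr => K _; apply: eq_bigr => L _.
  by congr (_ * _); rewrite -opprD sqrrN.
have f1 := fourth_moment_pos h1.
have := @fourth_moment_pos (fun K => - w K) (- w K1).
rewrite DN [X in X <= _ -> _](eq_bigl (fun K => w K < w K1)); last by move=> K; rewrite ltrN2.
rewrite [X in _ <= X -> _](eq_bigl (fun K => w K1 <= w K)); last by move=> K; rewrite lerN2.
move=> /(_ h2) f2; rewrite [leRHS]mulr_natl mulr2n.
apply: le_trans (lerD f1 f2); rewrite -big_split /= le_eqVlt; apply/orP; left.
apply/eqP/eq_bigr => K _; rewrite -mulrDr; congr (_ * _).
rewrite -opprD; have [h|h] := leP (w K - w K1) 0.
  by rewrite max_l ?oppr_ge0// expr0n add0r; ring.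
by rewrite max_r ?oppr_le0 ?ltW// expr0n addr0.
Qed.

End discrete_sobolev.

Local Open Scope classical_set_scope.
Local Open Scope ring_scope.

(** * Entropy functions and the entropy-dissipation inequality *)

Lemma ln_ge1BV (R : realType) (x : R) : 0 < x -> 1 - x^-1 <= ln x.
Proof.
move=> x0; have := @le_ln1Dx R (x^-1 - 1).
rewrite subrKC lnV ?posrE// ltrBDl addrN invr_gt0 => /(_ x0); lra.
Qed.

Lemma powR_bernoulli (R : realType) (x q : R) : 0 < x -> 0 <= q <= 1 ->
  x `^ q <= 1 + q * (x - 1).
Proof.
move=> x0 /andP[q0 q1]; have y0 : 0 < 1 + q * (x - 1).
  have [->|qn0] := eqVneq q 0; first by rewrite mul0r addr0.
  have qx : 0 < q * x by rewrite mulr_gt0// lt_def qn0.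
  nra.
rewrite -ler_ln ?posrE ?powR_gt0// ln_powR.
have := @concave_ln R (Itv01 q0 q1) x 1 x0 ltr01.
rewrite !convRE /= ln1 mulr0 addr0 => h; apply: le_trans h _.
(* Concavity of ln was used between x and 1 with weights q and 1 - q. *)
by rewrite le_eqVlt; apply/orP; left; apply/eqP; congr ln; rewrite /unstable.onem; ring.
Qed.

Section entropy_function.
Variables (R : realType) (p : R).
Hypothesis hp : 1 <= p <= 2.

Definition dPhi (p s : R) : R :=
  if p == 1 then ln s else p * (s `^ (p - 1) - 1) / (p - 1).

(** Gap between [Phi p] at h and its tangent at k; its sign encodes convexity, and k = 1 gives back
    [Phi p h]. *)
Definition bregman (p h k : R) : R := Phi p h - Phi p k - dPhi p k * (h - k).

Let p1_gt0 : p != 1 -> 0 < p - 1.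
Proof. by move=> p1; rewrite subr_gt0 lt_neqAle eq_sym p1; case/andP: hp. Qed.

Lemma Phi1 : Phi p 1 = 0.
Proof.
rewrite /Phi; case: ifPn => [_|/p1_gt0 p1]; first by rewrite ln1; ring.
by rewrite powR1; field; rewrite gt_eqF.
Qed.

Lemma bregmanE1 (h k : R) : bregman 1 h k = h * ln h - h * ln k - h + k.
Proof. by rewrite /bregman /Phi /dPhi eqxx; ring. Qed.

Lemma bregmanE (h k : R) : p != 1 -> 0 < k ->
  bregman p h k = (h `^ p - p * (k `^ (p - 1) * h) + (p - 1) * k `^ p) / (p - 1).
Proof.
move=> p1 k0; have p10 := p1_gt0 p1; rewrite /bregman /Phi /dPhi (negbTE p1).
have -> : k `^ p = k * k `^ (p - 1) by rewrite mulr_powRB1 ?ltW//; case/andP: hp => ? ?; lra.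
by field; rewrite gt_eqF.
Qed.

Lemma bregman_scale (h k : R) : p != 1 -> 0 <= h -> 0 < k ->
  bregman p h k = k `^ p * (((h / k) `^ p - 1 - p * (h / k - 1)) / (p - 1)).
Proof.
move=> p1 h0 k0; have p10 := p1_gt0 p1; rewrite bregmanE//.
have kp0 : k `^ p != 0 by rewrite gt_eqF// powR_gt0.
have kp : k `^ p = k * k `^ (p - 1) by rewrite mulr_powRB1 ?ltW//; case/andP: hp => ? ?; lra.
have {1}-> : h `^ p = (h / k) `^ p * k `^ p.
  by rewrite -powRM ?divr_ge0 ?(ltW k0)// divfK// gt_eqF.
rewrite kp in kp0 *; field; rewrite !gt_eqF//=.
Qed.

(** With x = h / k, the case p = 1 is ln x >= 1 - 1 / x, and p > 1 is the Bernoulli inequality for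
    (x^p)^(1/p). The value h = 0 is allowed because the initial datum may vanish on a cell. *)
Lemma bregman_ge0 (h k : R) : 0 <= h -> 0 < k -> 0 <= bregman p h k.
Proof.
move=> h0 k0; have [->|p1] := eqVneq p 1.
  rewrite bregmanE1; have [->|hn0] := eqVneq h 0; first by rewrite !mul0r; lra.
  have hp0 : 0 < h by rewrite lt_def hn0.
  have := @ln_ge1BV _ (h / k); rewrite divr_gt0// invf_div ln_div ?posrE// => /(_ isT).
  rewrite -(ler_pM2l hp0) mulrBr mulr1 mulrCA divff ?gt_eqF// mulr1; lra.
have p10 := p1_gt0 p1; rewrite bregman_scale// mulr_ge0 ?powR_ge0//.
rewrite divr_ge0 ?(ltW p10)//.
have p0 : 0 < p by case/andP: hp => ? ?; lra.
have [x0|x0] := ltP 0 (h / k); last first.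
  have -> : h / k = 0 by apply/eqP; rewrite eq_le x0 divr_ge0// ltW.
  by rewrite powR0 ?gt_eqF//; case/andP: hp => ? ?; lra.
set x := h / k in x0 *.
have pi : 0 <= p^-1 <= 1.
  apply/andP; split; first by rewrite invr_ge0 ltW.
  by rewrite invf_le1//; case/andP: hp.
have := powR_bernoulli (powR_gt0 p x0) pi.
rewrite -powRrM divff ?(gt_eqF p0)// powRr1 ?(ltW x0)// => H.
move: H; rewrite -(ler_pM2l p0) mulrDr mulr1 mulVKf ?(gt_eqF p0)//; lra.
Qed.

Lemma bregman1_le (h k : R) : 0 < h -> 0 < k -> bregman 1 h k <= (h - k) ^+ 2 / k.
Proof.
move=> h0 k0; rewrite bregmanE1.
have := @le_ln1Dx R (h / k - 1); rewrite subrKC ln_div ?posrE//.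
have hk : 0 < h / k by rewrite divr_gt0.
rewrite ltrBDl addrN hk => /(_ isT); rewrite -(ler_pM2l h0) => H.
rewrite ler_pdivlMr//.
have : h * (h / k - 1) * k = h * h - h * k by field; rewrite gt_eqF.
have := ler_wpM2r (ltW k0) H; nra.
Qed.

(** After division by k^p it reads 2 x^(p/2) <= 2 + p (x - 1) with x = h / k: Bernoulli with
    exponent p / 2 <= 1. *)
Lemma bregman_le (h k : R) : p != 1 -> 0 < h -> 0 < k ->
  bregman p h k <= (h `^ (p / 2) - k `^ (p / 2)) ^+ 2 / (p - 1).
Proof.
move=> p1 h0 k0; have p10 := p1_gt0 p1; rewrite bregman_scale ?(ltW h0)//.
have sq (a : R) : 0 < a -> a `^ p = (a `^ (p / 2)) ^+ 2.
  by move=> a0; rewrite -powR_mulrn ?powR_ge0// -powRrM divfK.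
have hk : 0 < h / k by rewrite divr_gt0.
have E : h `^ (p / 2) = (h / k) `^ (p / 2) * k `^ (p / 2).
  by rewrite -powRM ?(ltW hk) ?(ltW k0)// divfK// gt_eqF.
rewrite [leLHS]mulrA ler_pM2r ?invr_gt0//.
have -> : (h `^ (p / 2) - k `^ (p / 2)) ^+ 2 =
    k `^ p * ((h / k) `^ (p / 2) - 1) ^+ 2 by rewrite (sq k)// E; ring.
rewrite ler_wpM2l ?powR_ge0// (sq (h / k))//.
have := @powR_bernoulli R (h / k) (p / 2) hk.
rewrite (_ : 0 <= p / 2 <= 1); last by case/andP: hp => ? ?; apply/andP; split; lra.
by move=> /(_ isT); nra.
Qed.

(** A Stroock-Varopoulos inequality, replacing the chain rule for w = h^(p/2); the constant 1 is not
    sharp. By symmetry b <= a, and for p > 1 homogeneity leaves the ratio x = b / a <= 1. *)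
Lemma dissipation_powR (a b : R) : 0 < a -> 0 < b ->
  (a `^ (p / 2) - b `^ (p / 2)) ^+ 2 <= (a - b) * (dPhi p a - dPhi p b).
Proof.
wlog ba : a b / b <= a.
  move=> H a0 b0; have [ba|/ltW ab] := leP b a; first exact: H.
  by rewrite -sqrrN opprB (le_trans (H b a ab b0 a0))// -mulrNN !opprB.
move=> a0 b0; rewrite /dPhi; case: ifPn => [/eqP ->|p1].
  pose x := a `^ (1 / 2); pose y := b `^ (1 / 2).
  have x0 : 0 < x by rewrite powR_gt0.
  have y0 : 0 < y by rewrite powR_gt0.
  have aE : a = x ^+ 2 by rewrite /x -powR_mulrn ?powR_ge0// -powRrM divfK// powRr1 ?ltW.
  have bE : b = y ^+ 2 by rewrite /y -powR_mulrn ?powR_ge0// -powRrM divfK// powRr1 ?ltW.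
  rewrite -/x -/y aE bE !lnXn//.
  have yx : y <= x by rewrite -(ler_pXn2r (n := 2)) ?nnegrE ?(ltW x0) ?(ltW y0)// -aE -bE.
  have := @ln_ge1BV _ (x / y); rewrite divr_gt0// invf_div ln_div ?posrE// => /(_ isT).
  rewrite -(ler_pM2l x0) mulrBr mulr1 mulrCA divff ?gt_eqF// mulr1 => H.
  rewrite -mulrnBl subr_sqr expr2 -mulrA ler_wpM2l ?subr_ge0//.
  rewrite mulr2n.
  have : 0 <= ln x - ln y by rewrite subr_ge0 ler_ln ?posrE.
  nra.
have p10 := p1_gt0 p1.
have ab : a = a / b * b by rewrite divfK// gt_eqF.
set x := b / a; have x0 : 0 < x by rewrite divr_gt0.
have x1 : x <= 1 by rewrite ler_pdivrMr// mul1r.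
have bx : b = x * a by rewrite /x divfK// gt_eqF.
have sq : a `^ p = (a `^ (p / 2)) ^+ 2.
  by rewrite -powR_mulrn ?powR_ge0// -powRrM divfK.
have -> : (a `^ (p / 2) - b `^ (p / 2)) ^+ 2 = a `^ p * (1 - x `^ (p / 2)) ^+ 2.
  by rewrite sq bx powRM ?(ltW x0) ?(ltW a0)//; ring.
have -> : (a - b) * (p * (a `^ (p - 1) - 1) / (p - 1) - p * (b `^ (p - 1) - 1) / (p - 1))
   = a `^ p * (p / (p - 1) * ((1 - x) * (1 - x `^ (p - 1)))).
  have -> : a `^ p = a * a `^ (p - 1) by rewrite mulr_powRB1 ?ltW//; case/andP: hp => ? ?; lra.
  by rewrite {1}bx bx powRM ?(ltW x0) ?(ltW a0)//; field; rewrite gt_eqF.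
rewrite ler_wpM2l ?powR_ge0//.
have [p_ge1 p_le2] := andP hp.
have b1 : x `^ (p - 1) <= 1 + (p - 1) * (x - 1).
  by apply: powR_bernoulli => //; apply/andP; split; lra.
have b2 : x <= x `^ (p / 2).
  by rewrite -{1}[x]powRr1 ?(ltW x0)//; apply: ger_powR; [rewrite x0|lra].
have b3 : x `^ (p / 2) <= 1.
  have := @ge0_ler_powR R (p / 2); rewrite (_ : 0 <= p / 2); last by lra.
  by move=> /(_ isT x 1); rewrite !nnegrE (ltW x0) ler01 powR1; exact.
(* [b1] cancels the division by p - 1. By [b2] and [b3] the square (1 - x^(p/2))^2 is at most (1 -
   x)^2, and the leftover factor p >= 1 is given away. *)
have step : (p - 1) * (1 - x) ^+ 2 <= (1 - x) * (1 - x `^ (p - 1)) by nra.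
apply: (@le_trans _ _ ((1 - x) ^+ 2)).
  by rewrite ler_pXn2r ?nnegrE ?subr_ge0//; lra.
rewrite mulrAC ler_pdivlMr//.
have s0 := sqr_ge0 (1 - x).
have : 0 <= (p - 1) * (1 - x) ^+ 2 by rewrite mulr_ge0// ltW.
move: step; set Y := (1 - x) * _; set Z := (p - 1) * _ => ZY Z0.
by rewrite mulrC -/Z (le_trans ZY)// ler_peMl// (le_trans Z0).
Qed.

End entropy_function.

Section functional_inequality.
Variables (R : realType) (p : R) (T : finType) (m : T -> R) (l d : T -> T -> R).
Variables (C0 C1 : R).
Hypothesis hp : 1 <= p <= 2.
Hypotheses (m0 : forall K, 0 < m K) (l0 : forall K L, 0 <= l K L).
Hypotheses (lC : forall K L, l K L = l L K) (dC : forall K L, d K L = d L K).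
Hypothesis d0 : forall K L, l K L != 0 -> 0 < d K L.
Hypotheses (C0_ge0 : 0 <= C0) (C1_ge0 : 0 <= C1).
Hypothesis iso : forall A : {set T},
  \sum_(K in A) m K <= C0 * (\sum_(K in A) \sum_(L in ~: A) l K L) ^+ 2 \/
  \sum_(K in ~: A) m K <= C0 * (\sum_(K in A) \sum_(L in ~: A) l K L) ^+ 2.
Hypothesis ld : forall K, \sum_L l K L * d K L <= C1 * m K.

Lemma conductance_ge0 K L : 0 <= l K L / d K L.
Proof.
have [->|lKL] := eqVneq (l K L) 0; first by rewrite mul0r.
by rewrite divr_ge0// ltW// d0.
Qed.

(** Ordered pairs are summed, so each interface counts twice. *)
Definition dissipation (h : T -> R) : R :=
  \sum_K \sum_L l K L / d K L * ((h K - h L) * (dPhi p (h K) - dPhi p (h L))).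

Lemma dirichlet_le_dissipation (h : T -> R) : (forall K, 0 < h K) ->
  dirichlet l d (fun K => h K `^ (p / 2)) <= dissipation h.
Proof.
move=> h0; apply: ler_sum => K _; apply: ler_sum => L _.
by rewrite ler_wpM2l ?conductance_ge0// dissipation_powR.
Qed.

(* For p = 1 the term 8 / (p - 1) is 8 / 0 = 0. *)
Lemma entropy_functional_inequality (h : T -> R) (K0 : T) : (forall K, 0 < h K) ->
  exists2 k, 0 < k & \sum_K m K * bregman p (h K) k <=
    (144 + 8 / (p - 1)) * C0 * C1 * (\sum_K m K) * dissipation h.
Proof.
move=> h0; pose w K := h K `^ (p / 2).
have [K1 Hm] := fourth_moment m0 l0 lC dC d0 C0_ge0 C1_ge0 iso ld w K0.
set D := dirichlet l d w in Hm.
have D0 : 0 <= D := dirichlet_ge0 l0 d0 _.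
have DI : D <= dissipation h := dirichlet_le_dissipation h0.
set O := \sum_K m K in Hm *.
have O0 : 0 <= O by apply: sumr_ge0 => K _; exact: ltW.
pose f K := w K - w K1.
set F4 := \sum_K _ in Hm; pose F2 := \sum_K m K * f K ^+ 2.
have F20 : 0 <= F2 by apply: sumr_ge0 => K _; rewrite mulr_ge0 ?sqr_ge0// ltW.
(* The 8 absorbs the factor 2 of [fourth_moment] without a square root: 2 (4 y)^2 <= (8 y)^2. *)
pose B := 8 * C0 * C1 * D.
have B0 : 0 <= B by rewrite !mulr_ge0.
have F4B : F4 <= B ^+ 2 * O.
  apply: le_trans Hm _; rewrite mulrA ler_wpM2r//.
  rewrite (_ : B = 2 * (4 * C0 * C1 * D)); last by rewrite /B; ring.
  by move: (4 * C0 * C1 * D) => y; have := sqr_ge0 y; rewrite exprMn; nra.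
have F2B : F2 <= B * O.
  rewrite -(ler_pXn2r (n := 2)) ?nnegrE ?mulr_ge0//.
  have := cauchy_schwarz_sum (fun K => f K ^+ 2) (fun=> 1) (fun K => ltW (m0 K)).
  rewrite (eq_bigr (fun K => m K * f K ^+ 2)); last by move=> K _; rewrite mulr1.
  rewrite -/F2 (eq_bigr (fun K => m K * f K ^+ 4)); last first.
    by move=> K _; rewrite -exprM.
  rewrite -/F4 [X in _ <= _ * X -> _](eq_bigr m) => [|K _]; last by rewrite expr1n mulr1.
  rewrite -/O => h1; apply: le_trans h1 _.
  by rewrite exprMn expr2 (mulrA _ O O) ler_wpM2r.
have BO0 : 0 <= B * O by rewrite mulr_ge0.
have [p1|p1] := eqVneq p 1; last first.
  have p10 : 0 < p - 1 by rewrite subr_gt0 lt_neqAle eq_sym p1; case/andP: hp.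
  exists (h K1) => //.
  apply: (@le_trans _ _ (F2 / (p - 1))).
    rewrite /F2 mulr_suml; apply: ler_sum => K _.
    by rewrite -mulrA ler_wpM2l ?(ltW (m0 K))//; exact: bregman_le.
  apply: (@le_trans _ _ (B * O / (p - 1))); first by rewrite ler_wpM2r// invr_ge0 ltW.
  have -> : B * O / (p - 1) = 8 / (p - 1) * C0 * C1 * O * D by rewrite /B; ring.
  have c0 : 0 <= 8 / (p - 1) by rewrite divr_ge0// ltW.
  apply: ler_pM => //; first by rewrite mulr_ge0// mulr_ge0// mulr_ge0.
  rewrite !ler_wpM2r//; lra.
have wh K : w K ^+ 2 = h K.
  by rewrite /w p1 -powR_mulrn ?powR_ge0// -powRrM divfK// powRr1// ltW.
have c0 : 0 < w K1 by rewrite powR_gt0.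
rewrite p1 subrr invr0 mulr0 addr0.
(* The generic argument divides by B. If B = 0, the second moment vanishes and h is constant. *)
have [Bn|Bp] := leP B 0.
  have BE : B = 0 by apply/eqP; rewrite eq_le Bn B0.
  exists (h K1) => //; rewrite big1; first by rewrite !mulr_ge0// (le_trans D0).
  move=> K _; have : m K * f K ^+ 2 <= 0.
    apply: (@le_trans _ _ F2); last by rewrite (le_trans F2B)// BE mul0r.
    rewrite /F2 (bigD1 K)//= lerDl; apply: sumr_ge0 => L _.
    by rewrite mulr_ge0 ?sqr_ge0// ltW.
  rewrite pmulr_rle0// => fK; have /eqP : f K ^+ 2 = 0.
    by apply/eqP; rewrite eq_le fK sqr_ge0.
  rewrite sqrf_eq0 subr_eq0 => /eqP wK.
  have -> : h K = h K1 by rewrite -!wh wK.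
  by rewrite bregmanE1; ring.
have k0 : 0 < h K1 + B by rewrite addr_gt0.
(* Adding B to the squared median bounds the denominator k below by B, which tames the quartic part
   of (h - k)^2 / k, while the shift itself costs only B^2 / k <= B. *)
exists (h K1 + B) => //.
have termwise K : bregman 1 (h K) (h K1 + B) <= 12 * f K ^+ 2 + 3 * f K ^+ 4 / B + 3 * B.
  apply: le_trans (bregman1_le _ _) _ => //; rewrite ler_pdivrMr//.
  have -> : h K - (h K1 + B) = 2 * w K1 * f K + f K ^+ 2 - B.
    by rewrite -!wh /f; ring.
  set c := w K1 in c0 *; set x := f K.
  have -> : h K1 = c ^+ 2 by rewrite /c wh.
  set y := x ^+ 2; have y0 : 0 <= y := sqr_ge0 _.
  have -> : x ^+ 4 = y ^+ 2 by rewrite /y -exprM.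
  (* The square of a sum of three terms is at most three times the sum of their squares, hence 12, 3
     and 3. *)
  have s3 : (2 * c * x + y - B) ^+ 2 <= 12 * (c ^+ 2 * y) + 3 * y ^+ 2 + 3 * B ^+ 2.
    have e1 := sqr_ge0 (2 * c * x - y); have e2 := sqr_ge0 (2 * c * x + B).
    have e3 := sqr_ge0 (y + B); rewrite /y in e1 e2 e3 *; nra.
  apply: le_trans s3 _.
  have z0 : 0 <= 3 * y ^+ 2 / B by rewrite divr_ge0// mulr_ge0// sqr_ge0.
  have zB : 3 * y ^+ 2 / B * B = 3 * y ^+ 2 by rewrite divfK// gt_eqF.
  have cc : 0 <= c ^+ 2 := sqr_ge0 _.
  have -> : (12 * y + 3 * y ^+ 2 / B + 3 * B) * (c ^+ 2 + B) =
      12 * (c ^+ 2 * y) + 12 * y * B + 3 * y ^+ 2 / B * c ^+ 2 + 3 * y ^+ 2 +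
      3 * B * c ^+ 2 + 3 * B ^+ 2 by rewrite -{3}zB; ring.
  have : 0 <= 3 * y ^+ 2 / B * c ^+ 2 := mulr_ge0 z0 cc.
  have : 0 <= 12 * y * B by apply: mulr_ge0 => //; apply: mulr_ge0.
  have : 0 <= 3 * B * c ^+ 2 by apply: mulr_ge0 => //; apply: mulr_ge0.
  lra.
apply: (@le_trans _ _ (12 * F2 + 3 / B * F4 + 3 * B * O)).
  rewrite /F2 /F4 /O !mulr_sumr -!big_split/=; apply: ler_sum => K _.
  apply: le_trans (ler_wpM2l (ltW (m0 K)) (termwise K)) _.
  by rewrite le_eqVlt; apply/orP; left; apply/eqP; rewrite /f; field; rewrite gt_eqF.
have : 3 / B * F4 <= 3 * B * O.
  apply: (@le_trans _ _ (3 / B * (B ^+ 2 * O))).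
    by rewrite ler_wpM2l// divr_ge0// ltW.
  by rewrite le_eqVlt; apply/orP; left; apply/eqP; field; rewrite gt_eqF.
(* The three sums contribute 12, 3 and 3 times B O, and 18 * 8 = 144. *)
have : 144 * C0 * C1 * O * D <= 144 * C0 * C1 * O * dissipation h.
  by rewrite ler_wpM2l// !mulr_ge0.
rewrite (_ : 144 * C0 * C1 * O * D = 18 * (B * O)); last by rewrite /B; ring.
lra.
Qed.

End functional_inequality.

(** * One step of the scheme *)

(** Discrete integration by parts: exchanging the indices changes the sign of the double sum. *)
Lemma sum_antisym (R : realFieldType) (T : finType) (g : T -> T -> R) (y : T -> R) :
  (forall K L, g L K = - g K L) ->
  \sum_K y K * (\sum_L g K L) = 2^-1 * \sum_K \sum_L g K L * (y K - y L).
Proof.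
move=> gN.
have E : \sum_K \sum_L g K L * y L = - \sum_K \sum_L g K L * y K.
  rewrite exchange_big /= -sumrN; apply: eq_bigr => K _; rewrite -sumrN.
  by apply: eq_bigr => L _; rewrite gN mulNr.
have -> : \sum_K \sum_L g K L * (y K - y L) = 2 * \sum_K \sum_L g K L * y K.
  transitivity (\sum_K \sum_L g K L * y K - \sum_K \sum_L g K L * y L).
    rewrite -sumrB; apply: eq_bigr => K _.
    by rewrite -sumrB; apply: eq_bigr => L _; rewrite mulrBr.
  by rewrite E opprK -mulr2n mulr_natl.
rewrite mulrA mulVf ?pnatr_eq0// mul1r; apply: eq_bigr => K _.
by rewrite mulr_sumr; apply: eq_bigr => L _; rewrite mulrC.
Qed.

Section scheme_step.
Variables (R : realType) (p : R) (T : finType) (m V : T -> R) (a : T -> T -> R).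
Variables (r : R -> R -> R) (rho Vb dt : R) (u v : T -> R).
Hypothesis hp : 1 <= p <= 2.
Hypotheses (m0 : forall K, 0 < m K) (a0 : forall K L, 0 <= a K L).
Hypothesis aC : forall K L, a K L = a L K.
Hypothesis rP : admissible_mean r.
Hypotheses (rho0 : 0 < rho) (VVb : forall K, `|V K| <= Vb) (dt0 : 0 < dt).
Hypotheses (u0 : forall K, 0 < u K) (v0 : forall K, 0 <= v K).
Hypothesis scheme : forall K, m K * ((u K - v K) / dt) -
  \sum_L a K L * (r (u K) (u L) * (ln (u L) + V L - ln (u K) - V K)) = 0.

Let g K L := a K L * (r (u K) (u L) * (ln (u L) + V L - ln (u K) - V K)).

Let gN K L : g L K = - g K L.
Proof. by rewrite /g aC (mean_sym rP)//; ring. Qed.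

Let increment K : m K * (u K - v K) = dt * \sum_L g K L.
Proof.
move/eqP: (scheme K); rewrite subr_eq0 => /eqP <-.
by field; rewrite gt_eqF.
Qed.

(** The antisymmetric fluxes are tested against the constant 1. *)
Lemma mass_step : \sum_K m K * u K = \sum_K m K * v K.
Proof.
apply/eqP; rewrite -subr_eq0 -sumrB; apply/eqP.
rewrite (eq_bigr (fun K => dt * (1 * \sum_L g K L))); last first.
  by move=> K _; rewrite -mulrBr increment mul1r.
rewrite -mulr_sumr (sum_antisym (fun=> 1) gN) big1 ?mulr0// => K _.
by rewrite big1// => L _; rewrite subrr mulr0.
Qed.

Definition equilibrium K := rho * expR (- V K).

Let eq0 K : 0 < equilibrium K.
Proof. by rewrite mulr_gt0// expR_gt0. Qed.

Definition entropy (x : T -> R) : R :=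
  \sum_K m K * equilibrium K * Phi p (x K / equilibrium K).

Let h K := u K / equilibrium K.

Let h0 K : 0 < h K.
Proof. by rewrite divr_gt0. Qed.

Let hE K : u K = equilibrium K * h K.
Proof. by rewrite /h mulrC divfK// gt_eqF. Qed.

Lemma dPhi_monotone x y : 0 < x -> 0 < y -> x <= y -> dPhi p x <= dPhi p y.
Proof.
move=> x0 y0 xy; rewrite /dPhi; case: ifPn => [_|p1]; first by rewrite ler_ln ?posrE.
have [p_ge1 _] := andP hp.
have p10 : 0 < p - 1 by rewrite subr_gt0 lt_neqAle eq_sym p1.
rewrite ler_pM2r ?invr_gt0// ler_pM2l ?(lt_le_trans ltr01)// lerD2r.
by apply: (ge0_ler_powR (ltW p10)) => //; rewrite nnegrE ltW.
Qed.

Let low := rho * expR (- Vb).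

Let low0 : 0 < low.
Proof. by rewrite mulr_gt0// expR_gt0. Qed.

Let low_le K : low <= equilibrium K.
Proof.
rewrite ler_pM2l// ler_expR lerN2.
by apply: le_trans (VVb K); rewrite ler_norm.
Qed.

(** The potential is absorbed by ln u + V = ln rho + ln h. Since u >= low h, monotonicity and
    homogeneity give r (u K) (u L) >= low * r (h K) (h L), then the logarithmic mean cancels ln h K
    - ln h L. That difference and the one of [dPhi] have the same sign. *)
Let flux K L : low * ((h K - h L) * (dPhi p (h K) - dPhi p (h L))) <=
  r (u K) (u L) * (ln (u K) + V K - ln (u L) - V L) * (dPhi p (h K) - dPhi p (h L)).
Proof.
have lnE J : ln (u J) + V J = ln rho + ln (h J).
  have -> : ln (u J) = ln (equilibrium J) + ln (h J).
    by rewrite {1}(hE J) lnM ?posrE.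
  by rewrite /equilibrium lnM ?posrE ?expR_gt0// expRK; ring.
have -> : ln (u K) + V K - ln (u L) - V L = ln (h K) - ln (h L).
  by rewrite -addrA -opprD !lnE; ring.
have [->|hKL] := eqVneq (h K) (h L); first by rewrite !subrr !(mul0r, mulr0).
have lnn : ln (h K) - ln (h L) != 0.
  by rewrite subr_eq0; apply: contra_neq hKL; apply: ln_inj; rewrite posrE.
have lh0 J : 0 < low * h J := mulr_gt0 low0 (h0 J).
have rlow : low * ((h K - h L) / (ln (h K) - ln (h L))) <= r (u K) (u L).
  apply: (@le_trans _ _ (low * r (h K) (h L))).
    by rewrite ler_wpM2l ?(ltW low0)//; have /andP[] := mean_bounds rP (h0 K) (h0 L) hKL.
  rewrite -(mean_homog rP)//.
  apply: (@le_trans _ _ (r (u K) (low * h L))).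
    apply: (mean_mono_l rP); [exact: lh0|exact: lh0|].
    by rewrite hE ler_wpM2r// ltW.
  apply: (mean_mono_r rP) => //.
  by rewrite hE ler_wpM2r// ltW.
have mono : 0 <= (ln (h K) - ln (h L)) * (dPhi p (h K) - dPhi p (h L)).
  have [KL|LK] := leP (h K) (h L).
    by apply: mulr_le0; rewrite subr_le0; [rewrite ler_ln ?posrE|exact: dPhi_monotone].
  have {}LK := ltW LK.
  by apply: mulr_ge0; rewrite subr_ge0; [rewrite ler_ln ?posrE|exact: dPhi_monotone].
rewrite -mulrA; apply: le_trans (ler_wpM2r mono rlow).
move: lnn; move: (ln (h K) - _) (h K - h L) (dPhi p (h K) - _) low => x y z w x0.
by rewrite le_eqVlt; apply/orP; left; apply/eqP; field.
Qed.

Definition graph_dissipation (x : T -> R) : R :=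
  \sum_K \sum_L a K L * ((x K - x L) * (dPhi p (x K) - dPhi p (x L))).

(** The scheme is tested with y = [dPhi p] of the new ratio; the 1/2 is that of the summation by
    parts over ordered pairs. *)
Lemma entropy_step :
  entropy u + dt * (low / 2) * graph_dissipation h <= entropy v.
Proof.
pose y K := dPhi p (h K).
(* Tangent inequality at the new, positive value; the old value v K may be 0. *)
have conv K : m K * equilibrium K * Phi p (h K) - m K * (u K - v K) * y K <=
    m K * equilibrium K * Phi p (v K / equilibrium K).
  have := bregman_ge0 hp (divr_ge0 (v0 K) (ltW (eq0 K))) (h0 K).
  rewrite /bregman -/(y K) => B0.
  have -> : m K * (u K - v K) * y K =
      m K * equilibrium K * (y K * (h K - v K / equilibrium K)).
    rewrite {1}(hE K); have := eq0 K; move: (equilibrium K) (h K) (y K) => e x z e_gt0.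
    by field; rewrite gt_eqF.
  rewrite -mulrBr; apply: ler_wpM2l; first by rewrite mulr_ge0// ltW.
  move: B0; move: (v K / _) (h K) (y K) (Phi p (h K)) (Phi p (v K / _)) => z x c A B; lra.
have sumle : entropy u - \sum_K m K * (u K - v K) * y K <= entropy v.
  by rewrite /entropy -sumrB; apply: ler_sum => K _; exact: conv.
apply: le_trans sumle; rewrite lerD2l.
rewrite (eq_bigr (fun K => dt * (y K * \sum_L g K L))); last first.
  by move=> K _; rewrite increment; ring.
rewrite -mulr_sumr (sum_antisym y gN) -mulrA -mulrN ler_pM2l//.
rewrite (mulrC low) -mulrA -mulrN ler_pM2l ?invr_gt0//.
rewrite /graph_dissipation mulr_sumr -sumrN; apply: ler_sum => K _.
rewrite mulr_sumr -sumrN; apply: ler_sum => L _.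
have -> : - (g K L * (y K - y L)) = a K L *
    (r (u K) (u L) * (ln (u K) + V K - ln (u L) - V L) * (y K - y L)).
  by rewrite /g; move: (y K) (y L) (r _ _) => x z w; ring.
by rewrite mulrCA ler_wpM2l//; exact: flux.
Qed.

(** Equal masses let any multiple of x - u^oo be subtracted for free, which turns each summand into
    a Bregman divergence at 1. *)
Lemma entropy_ge0 (x : T -> R) : (forall K, 0 <= x K) ->
  \sum_K m K * x K = \sum_K m K * equilibrium K -> 0 <= entropy x.
Proof.
move=> x0 mE; have -> : 0 = \sum_K m K * equilibrium K * 0.
  by rewrite big1// => K _; rewrite mulr0.
have -> : entropy x = \sum_K m K * equilibrium K * bregman p (x K / equilibrium K) 1.
  have E : \sum_K (m K * x K - m K * equilibrium K) * dPhi p 1 = 0.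
    by rewrite -mulr_suml sumrB mE subrr mul0r.
  transitivity (entropy x -
      \sum_K (m K * x K - m K * equilibrium K) * dPhi p 1); first by rewrite E subr0.
  rewrite /entropy -sumrB; apply: eq_bigr => K _.
  rewrite /bregman (Phi1 hp) subr0; have := eq0 K.
  move: (equilibrium K) (dPhi p 1) (Phi p _) => e c A e_gt0; field.
  by rewrite gt_eqF.
apply: ler_sum => K _; apply: ler_wpM2l; first by rewrite mulr_ge0// ltW.
by apply: bregman_ge0 => //; rewrite divr_ge0// ltW.
Qed.

(** As h has mean 1 for the weights m u^oo, passing from k to 1 changes the weighted Bregman sum by
    the nonnegative amount [bregman p 1 k] times the total weight. The summands being nonnegative,
    the weight can then be replaced by its upper bound. *)
Lemma entropy_le_bregman k : 0 < k ->
  \sum_K m K * u K = \sum_K m K * equilibrium K ->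
  entropy u <= rho * expR Vb * \sum_K m K * bregman p (h K) k.
Proof.
move=> k0 mE.
apply: (@le_trans _ _ (\sum_K m K * equilibrium K * bregman p (h K) k)).
  set S := \sum_K m K * equilibrium K.
  have S0 : 0 <= S by apply: sumr_ge0 => K _; rewrite mulr_ge0// ltW.
  have tangent := bregman_ge0 hp ler01 k0.
  rewrite /bregman (Phi1 hp) in tangent.
  have -> : entropy u = \sum_K m K * equilibrium K * bregman p (h K) k +
      (Phi p k + dPhi p k * (1 - k)) * S.
    have E : \sum_K (m K * u K - m K * equilibrium K) * dPhi p k = 0.
      by rewrite -mulr_suml sumrB mE subrr mul0r.
    transitivity (entropy u -
      \sum_K (m K * u K - m K * equilibrium K) * dPhi p k); first by rewrite E subr0.
    rewrite /entropy /S mulr_sumr -big_split -sumrB; apply: eq_bigr => K _ /=.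
    rewrite /bregman -/(h K) {1}(hE K).
    move: (h K) (equilibrium K) (Phi p (h K)) (Phi p k) (dPhi p k) => x e B A c; ring.
  rewrite gerDl; have : Phi p k + dPhi p k * (1 - k) <= 0 by lra.
  by move=> ?; rewrite mulr_le0_ge0.
rewrite mulr_sumr; apply: ler_sum => K _.
have mB : 0 <= m K * bregman p (h K) k.
  by apply: mulr_ge0; [exact: ltW|apply: bregman_ge0 => //; exact: ltW].
have -> : m K * equilibrium K * bregman p (h K) k =
    equilibrium K * (m K * bregman p (h K) k) by rewrite mulrA (mulrC (m K)).
apply: (ler_wpM2r mB).
rewrite ler_pM2l// ler_expR; apply: le_trans (VVb K).
by rewrite -normrN ler_norm.
Qed.

(** The entropy is at most rho e^Vb CF I and the loss at least dt rho e^(-Vb) I / 2; rho cancels in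
    the quotient, so the rate is free of the mass. *)
Lemma entropy_contraction (CF : R) : 0 < CF ->
  \sum_K m K * u K = \sum_K m K * equilibrium K ->
  (exists2 k, 0 < k & \sum_K m K * bregman p (h K) k <= CF * graph_dissipation h) ->
  (1 + expR (- Vb) / (2 * CF * expR Vb) * dt) * entropy u <= entropy v.
Proof.
move=> CF0 mE [k k0 Hk]; have E1 := entropy_step.
have E2 := entropy_le_bregman k0 mE.
set I := graph_dissipation h in Hk E1.
have {}E2 : entropy u <= rho * expR Vb * (CF * I).
  by apply: le_trans E2 _; rewrite ler_wpM2l// mulr_ge0 ?expR_ge0// ltW.
have e0 : 0 < expR Vb := expR_gt0 _.
apply: le_trans E1; rewrite mulrDl mul1r lerD2l.
have q0 : 0 <= expR (- Vb) / (2 * CF * expR Vb) * dt.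
  by rewrite mulr_ge0 ?(ltW dt0)// divr_ge0 ?expR_ge0// !mulr_ge0 ?(ltW CF0) ?(ltW e0).
apply: le_trans (ler_wpM2l q0 E2) _; rewrite le_eqVlt; apply/orP; left; apply/eqP.
by rewrite /low; field; rewrite !gt_eqF.
Qed.

End scheme_step.

(** * Lebesgue measure of the plane *)

(** The pushforward scaled by |a| agrees with Lebesgue measure on half-open intervals; for a < 0 the
    preimage is half-open on the other side, with the same length. *)
Lemma lebesgue_measure_affine (R : realType) (a b : R) (S : set R) :
  a != 0 -> measurable S ->
  lebesgue_measure [set y : R | S (a * y + b)] =
  (`|a|^-1%:E * lebesgue_measure S)%E.
Proof.
move=> a0 mS.
have mf : measurable_fun [set: measurableTypeR R]
    (fun y => a * y + b : measurableTypeR R).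
  by apply: measurable_funD => //; apply: measurable_funM.
have na0 : 0 <= `|a| by [].
pose mu := mscale (NngNum na0)
  (pushforward (@lebesgue_measure R) (fun y => a * y + b : measurableTypeR R)).
have E : lebesgue_measure S = mu mf S.
  apply: lebesgue_measure_unique => //= _ [[x y] _ <-] /=.
  rewrite /mu /mscale /=.
  have [xy|yx] := ltP x y; last first.
    by rewrite set_itv_ge ?bnd_simp -?leNgt// !measure0 ?mule0.
  rewrite /pushforward; have [ap|an|E0] := ltgtP 0 a; last by move: a0; rewrite -E0 eqxx.
  - rewrite [X in (_ * lebesgue_measure X)%E](_ : _ = `](x - b) / a, (y - b) / a]%classic).
      rewrite !lebesgue_measure_itv/= !lte_fin xy ltr_pM2r ?invr_gt0// ltrD2r xy.
      rewrite -!EFinB -EFinM; congr (_ %:E); rewrite gtr0_norm//; field.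
      by rewrite gt_eqF.
    apply/seteqP; split => z /=; rewrite !in_itv/= ltr_pdivrMr// ler_pdivlMr//.
      by move=> /andP[? ?]; apply/andP; split; lra.
    by move=> /andP[? ?]; apply/andP; split; lra.
  - rewrite [X in (_ * lebesgue_measure X)%E](_ : _ = `[(y - b) / a, (x - b) / a[%classic).
      rewrite !lebesgue_measure_itv/= !lte_fin xy ltr_nM2r ?invr_lt0// ltrD2r xy.
      rewrite -!EFinB -EFinM; congr (_ %:E); rewrite ltr0_norm//; field.
      by rewrite lt_eqF.
    apply/seteqP; split => z /=; rewrite !in_itv/= ltr_ndivlMr// ler_ndivrMr//.
      by move=> /andP[? ?]; apply/andP; split; lra.
    by move=> /andP[? ?]; apply/andP; split; lra.
rewrite E /mu /mscale /pushforward /= muleA -EFinM mulVf ?mul1e ?normr_eq0//.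
Qed.

(** The plane carries the product sigma-algebra, so U is written as a countable union of boxes with
    rational corners. *)
Lemma open_measurable2 (R : realType) (U : set (R * R)) : open U ->
  measurable (U : set (measurableTypeR R * measurableTypeR R)).
Proof.
move=> oU.
pose box (a b c d : rat) : set (R * R) :=
  `]ratr a, ratr b[%classic `*` `]ratr c, ratr d[%classic.
rewrite (_ : U = \bigcup_(a : rat) \bigcup_(b : rat) \bigcup_(c : rat)
   \bigcup_(d : rat) [set z | box a b c d z /\ box a b c d `<=` U]).
  apply: bigcupT_measurable_rat => a; apply: bigcupT_measurable_rat => b.
  apply: bigcupT_measurable_rat => c.
  apply: bigcupT_measurable_rat => d.
  have [sub|nsub] := pselect (box a b c d `<=` U).
    rewrite (_ : [set _ | _] = box a b c d).
      by apply: measurableX; exact: measurable_itv.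
    by apply/seteqP; split => [z []|z ].
  by rewrite (_ : [set _ | _] = set0)//; apply/seteqP; split => [z []|z ].
apply/seteqP; split => [[x y] Uxy|z [a _ [b _ [c _ [d _ [boxz sub]]]]]]; last exact: sub.
have /nbhs_ballP[e /= e0 sub] : nbhs (x, y) U by apply: open_nbhs_nbhs.
have /rat_in_itvoo[a] : x - e < x by rewrite gtrBl.
have /rat_in_itvoo[b] : x < x + e by rewrite ltrDl.
have /rat_in_itvoo[c] : y - e < y by rewrite gtrBl.
have /rat_in_itvoo[d] : y < y + e by rewrite ltrDl.
rewrite !in_itv/= => /andP[yd de] /andP[ec cy] /andP[xb be] /andP[ea ax].
exists a => //; exists b => //; exists c => //; exists d => //.
split; first by split; rewrite /= in_itv/=; apply/andP.
move=> [u v] [] /=; rewrite !in_itv/= => /andP[au ub] /andP[cv vd].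
by apply: sub; split; rewrite /ball /= ltr_norml; apply/andP; split; lra.
Qed.

Lemma closed_measurable2 (R : realType) (U : set (R * R)) : closed U ->
  measurable (U : set (measurableTypeR R * measurableTypeR R)).
Proof.
by move=> cU; rewrite -[U]setCK; apply: measurableC;
   apply: open_measurable2; rewrite openC.
Qed.

Definition lin_set (R : realType) (a b c a' b' c' : R) (X Y : set R) : set (R * R) :=
  [set z | X (a * z.1 + b * z.2 + c) /\ Y (a' * z.1 + b' * z.2 + c')].

Lemma measurable_lin (R : realType) (a b c : R) :
  measurable_fun [set: measurableTypeR R * measurableTypeR R]
    (fun z => a * z.1 + b * z.2 + c : measurableTypeR R).
Proof.
apply: measurable_funD => //.
by apply: measurable_funD; apply: measurable_funM.
Qed.

Lemma measurable_lin_set (R : realType) (a b c a' b' c' : R) (X Y : set R) :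
  measurable X -> measurable Y ->
  measurable (lin_set a b c a' b' c' X Y :
    set (measurableTypeR R * measurableTypeR R)).
Proof.
move=> mX mY; rewrite (_ : lin_set _ _ _ _ _ _ _ _ =
  (fun z : R * R => a * z.1 + b * z.2 + c) @^-1` X `&`
  (fun z : R * R => a' * z.1 + b' * z.2 + c') @^-1` Y)//.
by apply: measurableI; rewrite -[X in measurable X]setTI; apply: measurable_lin.
Qed.

Section lin_measure.
Variable R : realType.
Let T := (measurableTypeR R * measurableTypeR R)%type.
Local Notation leb := (@lebesgue_measure R).

Lemma leb2_shear (a b c : R) (X Y : set R) :
  measurable X -> measurable Y -> a != 0 ->
  leb2 R (lin_set a b c 0 1 0 X Y) = (`|a|^-1%:E * (leb X * leb Y))%E.
Proof.
move=> mX mY a0.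
have mS := @measurable_lin_set R a b c 0 1 0 _ _ mX mY.
have -> : leb2 R (lin_set a b c 0 1 0 X Y) =
   ((@lebesgue_measure R) \x^ (@lebesgue_measure R))%E (lin_set a b c 0 1 0 X Y).
  apply: product_measure_unique => //= A B mA mB.
  by rewrite product_measure2E.
rewrite /product_measure2 /=.
rewrite (eq_integral (fun y : measurableTypeR R => (`|a|^-1%:E * leb X) * (\1_Y y)%:E)%E); last first.
  move=> y _ /=; rewrite indicE.
  have [/set_mem yY|yY] := boolP (y \in Y).
    rewrite mule1 -(lebesgue_measure_affine (b * y + c) a0 mX).
    congr (leb _); apply/seteqP; split => x; rewrite /ysection /lin_set /= inE /=.
      by rewrite addrA => -[].
    by rewrite addrA => ?; split => //; rewrite mul0r add0r mul1r addr0.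
  move/negP: yY; rewrite in_setE => yY.
  rewrite mule0 [X in leb X](_ : _ = set0) ?measure0//.
  apply/seteqP; split => x //; rewrite /ysection /lin_set /= inE /=.
  by rewrite mul0r add0r mul1r addr0 => -[].
rewrite ge0_integralZl ?integral_indic ?setIT//.
- by rewrite muleA.
- exact: measurableT_comp.
- by rewrite mule_ge0.
Qed.

Lemma leb2_lin_set (a b c a' b' c' : R) (X Y : set R) :
  measurable X -> measurable Y -> a * b' - a' * b != 0 ->
  leb2 R (lin_set a b c a' b' c' X Y) =
  (`|a * b' - a' * b|^-1%:E * (leb X * leb Y))%E.
Proof.
wlog b'0 : a b c a' b' c' X Y / b' != 0.
  move=> H mX mY d0; have [b'0|] := eqVneq b' 0; last by move=> /H; apply.
  rewrite (_ : lin_set _ _ _ _ _ _ _ _ = lin_set a' b' c' a b c Y X); last first.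
    by apply/seteqP; split => z [].
  rewrite H//.
  - by rewrite distrC muleC [in RHS]muleC (muleC (leb Y)).
  - by apply: contra_neq d0 => ->; rewrite b'0; ring.
  - by rewrite -oppr_eq0 opprB.
move=> mX mY d0.
(* W lives in the variables (x, a' x + b' y + c'): this substitution in y reduces the map to a
   shear. *)
pose W := lin_set (a - b * a' / b') (b / b') (c - b * c' / b') 0 1 0 X Y.
have mW := @measurable_lin_set R (a - b * a' / b') (b / b') (c - b * c' / b') 0 1 0 _ _ mX mY.
rewrite /leb2 /= /product_measure1 /=.
rewrite (eq_integral (fun x : measurableTypeR R => `|b'|^-1%:E * leb (xsection W x))%E); last first.
  move=> x _ /=; rewrite -(lebesgue_measure_affine (a' * x + c') b'0); last first.
    exact: measurable_xsection.
  congr (leb _); apply/seteqP; split => y; rewrite /xsection /W /lin_set /= !inE /=.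
    move=> [Xx Yy]; split; [move: Xx|move: Yy]; congr (_ _); last by ring.
    by field.
  move=> [Xx Yy]; split; [move: Xx|move: Yy]; congr (_ _); last by ring.
  by field.
rewrite ge0_integralZl//; last first.
  exact: measurable_fun_xsection.
have := @leb2_shear (a - b * a' / b') (b / b') (c - b * c' / b') X Y mX mY.
rewrite /leb2 /= /product_measure1 /= => ->; last first.
  apply: contra_neq d0 => d0.
  by rewrite (_ : _ - _ = (a - b * a' / b') * b'); [rewrite d0 mul0r|field].
rewrite muleA -EFinM; congr (_%:E * _)%E.
rewrite -invfM -normrM; congr (`| _ |^-1); field.
exact: b'0.
Qed.

End lin_measure.

(** * Projections of segments and of sets of zero length *)

Definition affine_form (R : realType) (a b c : R) (z : R * R) : R :=
  a * z.1 + b * z.2 + c.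

Lemma fst_addZ (R : realType) (p v : R * R) (t : R) :
  (p + t *: v).1 = p.1 + t * v.1.
Proof. by []. Qed.

Lemma snd_addZ (R : realType) (p v : R * R) (t : R) :
  (p + t *: v).2 = p.2 + t * v.2.
Proof. by []. Qed.

Lemma edist_ge0 (R : realType) (z w : R * R) : 0 <= edist z w.
Proof. exact: sqrtr_ge0. Qed.

Lemma dot_ge0 (R : realType) (z : R * R) : 0 <= dot z z.
Proof. by rewrite /dot addr_ge0// -expr2 sqr_ge0. Qed.

Lemma dot_eq0 (R : realType) (z : R * R) : dot z z = 0 -> z = 0.
Proof.
case: z => x y; rewrite /dot /= => /eqP.
by rewrite paddr_eq0 -?expr2 ?sqr_ge0// !sqrf_eq0 => /andP[/eqP -> /eqP ->].
Qed.

Lemma sqr_edist (R : realType) (z w : R * R) :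
  edist z w ^+ 2 = dot (z - w) (z - w).
Proof. by rewrite sqr_sqrtr// dot_ge0. Qed.

Lemma le_edist1 (R : realType) (z w : R * R) : `|z.1 - w.1| <= edist z w.
Proof.
rewrite -sqrtr_sqr ler_wsqrtr// /dot /=.
by rewrite -expr2 lerDl -expr2 sqr_ge0.
Qed.

Lemma le_edist2 (R : realType) (z w : R * R) : `|z.2 - w.2| <= edist z w.
Proof.
rewrite -sqrtr_sqr ler_wsqrtr// /dot /=.
by rewrite -!expr2 lerDr sqr_ge0.
Qed.

Lemma affine_form_lip (R : realType) (a b c : R) (z w : R * R) :
  `|affine_form a b c z - affine_form a b c w| <= (`|a| + `|b|) * edist z w.
Proof.
rewrite (_ : _ - _ = a * (z.1 - w.1) + b * (z.2 - w.2)); last first.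
  by rewrite /affine_form; ring.
rewrite (le_trans (ler_normD _ _))// !normrM mulrDl lerD// ler_wpM2l//.
  exact: le_edist1.
exact: le_edist2.
Qed.

(** The form is Lipschitz, so a disc of radius r projects into an interval of length 2 L r; the 1 in
    L keeps it positive when a = b = 0. *)
Lemma zero_length_proj (R : realType) (a b c : R) (A : set (R * R)) (e : R) :
  zero_length A -> 0 < e ->
  exists X : set R, [/\ measurable X, forall z, A z -> X (affine_form a b c z)
    & (lebesgue_measure X <= e%:E)%E].
Proof.
move=> zA e0; pose L := `|a| + `|b| + 1.
have L0 : 0 < L by rewrite ltr_wpDl// addr_ge0.
have [|p [r [r0 sub sumr]]] := zA (e / (2 * L)); first by rewrite divr_gt0// mulr_gt0.
pose I i := `[affine_form a b c (p i) - L * r i, affine_form a b c (p i) + L * r i]%classic.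
have mI i : measurable (I i) by exact: measurable_itv.
exists (\bigcup_i I i); split; first exact: bigcupT_measurable.
  move=> z /sub[i _ /= pz]; exists i => //; rewrite /I /= in_itv/=.
  rewrite -ler_distl distrC (le_trans (affine_form_lip _ _ _ _ _))//.
  apply: (@le_trans _ _ (L * edist (p i) z)); last by rewrite ler_pM2l.
  by rewrite ler_wpM2r ?edist_ge0// lerDl.
apply: (@le_trans _ _ (\sum_(0 <= i <oo) lebesgue_measure (I i))%E).
  apply: measure_sigma_subadditive => //; first exact: bigcupT_measurable.
rewrite (eq_eseriesr (g := fun i => ((2 * L)%:E * (r i)%:E)%E)); last first.
  move=> i _; rewrite lebesgue_measure_itv/= lte_fin.
  case: ifPn => [_|]; first by rewrite -EFinB -EFinM; congr _%:E; ring.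
  rewrite -leNgt => h; rewrite -EFinM; congr _%:E.
  have : 0 <= L * r i by rewrite mulr_ge0// ltW.
  by nra.
rewrite nneseriesZl//.
  apply: (@le_trans _ _ ((2 * L)%:E * (e / (2 * L))%:E)%E).
    by apply: lee_wpmul2l => //; rewrite lee_fin mulr_ge0// ltW.
  by rewrite -EFinM lee_fin mulrC divfK// mulf_neq0// gt_eqF.
by move=> i _; rewrite lee_fin.
Qed.

Lemma segment_proj (R : realType) (a b c : R) (p q : R * R) :
  exists X : set R, [/\ measurable X,
    forall z, segment p q z -> X (affine_form a b c z)
    & (lebesgue_measure X <= ((`|a| + `|b|) * edist p q)%:E)%E].
Proof.
set f := affine_form a b c.
exists (`[Num.min (f p) (f q), Num.max (f p) (f q)]%classic); split.
- exact: measurable_itv.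
- move=> _ [t /= + <-]; rewrite !in_itv/= => /andP[t0 t1].
  have -> : f (p + t *: (q - p)) = f p + t * (f q - f p).
    by rewrite /f /affine_form fst_addZ snd_addZ /=; ring.
  by case: (leP (f p) (f q)) => pq; apply/andP; split; nra.
- rewrite lebesgue_measure_itv/= lte_fin.
  have := affine_form_lip a b c p q; rewrite -/f.
  case: ifPn => h; last by rewrite lee_fin mulr_ge0 ?addr_ge0 ?edist_ge0.
  rewrite -EFinB lee_fin; apply: le_trans.
  case: (leP (f p) (f q)) => pq; first by rewrite distrC ler_norm.
  by rewrite ler_norm.
Qed.

(** The affine form that parametrizes the segment maps it onto [0, 1], which no set of measure 1 / 2
    contains. *)
Lemma segment_not_zero_length (R : realType) (p q : R * R) :
  p != q -> ~ zero_length (segment p q).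
Proof.
move=> pq /zero_length_proj h.
pose n := dot (q - p) (q - p).
have n0 : n != 0.
  by apply: contra_neq pq => /dot_eq0 /eqP; rewrite subr_eq0 => /eqP.
have [|X [mX sX sX']] := h ((q.1 - p.1) / n) ((q.2 - p.2) / n)
   (- (p.1 * (q.1 - p.1) + p.2 * (q.2 - p.2)) / n) (1 / 2); first by lra.
have sub : `[0, 1]%classic `<=` X.
  move=> t t01; have := sX (p + t *: (q - p)).
  rewrite (_ : affine_form _ _ _ _ = t).
    by apply; exists t.
  rewrite /affine_form fst_addZ snd_addZ /=.
  by move: n0; rewrite /n /dot /= => n0; field.
have : (@lebesgue_measure R [set` `[0%R, 1%R]] <= (1 / 2)%:E)%E.
  apply: le_trans sX'; apply: le_measure => //; rewrite inE//.
by rewrite lebesgue_measure_itv/= lte_fin ltr01 -EFinB lee_fin subr0; lra.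
Qed.

(** * Isoperimetry in parallelograms *)

Section mesh_perimeter.
Variables (R : realType) (M : mesh R).

Definition union_closure (A : {set Tidx M}) : set (R * R) :=
  \bigcup_(K in [set` A]) closure (cell K).

Definition interface_length (K L : Tidx M) : R :=
  \sum_(s in edges_of K | is_interface s K L) edge_length s.

(** Perimeter relative to [Omega]: edges on the boundary of the domain do not contribute. *)
Definition perimeter (A : {set Tidx M}) : R :=
  \sum_(K in A) \sum_(L in ~: A) interface_length K L.

Lemma interface_length_ge0 K L : 0 <= interface_length K L.
Proof. by apply: sumr_ge0 => s _; exact: edist_ge0. Qed.

Lemma perimeter_ge0 A : 0 <= perimeter A.
Proof.
by apply: sumr_ge0 => K _; apply: sumr_ge0 => L _; exact: interface_length_ge0.
Qed.

Lemma closed_union_closure A : closed (union_closure A).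
Proof.
apply: closed_bigcup => [|K _]; last exact: closed_closure.
exact: finite_finset.
Qed.

Lemma measurable_union_closure A :
  measurable (union_closure A : set (measurableTypeR R * measurableTypeR R)).
Proof. by apply: closed_measurable2; exact: closed_union_closure. Qed.

Lemma union_closureU (Omega : set (R * R)) A : admissible_mesh Omega M ->
  union_closure A `|` union_closure (~: A) = closure Omega.
Proof.
move=> adm; rewrite (cell_cover adm); apply/seteqP; split => z.
  by case=> -[K _ Kz]; exists K.
move=> [K _ Kz]; case: (boolP (K \in A)) => KA; [left|right]; exists K => //=.
by rewrite inE.
Qed.

End mesh_perimeter.

Lemma cover_bigcup_seq (R : realType) (I : eqType) (s : seq I)
    (P : I -> set R) (w : I -> R) :
  (forall i, i \in s -> exists X : set R,
    [/\ measurable X, P i `<=` X & (lebesgue_measure X <= (w i)%:E)%E]) ->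
  exists X : set R, [/\ measurable X, forall i, i \in s -> P i `<=` X
    & (lebesgue_measure X <= (\sum_(i <- s) w i)%:E)%E].
Proof.
elim: s => [|i s IH] H.
  by exists set0; split => //; rewrite measure0 big_nil.
have [|Y [mY sY lY]] := IH; first by move=> j js; apply: H; rewrite inE js orbT.
have [|X [mX sX lX]] := H i; first by rewrite inE eqxx.
exists (X `|` Y); split; first exact: measurableU.
  move=> j; rewrite inE => /predU1P[->|js] x Px; first by left; exact: sX.
  by right; exact: sY Px.
rewrite big_cons EFinD (le_trans (measureU2 _ _ _))// leeD//.
Qed.

Lemma interface_proj (R : realType) (Omega : set (R * R)) (M : mesh R)
    (A : {set Tidx M}) (a b c d : R) :
  admissible_mesh Omega M -> perimeter A < d ->
  exists X : set R, [/\ measurable X,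
    forall z, union_closure A z -> union_closure (~: A) z ->
      X (affine_form a b c z)
    & (lebesgue_measure X <= ((`|a| + `|b| + 1) * d)%:E)%E].
Proof.
move=> adm Pd; pose T := (Tidx M * Tidx M)%type.
pose s := enum [pred x : T | (x.1 \in A) && (x.2 \in ~: A)].
(* The slack is shared among the pairs of cells to pay for contacts of zero length; the successor
   avoids dividing by 0. *)
pose e := (d - perimeter A) / (size s).+1%:R.
have e0 : 0 < e by rewrite divr_gt0// subr_gt0.
pose w (x : T) := (`|a| + `|b|) * interface_length x.1 x.2 + e.
pose P (x : T) := affine_form a b c @` (closure (cell x.1) `&` closure (cell x.2)).
have [|X [mX sX lX]] := @cover_bigcup_seq R T s P w.
  move=> [K L]; rewrite mem_enum inE /= => /andP[KA LA].
  have KL : K != L by apply: contraTneq LA => <-; rewrite inE KA.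
  have [zl|[i [iKL iK iL]]] := cell_inter adm KL.
    have [X [mX sX lX]] := zero_length_proj a b c zl e0.
    exists X; split => //; first by move=> _ [z Kz <-]; exact: sX.
    apply: le_trans lX _; rewrite lee_fin /w lerDr mulr_ge0 ?addr_ge0//.
    exact: interface_length_ge0.
  have [X [mX sX lX]] := segment_proj a b c (edge_a i) (edge_b i).
  exists X; split => //.
    move: (iKL) => /andP[_ /asboolP E].
    by move=> _ [z Kz <-]; apply: sX; rewrite E in Kz.
  apply: le_trans lX _; rewrite lee_fin; apply: ler_wpDr; first exact: ltW.
  rewrite ler_wpM2l ?addr_ge0// /interface_length (bigD1 i) ?iK//=.
  by rewrite lerDl sumr_ge0// => j _; exact: edist_ge0.
exists X; split => //.
  move=> z [K KA Kz] [L LA Lz]; apply: (sX (K, L)); last by exists z.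
  by rewrite mem_enum inE /=; apply/andP.
apply: le_trans lX _; rewrite lee_fin big_split /=.
have -> : \sum_(i <- s) e = (size s)%:R * e.
  by rewrite big_const_seq count_predT iter_addr_0 mulr_natl.
rewrite -mulr_sumr big_enum/= -(pair_big (fun K => K \in A) (fun L => L \in ~: A)
  (fun K L => interface_length K L))/= -/(perimeter A).
have P0 := perimeter_ge0 A.
have : (size s)%:R * e <= d - perimeter A.
  rewrite /e mulrCA ger_pMr ?subr_gt0// ler_pdivrMr// mul1r ler_nat//.
have : 0 <= `|a| + `|b| by rewrite addr_ge0.
by nra.
Qed.

(* Using closures of cells, which cover G exactly, avoids any null set.  The
   slack d > perimeter A absorbs the contacts of zero length, whose projections
   are only covered up to an arbitrarily small measure. *)
Definition isoperimetric (R : realType) (Omega G : set (R * R)) : Prop :=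
  [/\ measurable (G : set (measurableTypeR R * measurableTypeR R)),
    G `<=` closure Omega, (leb2 R G < +oo)%E &
  exists2 C : R, 0 <= C & forall (M : mesh R) (A : {set Tidx M}) (d : R),
    admissible_mesh Omega M -> perimeter A < d ->
    (leb2 R (union_closure A `&` G) <= (C * d ^+ 2)%:E)%E \/
    (leb2 R (union_closure (~: A) `&` G) <= (C * d ^+ 2)%:E)%E].

Definition det2 (R : realType) (e f : R * R) : R := e.1 * f.2 - e.2 * f.1.

Definition pgram_pt (R : realType) (o e f : R * R) (s t : R) : R * R :=
  o + s *: e + t *: f.

Definition pgram (R : realType) (o e f : R * R) (X Y : set R) : set (R * R) :=
  [set z | exists s t, [/\ X s, Y t & z = pgram_pt o e f s t]].

(** Cramer's rule: the coefficients recover the coordinates s and t in the frame (o, e, f). *)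
Lemma pgram_lin_set (R : realType) (o e f : R * R) (X Y : set R) :
  det2 e f != 0 ->
  pgram o e f X Y = lin_set
    (f.2 / det2 e f) (- f.1 / det2 e f) (- det2 o f / det2 e f)
    (- e.2 / det2 e f) (e.1 / det2 e f) (det2 o e / det2 e f) X Y.
Proof.
rewrite /det2 => D0; apply/seteqP; split => [_ [s [t [Xs Yt ->]]]|z [Xz Yz]].
  split; rewrite /pgram_pt !(fst_addZ, snd_addZ).
    move: Xs; congr (X _); field; exact: D0.
  move: Yt; congr (Y _); field; exact: D0.
exists (f.2 / det2 e f * z.1 + - f.1 / det2 e f * z.2 + - det2 o f / det2 e f),
  (- e.2 / det2 e f * z.1 + e.1 / det2 e f * z.2 + det2 o e / det2 e f).
split => //; rewrite [LHS]surjective_pairing [RHS]surjective_pairing /pgram_pt.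
by rewrite !(fst_addZ, snd_addZ) /det2; congr pair; field; exact: D0.
Qed.

Lemma leb2_pgram (R : realType) (o e f : R * R) (X Y : set R) :
  det2 e f != 0 -> measurable X -> measurable Y ->
  measurable (pgram o e f X Y : set (measurableTypeR R * measurableTypeR R)) /\
  leb2 R (pgram o e f X Y) =
  (`|det2 e f|%:E * (lebesgue_measure X * lebesgue_measure Y))%E.
Proof.
move=> D0 mX mY; rewrite pgram_lin_set//; split; first exact: measurable_lin_set.
have E : f.2 / det2 e f * (e.1 / det2 e f) -
    - e.2 / det2 e f * (- f.1 / det2 e f) = (det2 e f)^-1.
  by move: D0; rewrite /det2 => D0; field.
rewrite leb2_lin_set// E; last by rewrite invr_neq0.
by rewrite normrV ?unitfE// invrK.
Qed.

(** On [0, 1] the preimage of A is closed, and also open as the complement of that of B;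
    connectedness decides. *)
Lemma path_monochromatic (R : realType) (g : R -> R * R) (A B : set (R * R)) :
  continuous g -> closed A -> closed B ->
  (forall s, `[0, 1]%classic s -> A (g s) \/ B (g s)) ->
  (forall s, `[0, 1]%classic s -> ~ (A (g s) /\ B (g s))) ->
  forall s s', `[0, 1]%classic s -> `[0, 1]%classic s' -> A (g s) -> A (g s').
Proof.
move=> cg cA cB AB nAB s s' s01 s'01 As.
have := @segment_connected R 0 1.
move=> /(_ [set s | `[0, 1]%classic s /\ A (g s)]) H.
suff : [set s | `[0, 1]%classic s /\ A (g s)] = `[0, 1]%classic.
  by move/seteqP => [_ /(_ _ s'01)] [].
apply: H.
- by exists s.
- exists (g @^-1` (~` B)).
    by apply: open_comp => [x _|]; [exact: cg|rewrite openC].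
  apply/seteqP; split => x /= [x01].
    by move=> Ax; split => // Bx; apply: (nAB x).
  by move=> nBx; split => //; case: (AB x).
- exists (g @^-1` A); last by [].
  by apply: closed_comp => // x _; exact: cg.
Qed.

Lemma notin_small (R : realType) (X : set R) : measurable X ->
  (lebesgue_measure X < 1)%E -> exists2 s, `[0, 1]%classic s & ~ X s.
Proof.
move=> mX; apply: contraPP => H; apply/negP; rewrite -leNgt.
rewrite (_ : 1%E = @lebesgue_measure R [set` `[0%R, 1%R]]); last first.
  by rewrite lebesgue_measure_itv/= lte_fin ltr01 -EFinB subr0.
apply: le_measure; rewrite ?inE// => s s01.
by apply: contrapT => nX; apply: H; exists s.
Qed.

Lemma pgram_isoperimetric (R : realType) (Omega : set (R * R)) (o e f : R * R) :
  det2 e f != 0 -> pgram o e f `[0, 1] `[0, 1] `<=` closure Omega ->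
  isoperimetric Omega (pgram o e f `[0, 1] `[0, 1]).
Proof.
move=> D0 sub; set P := pgram o e f _ _.
have m01 : measurable (`[0, 1]%classic : set R) by exact: measurable_itv.
have l01 : lebesgue_measure ([set` `[0%R, 1%R]] : set R) = 1%E.
  by rewrite lebesgue_measure_itv/= lte_fin ltr01 -EFinB subr0.
have [mP lP] := leb2_pgram o D0 m01 m01; rewrite -/P l01 !mule1 in mP lP.
split => //; first by rewrite lP ltry.
set D := det2 e f in D0 lP.
(* Coefficients of the two coordinate functions s and t of the parallelogram. *)
pose a1 := f.2 / D; pose b1 := - f.1 / D; pose c1 := - det2 o f / D.
pose a2 := - e.2 / D; pose b2 := e.1 / D; pose c2 := det2 o e / D.
pose k := `|a1| + `|b1| + 1 + (`|a2| + `|b2| + 1).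
have k1 : `|a1| + `|b1| + 1 <= k by rewrite lerDl !addr_ge0.
have k2 : `|a2| + `|b2| + 1 <= k by rewrite lerDr !addr_ge0.
have k0 : 0 < k by rewrite ltr_pwDl ?addr_ge0// ltr_wpDl ?addr_ge0.
exists (`|D| * k ^+ 2) => [|M A d adm Pd]; first by rewrite mulr_ge0 ?sqr_ge0.
have d0 : 0 < d by apply: le_lt_trans Pd; exact: perimeter_ge0.
have mA := measurable_union_closure A; have mB := measurable_union_closure (~: A).
(* For k d >= 1 the whole parallelogram is small enough; otherwise X and Y have measure below 1 and
   miss some s0 and t0. *)
have [kd1|kd1] := leP 1 (k * d).
  left; apply: (@le_trans _ _ (leb2 R P)).
    by apply: le_measure; rewrite ?inE//; exact: measurableI.
  rewrite lP lee_fin -mulrA -exprMn ler_peMr// expr_ge1//.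
  exact: le_trans kd1.
have [X [mX sX lX]] := interface_proj a1 b1 c1 adm Pd.
have [Y [mY sY lY]] := interface_proj a2 b2 c2 adm Pd.
have {}lX : (lebesgue_measure X <= (k * d)%:E)%E.
  by apply: le_trans lX _; rewrite lee_fin ler_pM2r.
have {}lY : (lebesgue_measure Y <= (k * d)%:E)%E.
  by apply: le_trans lY _; rewrite lee_fin ler_pM2r.
have [|s0 s001 nXs0] := notin_small mX.
  by apply: le_lt_trans lX _; rewrite lte_fin.
have [|t0 t001 nYt0] := notin_small mY.
  by apply: le_lt_trans lY _; rewrite lte_fin.
pose pt := pgram_pt o e f.
have cs s t : affine_form a1 b1 c1 (pt s t) = s.
  rewrite /affine_form /pt /pgram_pt !(fst_addZ, snd_addZ) /a1 /b1 /c1.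
  by move: D0; rewrite /D /det2 => D0; field.
have ct s t : affine_form a2 b2 c2 (pt s t) = t.
  rewrite /affine_form /pt /pgram_pt !(fst_addZ, snd_addZ) /a2 /b2 /c2.
  by move: D0; rewrite /D /det2 => D0; field.
have cptl t : continuous (pt^~ t).
  move=> s; apply: cvgD; last exact: cvg_cst.
  by apply: cvgD; [exact: cvg_cst|apply: cvgZr_tmp].
have cptr s : continuous (pt s).
  by move=> t; apply: cvgD; [exact: cvg_cst|apply: cvgZr_tmp].
have cov s t : `[0, 1]%classic s -> `[0, 1]%classic t ->
    union_closure A (pt s t) \/ union_closure (~: A) (pt s t).
  move=> s01 t01; have : closure Omega (pt s t) by apply: sub; exists s, t.
  by rewrite -(union_closureU A adm).
have row t : `[0, 1]%classic t -> ~ Y t -> forall B s s', `[0, 1]%classic s ->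
    `[0, 1]%classic s' -> B = A \/ B = ~: A ->
    union_closure B (pt s t) -> union_closure B (pt s' t).
  move=> t01 nY B s s' s01 s'01 BA.
  apply: (@path_monochromatic _ (pt^~ t) _ (union_closure (~: B))) => //;
    try exact: closed_union_closure.
  - by move=> x x01 /=; case: BA => ->; rewrite ?finset.setCK; have := cov _ _ x01 t01; tauto.
  - move=> x x01 [x1 x2]; apply: nY; rewrite -[t](ct x t).
    by move: x1 x2 => /=; case: BA => ->; rewrite ?finset.setCK => x1 x2; apply: sY.
have col s : `[0, 1]%classic s -> ~ X s -> forall B t t', `[0, 1]%classic t ->
    `[0, 1]%classic t' -> B = A \/ B = ~: A ->
    union_closure B (pt s t) -> union_closure B (pt s t').
  move=> s01 nX B t t' t01 t'01 BA.
  apply: (@path_monochromatic _ (pt s) _ (union_closure (~: B))) => //;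
    try exact: closed_union_closure.
  - by move=> x x01 /=; case: BA => ->; rewrite ?finset.setCK; have := cov _ _ s01 x01; tauto.
  - move=> x x01 [x1 x2]; apply: nX; rewrite -[s](cs s x).
    by move: x1 x2 => /=; case: BA => ->; rewrite ?finset.setCK => x1 x2; apply: sX.
have small B B' : (B = A /\ B' = ~: A) \/ (B = ~: A /\ B' = A) ->
    union_closure B (pt s0 t0) ->
    (leb2 R (union_closure B' `&` P) <= (`|D| * k ^+ 2 * d ^+ 2)%:E)%E.
  move=> BB' B0.
  have HB : B = A \/ B = ~: A by case: BB' => -[-> _]; tauto.
  have HB' : B' = A \/ B' = ~: A by case: BB' => -[_ ->]; tauto.
  have XI z : union_closure B z -> union_closure B' z -> X (affine_form a1 b1 c1 z).
    by case: BB' => -[-> ->] z1 z2; exact: sX.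
  have YI z : union_closure B z -> union_closure B' z -> Y (affine_form a2 b2 c2 z).
    by case: BB' => -[-> ->] z1 z2; exact: sY.
  have [mXY lXY] := leb2_pgram o D0 mX mY.
  apply: (@le_trans _ _ (leb2 R (pgram o e f X Y))).
    apply: le_measure; rewrite ?inE//.
      by apply: measurableI => //; exact: measurable_union_closure.
    move=> z [B'z [s [t [s01 t01 zE]]]]; rewrite {}zE in B'z *.
    exists s, t; split => //.
      (* For s outside X, its column carries B' from (s, t) to (s, t0), where row t0 brings B from
         (s0, t0). That is a contact point, which puts s in X. The argument for t is symmetric. *)
      apply: contrapT => nXs; apply: (nXs); rewrite -[s](cs s t0).
      apply: XI; first exact: (row t0 t001 nYt0 B s0 s).
      exact: (col s s01 nXs B' t t0).
    apply: contrapT => nYt; apply: (nYt); rewrite -[t](ct s0 t).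
    apply: YI; first exact: (col s0 s001 nXs0 B t0 t).
    exact: (row t t01 nYt B' s s0).
  rewrite lXY -mulrA EFinM; apply: lee_wpmul2l => //.
  by rewrite -exprMn expr2 EFinM; apply: lee_pmul.
have [h|h] := cov s0 t0 s001 t001.
- by right; apply: (small A) => //; left.
- by left; apply: (small (~: A)) => //; right.
Qed.

(** * Isoperimetry in polygonal domains *)

(** If Q fails on K, the sets U for which Q holds on K minus U form a proper filter; the local
    hypothesis at a cluster point contradicts it. *)
Lemma compact_property (T : topologicalType) (K : set T) (Q : set T -> Prop) :
  compact K -> Q set0 -> (forall U V, U `<=` V -> Q V -> Q U) ->
  (forall U V, Q U -> Q V -> Q (U `|` V)) ->
  (forall x, K x -> exists2 U, nbhs x U & Q U) -> Q K.
Proof.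
move=> cK Q0 QS QU Qloc; apply: contrapT => nQK.
pose F : set_system T := fun U => Q (K `\` U).
have FF : Filter F.
  split.
  - by rewrite /F setDT.
  - by move=> U V FU FV; rewrite /F setDIr; exact: QU.
  - by move=> U V UV; apply: QS => z [Kz nVz]; split => // /UV.
have PF : ProperFilter F by split => //; rewrite /F setD0.
have [|x [Kx]] := cK F PF; first by rewrite /F setDv.
have [U xU QU'] := Qloc x Kx.
move=> /(_ (~` U) U); case => //; last by move=> z [].
by apply: QS QU' => z [_ /contrapT].
Qed.

Lemma pgram_nbhs (R : realType) (x : R * R) (U : set (R * R)) : nbhs x U ->
  exists o e f : R * R, [/\ det2 e f != 0, pgram o e f `[0, 1] `[0, 1] `<=` U
    & nbhs x (pgram o e f `[0, 1] `[0, 1])].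
Proof.
move=> /nbhs_ballP[r /= r0 sub].
exists (x - (r / 2, r / 2)), (r, 0), (0, r); rewrite /det2 /= mulr0 subr0; split.
- by rewrite mulf_neq0// gt_eqF.
- move=> _ [s [t [+ + ->]]]; rewrite /= !in_itv/= => /andP[s0 s1] /andP[t0 t1].
  apply: sub; split; rewrite /ball /pgram_pt !(fst_addZ, snd_addZ)/= ltr_norml.
    by apply/andP; split; nra.
  by apply/andP; split; nra.
- apply/nbhs_ballP; exists (r / 2) => /=; first by rewrite divr_gt0.
  move=> z []; rewrite /ball /= !ltr_norml => /andP[h1 h2] /andP[h3 h4].
  exists ((z.1 - x.1 + r / 2) / r), ((z.2 - x.2 + r / 2) / r).
  rewrite /= !in_itv /=; split.
  + by apply/andP; split; [rewrite ler_pdivlMr|rewrite ler_pdivrMr]; lra.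
  + by apply/andP; split; [rewrite ler_pdivlMr|rewrite ler_pdivrMr]; lra.
  + rewrite [LHS]surjective_pairing [RHS]surjective_pairing /pgram_pt.
    rewrite !(fst_addZ, snd_addZ) /=; have r0' : r != 0 by rewrite gt_eqF.
    by congr pair; field.
Qed.

Lemma nbhs_leb2_gt0 (R : realType) (x : R * R) (G : set (R * R)) :
  measurable (G : set (measurableTypeR R * measurableTypeR R)) ->
  nbhs x G -> (0 < leb2 R G)%E.
Proof.
move=> mG /pgram_nbhs[p [e [f [D0 sub _]]]].
have m01 : measurable (`[0, 1]%classic : set R) by exact: measurable_itv.
have [mP lP] := leb2_pgram p D0 m01 m01.
apply: (@lt_le_trans _ _ (leb2 R (pgram p e f `[0, 1] `[0, 1]))); last first.
  by apply: le_measure; rewrite ?inE.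
rewrite lP lebesgue_measure_itv/= lte_fin ltr01 -EFinB subr0 !mule1 lte_fin.
by rewrite normr_gt0.
Qed.

(** The case to handle is A small in G and its complement small in H. Together they cover G [&] H,
    whose measure m > 0 is then at most (C + D) d^2, so even the whole union, of measure g, is at
    most g / m times that. *)
Lemma isoperimetricU (R : realType) (Omega G H : set (R * R)) (x : R * R) :
  isoperimetric Omega G -> isoperimetric Omega H -> G° x -> H° x ->
  isoperimetric Omega (G `|` H).
Proof.
move=> [mG sG fG [C C0 CG]] [mH sH fH [D D0 DH]] Gx Hx.
have mI := measurableI _ _ mG mH; have mU := measurableU _ _ mG mH.
have i0 : (0 < leb2 R (G `&` H))%E.
  by apply: (@nbhs_leb2_gt0 _ x) => //; exact: filterI.
have fU : (leb2 R (G `|` H) < +oo)%E.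
  by apply: le_lt_trans (measureU2 _ _ _) _ => //; exact: lte_add_pinfty.
have fI : (leb2 R (G `&` H) < +oo)%E.
  by apply: le_lt_trans fG; apply: le_measure; rewrite ?inE//; exact: subIsetl.
split => //; first by move=> z [/sG|/sH].
set m := fine (leb2 R (G `&` H)); set g := fine (leb2 R (G `|` H)).
have mE : leb2 R (G `&` H) = m%:E by rewrite fineK// ge0_fin_numE.
have gE : leb2 R (G `|` H) = g%:E by rewrite fineK// ge0_fin_numE.
have m0 : 0 < m by rewrite -lte_fin -mE.
have g0 : 0 <= g by rewrite fine_ge0.
exists ((C + D) * (1 + g / m)).
  by rewrite mulr_ge0 ?addr_ge0// divr_ge0// ltW.
move=> M A d adm Pd.
have mA (B : {set Tidx M}) : measurable (union_closure B : set (measurableTypeR R * measurableTypeR R)).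
  exact: measurable_union_closure.
have both (B : {set Tidx M}) : (leb2 R (union_closure B `&` G) <= (C * d ^+ 2)%:E)%E ->
    (leb2 R (union_closure B `&` H) <= (D * d ^+ 2)%:E)%E ->
    (leb2 R (union_closure B `&` (G `|` H)) <=
      ((C + D) * (1 + g / m) * d ^+ 2)%:E)%E.
  move=> h1 h2; rewrite setIUr.
  apply: le_trans (measureU2 _ _ _) _; try exact: measurableI.
  apply: le_trans (leeD h1 h2) _; rewrite -EFinD lee_fin -mulrDl.
  rewrite ler_wpM2r ?sqr_ge0// ler_peMr ?addr_ge0// lerDl divr_ge0// ltW//.
have mixed (B B' : {set Tidx M}) : union_closure B `|` union_closure B' = closure Omega ->
    (leb2 R (union_closure B `&` G) <= (C * d ^+ 2)%:E)%E ->
    (leb2 R (union_closure B' `&` H) <= (D * d ^+ 2)%:E)%E ->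
    (leb2 R (union_closure A `&` (G `|` H)) <=
      ((C + D) * (1 + g / m) * d ^+ 2)%:E)%E.
  move=> BB' h1 h2.
  have : (leb2 R (G `&` H) <= ((C + D) * d ^+ 2)%:E)%E.
    apply: (@le_trans _ _ (leb2 R ((union_closure B `&` G) `|` (union_closure B' `&` H)))).
      apply: le_measure; rewrite ?inE//.
        by apply: measurableU; exact: measurableI.
      move=> z [Gz Hz]; have : closure Omega z by exact: sG.
      by rewrite -BB' => -[]; [left|right].
    apply: le_trans (measureU2 _ _ _) _; try exact: measurableI.
    by apply: le_trans (leeD h1 h2) _; rewrite -EFinD lee_fin -mulrDl.
  rewrite mE lee_fin => h.
  apply: (@le_trans _ _ (leb2 R (G `|` H))).
    by apply: le_measure; rewrite ?inE//; exact: measurableI.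
  rewrite gE lee_fin; apply: (@le_trans _ _ ((C + D) * d ^+ 2 * (g / m))).
    by rewrite mulrA ler_pdivlMr// mulrC ler_wpM2r.
  rewrite mulrAC ler_wpM2r ?sqr_ge0// ler_wpM2l ?addr_ge0// lerDr//.
have cU := union_closureU A adm.
have cU' : union_closure (~: A) `|` union_closure A = closure Omega by rewrite setUC.
have [hG|hG] := CG M A d adm Pd; have [hH|hH] := DH M A d adm Pd.
- by left; exact: both.
- by left; exact: (mixed A (~: A)).
- by left; exact: (mixed (~: A) A).
- by right; exact: both.
Qed.

(** The points linked to x are relatively open and closed in [Omega]: a linked point in the interior
    of a square around z would link z by [isoperimetricU]. *)
Lemma isoperimetric_link (R : realType) (Omega : set (R * R)) (x y : R * R) :
  open Omega -> connected Omega -> Omega x -> Omega y ->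
  exists G, [/\ isoperimetric Omega G, G° x & G° y].
Proof.
move=> oO cO Ox Oy.
have box z : Omega z -> exists2 G, isoperimetric Omega G & G° z.
  move=> Oz; have /pgram_nbhs[p [e [f [D0 sub nb]]]] : nbhs z Omega.
    exact: open_nbhs_nbhs.
  exists (pgram p e f `[0, 1] `[0, 1]) => //.
  apply: pgram_isoperimetric => //; apply: subset_trans sub _.
  exact: subset_closure.
pose linked z := exists G, [/\ isoperimetric Omega G, G° x & G° z].
suff E : [set z | Omega z /\ linked z] = Omega.
  by have [] : [set z | Omega z /\ linked z] y by rewrite E.
apply: cO.
- by exists x; split => //; have [G iG Gx] := box x Ox; exists G.
- exists (\bigcup_(G in [set G | isoperimetric Omega G /\ G° x]) G°).
    by apply: bigcup_open => G _; exact: open_interior.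
  apply/seteqP; split => z [Oz].
    by move=> [G [iG Gx Gz]]; split => //; exists G.
  by move=> [G [iG Gx] Gz]; split => //; exists G.
- exists (~` \bigcup_(G in [set G | isoperimetric Omega G /\
      forall z, G° z -> ~ linked z]) G°).
    by rewrite closedC; apply: bigcup_open => G _; exact: open_interior.
  apply/seteqP; split => z [Oz].
    move=> lz; split => //; move=> [G [iG nl] Gz]; exact: nl Gz lz.
  move=> nz; split => //; apply: contrapT => nlz; apply: nz.
  have [G iG Gz] := box z Oz; exists G => //; split => // w Gw [H [iH Hx Hw]].
  apply: nlz; exists (G `|` H); split; first exact: (isoperimetricU iG iH Gw).
    by apply: interiorU; right.
  by apply: interiorU; left.
Qed.

(** * Cones of boundary directions around a point *)

Lemma affine_form_continuous (R : realType) (a b c : R) :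
  continuous (affine_form a b c).
Proof.
move=> z; apply: cvgD; last exact: cvg_cst.
apply: cvgD; apply: cvgM; (try exact: cvg_cst); [exact: cvg_fst|exact: cvg_snd].
Qed.

Lemma open_pgram (R : realType) (o e f : R * R) (X Y : set R) :
  det2 e f != 0 -> open X -> open Y -> open (pgram o e f X Y).
Proof.
move=> D0 oX oY; rewrite pgram_lin_set//.
by apply: openI; apply: open_comp => // z _; exact: affine_form_continuous.
Qed.

Lemma pgram_pt_continuous (R : realType) (o e f : R * R) (g h : R -> R) :
  continuous g -> continuous h ->
  continuous (fun l => pgram_pt o e f (g l) (h l)).
Proof.
move=> cg ch l; apply: cvgD; last by apply: cvgZr_tmp; exact: ch.
by apply: cvgD; [exact: cvg_cst|apply: cvgZr_tmp; exact: cg].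
Qed.

Lemma line_continuous (R : realType) (a b : R) : continuous (fun l : R => a + l * b).
Proof.
move=> l; apply: cvgD; first exact: cvg_cst.
by apply: cvgM; [exact: cvg_id|exact: cvg_cst].
Qed.

(** A point of the closed parallelogram is the limit of its contractions towards the centre, which
    are interior. *)
Lemma pgram_closed_sub (R : realType) (o e f : R * R) (C : set (R * R)) :
  closed C -> pgram o e f `]0, 1[ `]0, 1[ `<=` C ->
  pgram o e f `[0, 1] `[0, 1] `<=` C.
Proof.
move=> cC sub _ [s [t [+ + ->]]]; rewrite /= !in_itv/= => /andP[s0 s1] /andP[t0 t1].
pose g (l : R) := pgram_pt o e f (s + l * (1 / 2 - s)) (t + l * (1 / 2 - t)).
have g0 : g l @[l --> 0^'+] --> pgram_pt o e f s t.
  have cg : continuous g by apply: pgram_pt_continuous; exact: line_continuous.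
  have -> : pgram_pt o e f s t = g 0 by rewrite /g !mul0r !addr0.
  by apply: cvg_at_right_filter; exact: cg.
apply: (closed_cvg C cC _ _ g0).
near=> l; apply: sub; exists (s + l * (1 / 2 - s)), (t + l * (1 / 2 - t)).
have l0 : 0 < l by near: l; exact: nbhs_right_gt.
have l1 : l < 1 by near: l; apply: nbhs_right_lt.
by rewrite /= !in_itv/=; split => //; apply/andP; split; nra.
Unshelve. all: by end_near. Qed.

Lemma conv_oo (R : realDomainType) (a b s s' l : R) :
  a < s < b -> a < s' < b -> 0 <= l <= 1 -> a < s + l * (s' - s) < b.
Proof.
move=> /andP[as_ sb] /andP[as' s'b] /andP[l0 l1].
by have [ss|ss] := leP s s'; apply/andP; split; nra.
Qed.

(** On a segment between two points of the parallelogram, the closure of [Omega] and its complement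
    are closed, cover, and could meet only on the boundary. *)
Lemma pgram_dichotomy (R : realType) (Omega : set (R * R)) (o e f : R * R) :
  open Omega ->
  (forall z, pgram o e f `]0, 1[ `]0, 1[ z -> ~ bdry Omega z) ->
  pgram o e f `]0, 1[ `]0, 1[ `<=` Omega \/
  pgram o e f `]0, 1[ `]0, 1[ `<=` ~` Omega.
Proof.
move=> oO nb; have [[z [Pz Oz]]|H] := pselect
    (exists z, pgram o e f `]0, 1[ `]0, 1[ z /\ Omega z); last first.
  by right => z Pz Oz; apply: H; exists z.
left=> w Pw; have bE : bdry Omega = closure Omega `\` Omega.
  by rewrite /bdry; move/interior_id: (oO) => ->.
have [s [t [+ + zE]]] := Pz; have [s' [t' [+ + wE]]] := Pw.
rewrite /= !in_itv/= => s'01 t'01 s01 t01.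
pose g (l : R) := pgram_pt o e f (s + l * (s' - s)) (t + l * (t' - t)).
have g01 l : `[0, 1]%classic l -> pgram o e f `]0, 1[ `]0, 1[ (g l).
  rewrite /= in_itv/= => l01.
  exists (s + l * (s' - s)), (t + l * (t' - t)); rewrite /= !in_itv/=.
  by split => //; exact: conv_oo.
have i0 : `[0, 1]%classic (0 : R) by rewrite /= in_itv/= lexx ler01.
have i1 : `[0, 1]%classic (1 : R) by rewrite /= in_itv/= lexx ler01.
have gw : g 1 = w by rewrite wE /g !mul1r ![_ + (_ - _)]addrC !subrK.
have gz : g 0 = z by rewrite zE /g !mul0r !addr0.
have cw : closure Omega w.
  rewrite -gw; apply: (@path_monochromatic _ g (closure Omega) (~` Omega) _ _ _ _ _ 0) => //.
  - by apply: pgram_pt_continuous; exact: line_continuous.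
  - exact: closed_closure.
  - by rewrite closedC.
  - move=> l l01; have [Ol|nOl] := pselect (Omega (g l)); last by right.
    by left; exact: subset_closure.
  - by move=> l /g01/nb; rewrite bE.
  - by rewrite gz; exact: subset_closure.
by apply: contrapT => nOw; apply: (nb w Pw); rewrite bE.
Qed.

(* A direction of ds strictly inside the cone (e, f) splits it in two cones, and
   the one containing v has fewer directions inside. *)
Lemma empty_cone (R : realType) (ds : seq (R * R)) (e f v : R * R) :
  e \in ds -> f \in ds -> 0 < det2 e f -> 0 <= det2 e v -> 0 <= det2 v f ->
  exists e' f', [/\ e' \in ds, f' \in ds,
    [/\ 0 < det2 e' f', 0 <= det2 e' v & 0 <= det2 v f'] &
    forall g, g \in ds -> ~~ ((0 < det2 e' g) && (0 < det2 g f'))].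
Proof.
pose inc (e f : R * R) := [pred g : R * R | (0 < det2 e g) && (0 < det2 g f)].
(* The Grassmann-Plücker relation; it shows that a direction inside a half cone (g, f) or (e, g) is
   inside (e, f). *)
have plu (a b c d : R * R) :
    det2 a b * det2 c d = det2 a d * det2 c b + det2 a c * det2 b d.
  by rewrite /det2; ring.
have [n] := ubnP (count (inc e f) ds); elim: n e f => // n IH e f.
rewrite ltnS => cn eds fds ef ev vf.
have [/hasP[g gds /andP[eg gf]]|/hasPn h] := boolP (has (inc e f) ds); last first.
  by exists e, f; split.
have strict (P : pred (R * R)) : (forall h, P h -> inc e f h) -> ~~ P g -> (count P ds < n)%N.
  move=> sP nPg; apply: leq_trans cn.
  have := count_predUI P (pred1 g) ds.
  rewrite (@eq_count _ (predI P (pred1 g)) pred0) ?count_pred0 ?addn0; last first.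
    by move=> h /=; apply: contraNF nPg => /andP[Ph /eqP <-].
  have : (count (predU P (pred1 g)) ds <= count (inc e f) ds)%N.
    apply: sub_count => h /=.
    by move=> /orP[/sP//|/eqP ->]; rewrite eg.
  by move=> /[swap] ->; apply: leq_trans; rewrite -addn1 leq_add2l -has_count has_pred1.
have [gv|gv] := leP 0 (det2 g v).
  apply: (IH g f) => //; apply: strict => [h|]; last first.
    by rewrite /= {1}/det2 mulrC subrr ltxx.
  move=> /andP[gh hf]; apply/andP; split => //.
  by have := plu g f e h; rewrite /det2 in gh hf eg gf ef *; nra.
apply: (IH e g) => //; last first.
- by rewrite ltW// -oppr_lt0; move: gv; congr (_ < _); rewrite /det2; ring.
apply: strict => [h|]; last first.
  by rewrite /= andbC {1}/det2 mulrC subrr ltxx.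
move=> /andP[gh hf]; apply/andP; split => //.
by have := plu g f e h; rewrite /det2 in gh hf eg gf ef *; nra.
Qed.

Lemma near_seq (T : Type) (I : eqType) (F : set_system T) {FF : Filter F}
    (s : seq I) (P : I -> T -> Prop) :
  (forall i, i \in s -> \forall x \near F, P i x) ->
  \forall x \near F, forall i, i \in s -> P i x.
Proof.
elim: s => [_|i s IH H]; first by apply: filterE => x i; rewrite in_nil.
have Fi : \forall x \near F, P i x by apply: H; rewrite inE eqxx.
have Fs : \forall x \near F, forall i, i \in s -> P i x.
  by apply: IH => j js; apply: H; rewrite inE js orbT.
apply: filterS2 Fi Fs => x Pi Ps j.
by rewrite inE => /predU1P[->|/Ps].
Qed.

Lemma closed_segment (R : realType) (a b : R * R) : closed (segment a b).
Proof.
apply: compact_closed; first exact: norm_hausdorff.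
apply: continuous_compact; last exact: segment_compact.
apply: continuous_subspaceT => t.
by apply: cvgD; [exact: cvg_cst|apply: cvgZr_tmp; exact: cvg_id].
Qed.

Lemma segment_det (R : realType) (a b x z : R * R) :
  segment a b x -> segment a b z -> det2 (z - x) (b - a) = 0.
Proof.
move=> [s _ <-] [t _ <-]; rewrite /det2.
rewrite (_ : (_ - (a + _)).1 = a.1 + t * (b - a).1 - (a.1 + s * (b - a).1))//.
rewrite (_ : (_ - (a + _)).2 = a.2 + t * (b - a).2 - (a.2 + s * (b - a).2))//.
ring.
Qed.

(** Scaling for which the open parallelogram spanned at x stays in the sup-norm ball of radius r;
    the 1 avoids division by 0. *)
Definition cone_scale (R : realType) (r : R) (e f : R * R) : R :=
  r / (`|e.1| + `|e.2| + `|f.1| + `|f.2| + 1).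

Lemma cone_scale_gt0 (R : realType) (r : R) (e f : R * R) :
  0 < r -> 0 < cone_scale r e f.
Proof. by move=> r0; rewrite divr_gt0// ltr_wpDl// !addr_ge0. Qed.

Definition cone_pgram (R : realType) (x : R * R) (r : R) (e f : R * R) :=
  pgram x (cone_scale r e f *: e) (cone_scale r e f *: f).

Lemma det2Z (R : realType) (k : R) (e f : R * R) :
  det2 (k *: e) (k *: f) = k ^+ 2 * det2 e f.
Proof.
rewrite /det2 (_ : (k *: e).1 = k * e.1)// (_ : (k *: e).2 = k * e.2)//.
by rewrite (_ : (k *: f).1 = k * f.1)// (_ : (k *: f).2 = k * f.2)//; ring.
Qed.

Lemma cone_pgram_ball (R : realType) (x : R * R) (r : R) (e f : R * R) :
  0 < r -> cone_pgram x r e f `]0, 1[ `]0, 1[ `<=` ball x r.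
Proof.
move=> r0 _ [s [t [+ + ->]]]; rewrite /= !in_itv/= => /andP[s0 s1] /andP[t0 t1].
have D0 := cone_scale_gt0 e f r0.
have Dr : cone_scale r e f * (`|e.1| + `|e.2| + `|f.1| + `|f.2| + 1) = r.
  by rewrite /cone_scale divfK// gt_eqF// ltr_wpDl// !addr_ge0.
move: (cone_scale r e f) D0 Dr => D D0 Dr.
have bd (a b : R) : `|a| + `|b| <= `|e.1| + `|e.2| + `|f.1| + `|f.2| ->
    forall c, `|c - (c + s * (D * a) + t * (D * b))| < r.
  move=> h c; rewrite (_ : _ - _ = - (s * (D * a) + t * (D * b))); last by ring.
  rewrite normrN (le_lt_trans (ler_normD _ _))// !normrM.
  rewrite (gtr0_norm s0) (gtr0_norm t0) (gtr0_norm D0) -Dr.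
  have : s * (D * `|a|) <= D * `|a| by rewrite ler_piMl ?mulr_ge0// ltW.
  have : t * (D * `|b|) <= D * `|b| by rewrite ler_piMl ?mulr_ge0// ltW.
  by nra.
have [n1 n2 n3 n4] : [/\ 0 <= `|e.1|, 0 <= `|e.2|, 0 <= `|f.1| & 0 <= `|f.2|] by [].
by split; rewrite /ball /= /pgram_pt; apply: bd; lra.
Qed.

(** A boundary point in the open cone would be parallel to some d, and then d or - d would lie
    strictly inside the cone. If d is parallel to e, it is also parallel to f, hence zero. *)
Lemma cone_no_boundary (R : realType) (Omega : set (R * R)) (x : R * R) (r : R)
    (e f : R * R) (ds : seq (R * R)) :
  0 < r -> 0 < det2 e f -> (forall d, d \in ds -> - d \in ds) ->
  (forall g, g \in ds -> ~~ ((0 < det2 e g) && (0 < det2 g f))) ->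
  (forall z, ball x r z -> bdry Omega z ->
     exists d, [/\ d \in ds, d != 0 & det2 (z - x) d = 0]) ->
  forall z, cone_pgram x r e f `]0, 1[ `]0, 1[ z -> ~ bdry Omega z.
Proof.
move=> r0 D0 dsN emp Hb z Pz bz.
have [d [dds d0 dz]] := Hb z (cone_pgram_ball r0 Pz) bz.
case: Pz dz => s [t [+ + ->]]; rewrite /= !in_itv/= => /andP[s0 _] /andP[t0 _].
have k0 := cone_scale_gt0 e f r0; set k := cone_scale r e f in k0 *.
rewrite {1}/det2 /pgram_pt.
rewrite (_ : (x + s *: (k *: e) + t *: (k *: f) - x).1 = k * (s * e.1 + t * f.1));
  last by rewrite (_ : _.1 = x.1 + s * (k * e.1) + t * (k * f.1) - x.1)//; ring.
rewrite (_ : (x + s *: (k *: e) + t *: (k *: f) - x).2 = k * (s * e.2 + t * f.2));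
  last by rewrite (_ : _.2 = x.2 + s * (k * e.2) + t * (k * f.2) - x.2)//; ring.
move=> dz.
have {dz} H : s * det2 e d + t * det2 f d = 0.
  apply: (mulfI (lt0r_neq0 k0)); rewrite mulr0 -[RHS]dz /det2; ring.
have dNf : det2 f d = - det2 d f by rewrite /det2; ring.
have eN : det2 e (- d) = - det2 e d by rewrite /det2 /=; ring.
have Nf : det2 (- d) f = - det2 d f by rewrite /det2 /=; ring.
have [a0|a0|a0] := ltgtP 0 (det2 e d).
- have := emp d dds; rewrite a0 /= => /negP; apply.
  by rewrite dNf in H; nra.
- have := emp (- d) (dsN d dds); rewrite eN Nf !oppr_gt0 a0 /= => /negP; apply.
  by rewrite dNf in H; nra.
- have b0 : det2 d f = 0.
    move: H; rewrite -a0 mulr0 add0r dNf => /eqP.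
    by rewrite mulf_eq0 oppr_eq0 (gt_eqF t0) => /eqP.
  move/negP: d0; apply; apply/eqP; rewrite [d]surjective_pairing.
  have D0' : det2 e f != 0 by rewrite gt_eqF.
  have E1 : d.1 * det2 e f = det2 d f * e.1 + det2 e d * f.1 by rewrite /det2; ring.
  have E2 : d.2 * det2 e f = det2 d f * e.2 + det2 e d * f.2 by rewrite /det2; ring.
  have -> : d.1 = 0 by apply: (mulIf D0'); rewrite E1 b0 -a0; ring.
  by have -> : d.2 = 0 by apply: (mulIf D0'); rewrite E2 b0 -a0; ring.
Qed.

(** The Cramer coordinates of z - x are nonnegative in the closed cone and at most 1 near x. *)
Lemma near_cone_pgram (R : realType) (x : R * R) (r : R) (e f : R * R) :
  0 < r -> \forall z \near x, 0 < det2 e f -> 0 <= det2 e (z - x) ->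
    0 <= det2 (z - x) f -> cone_pgram x r e f `[0, 1] `[0, 1] z.
Proof.
move=> r0; have [D0|] := boolP (0 < det2 e f); last first.
  by move=> _; apply: filterE.
have k0 := cone_scale_gt0 e f r0; rewrite /cone_pgram; set k := cone_scale r e f in k0 *.
set n := `|e.1| + `|e.2| + `|f.1| + `|f.2| + 1.
have n0 : 0 < n by rewrite ltr_wpDl// !addr_ge0.
apply/nbhs_ballP; exists (k * det2 e f / n) => /=.
  by rewrite divr_gt0// mulr_gt0.
move=> z [] /=; rewrite /ball /= => h1 h2 _ ez zf.
set v1 := z.1 - x.1; set v2 := z.2 - x.2.
have {}h1 : `|v1| * n < k * det2 e f by rewrite /v1 distrC -ltr_pdivlMr.
have {}h2 : `|v2| * n < k * det2 e f by rewrite /v2 distrC -ltr_pdivlMr.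
have [n1 n2 n3 n4] : [/\ 0 <= `|e.1|, 0 <= `|e.2|, 0 <= `|f.1| & 0 <= `|f.2|] by [].
have bd (a b : R) : `|a| + `|b| <= n -> a * v1 - b * v2 <= k * det2 e f.
  move=> ab; have av : a * v1 <= `|a| * `|v1| by rewrite -normrM ler_norm.
  have bv : - (b * v2) <= `|b| * `|v2| by rewrite -normrM -normrN ler_norm.
  have [v12|v21] := leP `|v1| `|v2|.
    have := normr_ge0 a; have := normr_ge0 b; have := normr_ge0 v2; nra.
  have := normr_ge0 a; have := normr_ge0 b; have := normr_ge0 v1; nra.
have kD : 0 < k * det2 e f by rewrite mulr_gt0.
exists (det2 (z - x) f / (k * det2 e f)), (det2 e (z - x) / (k * det2 e f)).
rewrite /= !in_itv/=; split.
- apply/andP; split; first by rewrite divr_ge0// ltW.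
  rewrite ler_pdivrMr// mul1r.
  have := bd f.2 f.1; rewrite /det2 /= -/v1 -/v2 (mulrC f.2) (mulrC f.1) (mulrC v2).
  by rewrite (mulrC f.1); apply; rewrite /n; lra.
- apply/andP; split; first by rewrite divr_ge0// ltW.
  rewrite ler_pdivrMr// mul1r.
  have := bd (- e.2) (- e.1); rewrite /det2 /= -/v1 -/v2 !normrN => bd'.
  rewrite (_ : e.1 * v2 - e.2 * v1 = - e.2 * v1 - - e.1 * v2); last by ring.
  by apply: bd'; rewrite /n; lra.
- have D0' : det2 e f != 0 by rewrite gt_eqF.
  have k0' : k != 0 by rewrite gt_eqF.
  rewrite [LHS]surjective_pairing [RHS]surjective_pairing /pgram_pt.
  rewrite !(fst_addZ, snd_addZ).
  rewrite (_ : (k *: e).1 = k * e.1)// (_ : (k *: e).2 = k * e.2)//.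
  rewrite (_ : (k *: f).1 = k * f.1)// (_ : (k *: f).2 = k * f.2)//.
  by move: D0'; rewrite /det2 /= => D0'; congr pair; field; apply/andP; split.
Qed.

Lemma mem_cat_opp (V : zmodType) (s : seq V) (d : V) :
  d \in s ++ [seq - c | c <- s] -> - d \in s ++ [seq - c | c <- s].
Proof.
rewrite !mem_cat => /orP[ds|/mapP[c cs ->]]; apply/orP; [right|left].
  by apply/mapP; exists d.
by rewrite opprK.
Qed.

(** Boundary segments missing x are closed, so a small ball meets only those through x, on which z -
    x is parallel to the segment. The axes are added to the directions so that every vector lies in
    a cone of angle less than pi. *)
Lemma polygonal_local_directions (R : realType) (Omega : set (R * R)) (x : R * R) :
  polygonal Omega ->
  exists (ds : seq (R * R)) (r : R),
    [/\ 0 < r, forall d, d \in ds -> - d \in ds,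
      [/\ (1, 0) \in ds & (0, 1) \in ds] &
      forall z, ball x r z -> bdry Omega z ->
        exists d, [/\ d \in ds, d != 0 & det2 (z - x) d = 0]].
Proof.
move=> [s [sne bE]].
pose ds0 := [:: (1, 0); (0, 1)] ++ [seq e.2 - e.1 | e <- s].
have : \forall z \near x, forall e, e \in s ->
    segment e.1 e.2 z -> segment e.1 e.2 x.
  apply: (@near_seq _ _ (nbhs x) _ s (fun e z =>
    segment e.1 e.2 z -> segment e.1 e.2 x)) => e _.
  have [sx|nsx] := pselect (segment e.1 e.2 x); first by apply: filterE.
  have : nbhs x (~` segment e.1 e.2).
    by apply: open_nbhs_nbhs; split => //; rewrite openC; exact: closed_segment.
  by apply: filterS.
move=> /nbhs_ballP[r /= r0 Hr].
have sub d : d \in ds0 -> d \in ds0 ++ [seq - d | d <- ds0].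
  by move=> h; rewrite mem_cat h.
exists (ds0 ++ [seq - d | d <- ds0]), r; split => //.
- exact: mem_cat_opp.
- by split; apply: sub; rewrite /ds0 /= !inE eqxx ?orbT.
- move=> z /Hr Hz; rewrite bE => -[e /= es ez].
  exists (e.2 - e.1); split.
  + by apply: sub; rewrite /ds0 mem_cat; apply/orP; right; apply/mapP; exists e.
  + by rewrite subr_eq0 eq_sym; exact: sne.
  + exact: segment_det (Hz e es ez) ez.
Qed.

(** Starting cone for [empty_cone]. *)
Lemma quadrant (R : realType) (ds : seq (R * R)) (v : R * R) :
  (forall d, d \in ds -> - d \in ds) -> (1, 0) \in ds -> (0, 1) \in ds ->
  exists e f, [/\ e \in ds, f \in ds, 0 < det2 e f, 0 <= det2 e v & 0 <= det2 v f].
Proof.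
move=> dsN d1 d2; have [v1|v1] := leP 0 v.1; have [v2|v2] := leP 0 v.2.
- exists (1, 0), (0, 1); rewrite /det2 /=; split => //; lra.
- exists (- (0, 1)), (1, 0); rewrite /det2 /= dsN//; split => //; lra.
- exists (0, 1), (- (1, 0)); rewrite /det2 /= dsN//; split => //; lra.
- exists (- (1, 0)), (- (0, 1)); rewrite /det2 /= !dsN//; split => //; lra.
Qed.

Lemma compact_closure_bounded (R : realType) (A : set (R * R)) :
  bounded_set A -> compact (closure A).
Proof.
move=> bA; have [N [_ /(_ (N + 1))]] := bA; rewrite ltrDl ltr01 => /(_ isT) HN.
have cQ : compact (`[- (N + 1), N + 1]%classic `*` `[- (N + 1), N + 1]%classic).
  by apply: compact_setX; exact: segment_compact.
apply: (subclosed_compact _ cQ); first exact: closed_closure.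
have -> : `[- (N + 1), N + 1]%classic `*` `[- (N + 1), N + 1]%classic =
    closure (`[- (N + 1), N + 1]%classic `*` `[- (N + 1), N + 1]%classic).
  by apply/closure_id; apply: compact_closed => //; exact: norm_hausdorff.
apply: closureS => z /HN /=; rewrite prod_normE ge_max => /andP[].
by rewrite !ler_norml => h1 h2; split; rewrite /= in_itv.
Qed.

Section covering.
Variables (R : realType) (Omega : set (R * R)).
Hypotheses (oO : open Omega) (cO : connected Omega) (pO : polygonal Omega).

(** Only the part of U inside [Omega] is covered, so that cones outside the domain are harmless; the
    point y allows G to be linked to other pieces. *)
Let coverable (U : set (R * R)) := exists G, [/\ isoperimetric Omega G,
  U `&` Omega `<=` G & exists2 y, Omega y & G° y].

Let coverable_disjoint U : Omega !=set0 -> U `&` Omega = set0 -> coverable U.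
Proof.
move=> [x Ox] U0; have [G [iG Gx _]] := isoperimetric_link oO cO Ox Ox.
by exists G; split; rewrite ?U0//; exists x.
Qed.

Let coverableS U V : U `<=` V -> coverable V -> coverable U.
Proof.
move=> UV [G [iG VG Gy]]; exists G; split => //.
by apply: subset_trans VG; exact: setSI.
Qed.

Let coverableU U V : coverable U -> coverable V -> coverable (U `|` V).
Proof.
move=> [G [iG UG [y Oy Gy]]] [H [iH VH [w Ow Hw]]].
have [K [iK Ky Kw]] := isoperimetric_link oO cO Oy Ow.
have iGK := isoperimetricU iG iK Gy Ky.
exists (G `|` K `|` H); split.
- by apply: isoperimetricU iH _ Hw => //; apply: interiorU; right.
- by move=> z [[Uz|Vz] Oz]; [left; left; exact: UG|right; exact: VH].
- by exists w => //; apply: interiorU; right.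
Qed.

Let coverable_local (x : R * R) : Omega !=set0 -> exists2 U, nbhs x U & coverable U.
Proof.
move=> O0; have [ds [r [r0 dsN [d1 d2] Hb]]] := polygonal_local_directions x pO.
pose emp (p : (R * R) * (R * R)) := 0 < det2 p.1 p.2 /\
  (forall g, g \in ds -> ~~ ((0 < det2 p.1 g) && (0 < det2 g p.2))).
pose P (p : (R * R) * (R * R)) := cone_pgram x r p.1 p.2 `[0, 1] `[0, 1].
pose pairs := [seq (e, f) | e <- ds, f <- ds].
exists [set z | exists p, [/\ p \in pairs, emp p & P p z]].
  have : \forall z \near x, forall p, p \in pairs -> 0 < det2 p.1 p.2 ->
      0 <= det2 p.1 (z - x) -> 0 <= det2 (z - x) p.2 -> P p z.
    apply: (@near_seq _ _ (nbhs x) _ pairs (fun p z => 0 < det2 p.1 p.2 ->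
      0 <= det2 p.1 (z - x) -> 0 <= det2 (z - x) p.2 -> P p z)) => p _.
    exact: near_cone_pgram.
  apply: filterS => z H.
  have [e [f [eds fds ef ev vf]]] := quadrant (z - x) dsN d1 d2.
  have [e' [f' [e'ds f'ds [D0 e'v vf'] em]]] := empty_cone eds fds ef ev vf.
  have efp : (e', f') \in pairs by exact: allpairs_f.
  by exists (e', f'); split => //; exact: H.
(* The neighbourhood is a finite union of cone parallelograms, treated one at a time. *)
elim: pairs => [|p s IH].
  apply: coverable_disjoint => //; apply/seteqP; split => // z [[p []]] //.
apply: (@coverableS _ ([set z | emp p /\ P p z] `|`
    [set z | exists p, [/\ p \in s, emp p & P p z]])).
  move=> z [q []]; rewrite inE => /predU1P[-> ? ?|qs ? ?]; first by left.
  by right; exists q.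
apply: coverableU => //.
have [[D0 em]|nem] := pselect (emp p); last first.
  by apply: coverable_disjoint => //; apply/seteqP; split => // z [[]].
have k0 := cone_scale_gt0 p.1 p.2 r0.
have kD : det2 (cone_scale r p.1 p.2 *: p.1) (cone_scale r p.1 p.2 *: p.2) != 0.
  by rewrite det2Z mulf_neq0 ?expf_neq0// gt_eqF.
have [sub|sub] := pgram_dichotomy oO (cone_no_boundary r0 D0 dsN em Hb).
  exists (P p); split.
  - apply: pgram_isoperimetric => //; apply: pgram_closed_sub.
      exact: closed_closure.
    by apply: subset_trans sub _; exact: subset_closure.
  - by move=> z [[]].
  - pose h : R := 1 / 2.
    have h01 : `]0, 1[%classic h by rewrite /= in_itv/= /h; apply/andP; split; lra.
    exists (pgram_pt x (cone_scale r p.1 p.2 *: p.1)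
                       (cone_scale r p.1 p.2 *: p.2) h h).
      by apply: sub; exists h, h.
    apply: (@filterS _ _ _ (cone_pgram x r p.1 p.2 `]0, 1[ `]0, 1[)).
      move=> z [u [v [+ + ->]]]; rewrite /= !in_itv/= => /andP[? ?] /andP[? ?].
      by exists u, v; rewrite /= !in_itv/= !ltW.
    apply: open_nbhs_nbhs; split; last by exists h, h.
    by apply: open_pgram => //; exact: interval_open.
(* The complement of [Omega] is closed, so the closed parallelogram stays outside too. *)
apply: coverable_disjoint => //; apply/seteqP; split => // z [[_ Pz] Oz].
by apply: (pgram_closed_sub _ sub Pz) => //; rewrite closedC.
Qed.

Lemma isoperimetric_domain : bounded_set Omega -> isoperimetric Omega Omega.
Proof.
move=> bO; have mO := open_measurable2 oO.
have [Oe|/set0P O0] := eqVneq Omega set0.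
  rewrite Oe in mO *; split => //; first by rewrite measure0.
  by exists 0 => // M A d _ _; left; rewrite setI0 measure0 mul0r.
have cK := compact_closure_bounded bO.
have : coverable (closure Omega).
  apply: compact_property cK _ _ _ _.
  - by apply: coverable_disjoint => //; rewrite set0I.
  - exact: coverableS.
  - exact: coverableU.
  - by move=> x _; exact: coverable_local.
move=> [G [[mG sG fG [C C0 CG]] sub _]].
have {}sub : Omega `<=` G.
  by move=> z Oz; apply: sub; split => //; exact: subset_closure.
split => //; first exact: subset_closure.
  by apply: le_lt_trans fG; apply: le_measure; rewrite ?inE.
exists C => // M A d adm Pd.
have leGO (B : {set Tidx M}) : (leb2 R (union_closure B `&` Omega) <= leb2 R (union_closure B `&` G))%E.
  have mB := measurable_union_closure B.
  by apply: le_measure; rewrite ?inE; [exact: measurableI|exact: measurableI|exact: setIS].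
by have [h|h] := CG M A d adm Pd; [left|right]; exact: le_trans h.
Qed.

End covering.

(** * Geometry of the mesh *)

Lemma convex_setP (R : realType) (A : set (R * R)) : convex_set A ->
  forall x y t, A x -> A y -> 0 <= t <= 1 -> A (x + t *: (y - x)).
Proof.
move=> cA x y t Ax Ay /andP[t0 t1].
have := cA y x (Itv01 t0 t1); rewrite !inE => /(_ Ay Ax).
rewrite /conv /= => h.
by rewrite (_ : _ + _ = t *: y + (1 - t) *: x)// scalerBr scalerBl scale1r addrCA.
Qed.

(** Replace z by a nearby z' in A and shift x to x' so that the combination is unchanged; openness
    keeps x' in A. *)
Lemma convex_closure_segment (R : realType) (A : set (R * R)) (x z : R * R) (l : R) :
  open A -> convex_set A -> A x -> closure A z -> 0 <= l < 1 ->
  A (x + l *: (z - x)).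
Proof.
move=> oA cA Ax cz /andP[l0 l1].
have [->|ln0] := eqVneq l 0; first by rewrite scale0r addr0.
have lp : 0 < l by rewrite lt_neqAle eq_sym ln0.
have /nbhs_ballP[r /= r0 sub] : nbhs x A by exact: open_nbhs_nbhs.
have q0 : 0 < r * (1 - l) / l by rewrite divr_gt0// mulr_gt0// subr_gt0.
have [z' [Az' zz']] := cz _ (nbhsx_ballx z _ q0).
have l1' : 1 - l != 0 by rewrite subr_eq0 eq_sym lt_eqF.
pose x' := x + (l / (1 - l)) *: (z - z').
have -> : x + l *: (z - x) = x' + l *: (z' - x').
  rewrite [LHS]surjective_pairing [RHS]surjective_pairing !(fst_addZ, snd_addZ).
  rewrite (_ : (z' - x').1 = z'.1 - x'.1)// (_ : (z' - x').2 = z'.2 - x'.2)//.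
  rewrite /x' !(fst_addZ, snd_addZ) /=; congr pair; field; exact: l1'.
apply: convex_setP => //; last by rewrite l0 ltW.
apply: sub.
have bd (c d e : R) : `|d - e| < r * (1 - l) / l ->
    `|c - (c + (l / (1 - l)) * (d - e))| < r.
  move=> h; rewrite opprD addrA subrr sub0r normrN normrM.
  rewrite ger0_norm ?divr_ge0// ?subr_ge0 ?ltW//.
  rewrite -ltr_pdivlMl ?divr_gt0// ?subr_gt0//.
  by rewrite invf_div mulrC mulrA.
case: zz' => h1 h2.
by split; [exact: (bd x.1 z.1 z'.1 h1)|exact: (bd x.2 z.2 z'.2 h2)].
Qed.

Lemma open_off_line (R : realType) (A : set (R * R)) (p q : R * R) :
  open A -> A !=set0 -> p != q ->
  exists2 k, A k & det2 (q - p) (k - p) != 0.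
Proof.
move=> oA [x Ax] pq; have [D0|D0] := eqVneq (det2 (q - p) (x - p)) 0; last by exists x.
have /nbhs_ballP[r /= r0 sub] : nbhs x A by exact: open_nbhs_nbhs.
pose n : R * R := (- (q - p).2, (q - p).1).
pose N := `|n.1| + `|n.2| + 1.
have N0 : 0 < N by rewrite ltr_wpDl// addr_ge0.
pose e := r / N; have e0 : 0 < e by rewrite divr_gt0.
have eN : e * N = r by rewrite /e divfK// gt_eqF.
exists (x + e *: n).
  have bd (c d : R) : `|d| < N -> `|c - (c + e * d)| < r.
    move=> h; rewrite opprD addrA subrr sub0r normrN normrM (gtr0_norm e0) -eN.
    by rewrite ltr_pM2l.
  have n1 : `|n.1| < N by rewrite /N -addrA ltrDl ltr_wpDl.
  have n2 : `|n.2| < N by rewrite /N addrAC ltrDr ltr_wpDl.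
  by apply: sub; split; [exact: (bd x.1 n.1 n1)|exact: (bd x.2 n.2 n2)].
have -> : det2 (q - p) (x + e *: n - p) = det2 (q - p) (x - p) + e * dot (q - p) (q - p).
  rewrite /det2 /dot.
  rewrite (_ : (x + e *: n - p).1 = x.1 + e * n.1 - p.1)//.
  by rewrite (_ : (x + e *: n - p).2 = x.2 + e * n.2 - p.2)// /n /=; ring.
rewrite D0 add0r mulf_neq0 ?(gt_eqF e0)//.
by apply: contra_neq pq => /dot_eq0/eqP; rewrite subr_eq0 => /eqP.
Qed.

(** Above the midpoint of the segment, each set contains all points at sufficiently small height on
    the common side. *)
Lemma same_side_meet (R : realType) (K L : set (R * R)) (p q k l : R * R) :
  open K -> convex_set K -> open L -> convex_set L -> p != q ->
  segment p q `<=` closure K -> segment p q `<=` closure L ->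
  K k -> L l -> 0 < det2 (q - p) (k - p) -> 0 < det2 (q - p) (l - p) ->
  K `&` L !=set0.
Proof.
move=> oK cK oL cL pq sK sL Kk Ll kD lD.
pose n := dot (q - p) (q - p).
have n0 : 0 < n.
  rewrite lt_def /n; apply/andP; split; last exact: dot_ge0.
  by apply: contra_neq pq => /dot_eq0/eqP; rewrite subr_eq0 => /eqP.
have key (A : set (R * R)) (x : R * R) : open A -> convex_set A ->
    segment p q `<=` closure A -> A x -> 0 < det2 (q - p) (x - p) ->
    exists2 h0, 0 < h0 & forall h, 0 < h <= h0 ->
      A (p + ((1 / 2) *: (q - p) + h *: (- (q - p).2, (q - p).1))).
  move=> oA cA sA Ax xD.
  set b := det2 (q - p) (x - p) / n; set a := dot (x - p) (q - p) / n.
  have b0 : 0 < b by rewrite divr_gt0.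
  have xE : x = p + (a *: (q - p) + b *: (- (q - p).2, (q - p).1)).
    have n0' : n != 0 by rewrite gt_eqF.
    rewrite [LHS]surjective_pairing [RHS]surjective_pairing.
    rewrite (_ : (p + (a *: (q - p) + _)).1 = p.1 + (a * (q.1 - p.1) - b * (q.2 - p.2))); last first.
      by rewrite [LHS](_ : _ = p.1 + (a * (q.1 - p.1) + b * (- (q.2 - p.2))))//; ring.
    rewrite (_ : (p + (a *: (q - p) + _)).2 = p.2 + (a * (q.2 - p.2) + b * (q.1 - p.1)))//.
    move: n0'; rewrite /a /b /det2 /n /dot /= => n0'.
    by congr pair; field; exact: n0'.
  have a0 : 0 <= `|a| by [].
  exists (b / (2 * (1 + `|a|))); first by rewrite divr_gt0// mulr_gt0// ltr_pwDl.
  move=> h /andP[hp]; rewrite ler_pdivlMr; last by rewrite mulr_gt0// ltr_pwDl.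
  move=> hb; pose t := h / b.
  have t0 : 0 < t by rewrite divr_gt0.
  have hE : h = t * b by rewrite /t divfK// gt_eqF.
  have tl : t * (2 * (1 + `|a|)) <= 1 by rewrite /t mulrAC ler_pdivrMr// mul1r.
  have t12 : t <= 1 / 2 by nra.
  have t1 : 1 - t != 0 by apply: lt0r_neq0; lra.
  (* a and b are the coordinates of x along the segment and its normal: t brings the height b to h,
     and s solves t a + (1 - t) s = 1 / 2. The bound on h keeps s in [0, 1]. *)
  pose s := (1 / 2 - t * a) / (1 - t).
  have [a1 a2] : - `|a| <= a /\ a <= `|a|.
    by split; [rewrite lerNl -normrN ler_norm|rewrite ler_norm].
  have s01 : `[0, 1]%classic s.
    rewrite /= in_itv/= /s; apply/andP; split.
      by rewrite divr_ge0//; nra.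
    by rewrite ler_pdivrMr; nra.
  have := @convex_closure_segment R A x (p + s *: (q - p)) (1 - t) oA cA Ax.
  have cs : closure A (p + s *: (q - p)) by apply: sA; exists s.
  move=> /(_ cs); have -> : 0 <= 1 - t < 1 by apply/andP; split; lra.
  move=> /(_ isT); congr (A _).
  rewrite [in LHS]xE hE.
  rewrite [LHS]surjective_pairing [RHS]surjective_pairing.
  set w : R * R := (- _, _).
  rewrite (_ : (p + (a *: (q - p) + b *: w) + (1 - t) *: (p + s *: (q - p) -
     (p + (a *: (q - p) + b *: w)))).1 = p.1 + (a * (q - p).1 + b * w.1) + (1 - t) *
     (p.1 + s * (q - p).1 - (p.1 + (a * (q - p).1 + b * w.1))))//.
  rewrite (_ : (p + (a *: (q - p) + b *: w) + (1 - t) *: (p + s *: (q - p) -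
     (p + (a *: (q - p) + b *: w)))).2 = p.2 + (a * (q - p).2 + b * w.2) + (1 - t) *
     (p.2 + s * (q - p).2 - (p.2 + (a * (q - p).2 + b * w.2))))//.
  rewrite (_ : (p + _).1 = p.1 + (1 / 2 * (q - p).1 + t * b * w.1))//.
  rewrite (_ : (p + ((1 / 2) *: (q - p) + (t * b) *: w)).2 = p.2 + (1 / 2 * (q - p).2 + t * b * w.2))//.
  by rewrite /s; congr pair; field; exact: t1.
have [hK hK0 HK] := key K k oK cK sK Kk kD.
have [hL hL0 HL] := key L l oL cL sL Ll lD.
pose h := Num.min hK hL.
have h0 : 0 < h by rewrite lt_min hK0.
exists (p + ((1 / 2) *: (q - p) + h *: (- (q - p).2, (q - p).1))); split.
  by apply: HK; rewrite h0 ge_min lexx.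
by apply: HL; rewrite h0 ge_min lexx orbT.
Qed.

Lemma segmentC (R : realType) (p q : R * R) : segment p q `<=` segment q p.
Proof.
move=> _ [t /= + <-]; rewrite in_itv/= => /andP[t0 t1]; exists (1 - t).
  by rewrite /= in_itv/=; apply/andP; split; lra.
by rewrite scalerBl scale1r -scalerN opprB addrA subrKC.
Qed.

Lemma same_sign3 (R : realDomainType) (a b c : R) : a != 0 -> b != 0 -> c != 0 ->
  0 < a * b \/ 0 < a * c \/ 0 < b * c.
Proof.
move=> a0 b0 c0; case: (ltgtP a 0) a0 => // a0 _; case: (ltgtP b 0) b0 => // b0 _;
  case: (ltgtP c 0) c0 => // c0 _.
all: by [left; nra|right; left; nra|right; right; nra].
Qed.

(** Each set has a point off the line through p and q, so two of them have points on the same side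
    and meet; swapping p and q treats the negative side. *)
Lemma no_three_cells (R : realType) (K L M : set (R * R)) (p q : R * R) :
  [/\ open K, convex_set K & K !=set0] -> [/\ open L, convex_set L & L !=set0] ->
  [/\ open M, convex_set M & M !=set0] ->
  K `&` L = set0 -> K `&` M = set0 -> L `&` M = set0 -> p != q ->
  segment p q `<=` closure K -> segment p q `<=` closure L ->
  segment p q `<=` closure M -> False.
Proof.
move=> [oK cK K0] [oL cL L0] [oM cM M0] KL KM LM pq sK sL sM.
have [k Kk kD] := open_off_line oK K0 pq.
have [l Ll lD] := open_off_line oL L0 pq.
have [m Mm mD] := open_off_line oM M0 pq.
have meet (A B : set (R * R)) (a b : R * R) : open A -> convex_set A -> open B ->
    convex_set B -> segment p q `<=` closure A -> segment p q `<=` closure B ->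
    A a -> B b -> 0 < det2 (q - p) (a - p) * det2 (q - p) (b - p) -> A `&` B = set0 ->
    False.
  move=> oA cA oB cB sA sB Aa Bb + AB.
  have [a0|a0|->] := ltgtP (det2 (q - p) (a - p)) 0; last by rewrite mul0r ltxx.
    have sw x : det2 (p - q) (x - q) = - det2 (q - p) (x - p) by rewrite /det2 /=; ring.
    rewrite nmulr_rgt0// => b0.
    have qp : q != p by rewrite eq_sym.
    have sA' := subset_trans (@segmentC R q p) sA.
    have sB' := subset_trans (@segmentC R q p) sB.
    have [||z] := @same_side_meet R A B q p a b oA cA oB cB qp sA' sB' Aa Bb;
      by rewrite ?sw ?oppr_gt0// AB.
  rewrite pmulr_rgt0// => b0.
  by have [z] := @same_side_meet R A B p q a b oA cA oB cB pq sA sB Aa Bb a0 b0; rewrite AB.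
have [h|[h|h]] := same_sign3 kD lD mD.
- exact: (meet K L k l).
- exact: (meet K M k m).
- exact: (meet L M l m).
Qed.

Lemma edistC (R : realType) (z w : R * R) : edist z w = edist w z.
Proof. by rewrite /edist /dot; congr Num.sqrt; rewrite /=; ring. Qed.

Lemma edist_gt0 (R : realType) (z w : R * R) : z != w -> 0 < edist z w.
Proof.
move=> zw; rewrite lt_def edist_ge0 andbT; apply: contra_neq zw => E.
have := sqr_edist z w; rewrite E expr0n /= => /esym/dot_eq0/eqP.
by rewrite subr_eq0 => /eqP.
Qed.

Section interfaces.
Variables (R : realType) (Omega : set (R * R)) (M : mesh R).
Hypothesis adm : admissible_mesh Omega M.

Lemma cellP (K : Tidx M) :
  [/\ open (cell K), convex_set (cell K) & cell K !=set0].
Proof.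
split; [exact: (cell_open adm)|exact: (cell_convex adm)|].
by exists (center K); exact: (center_in adm).
Qed.

Lemma is_interface_sym (s : Eidx M) K L : is_interface s K L = is_interface s L K.
Proof. by rewrite /is_interface eq_sym setIC. Qed.

Lemma interface_closure (s : Eidx M) K L : is_interface s K L ->
  closure (cell K) `&` closure (cell L) = edge_seg s.
Proof. by move=> /andP[_ /asboolP]. Qed.

Lemma interface_neq (s : Eidx M) K L : is_interface s K L -> K != L.
Proof. by move=> /andP[]. Qed.

Lemma interface_subl (s : Eidx M) K L : is_interface s K L ->
  edge_seg s `<=` closure (cell K).
Proof. by move=> /interface_closure <-; exact: subIsetl. Qed.

Lemma interface_subr (s : Eidx M) K L : is_interface s K L ->
  edge_seg s `<=` closure (cell L).
Proof. by move=> /interface_closure <-; exact: subIsetr. Qed.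

Lemma interface_edge_unique (s s' : Eidx M) K L :
  is_interface s K L -> is_interface s' K L -> s = s'.
Proof.
move=> /interface_closure E /interface_closure E'.
by apply: (edge_seg_inj adm); rewrite -E -E'.
Qed.

Lemma neighbour_unique (s : Eidx M) K L L' :
  is_interface s K L -> is_interface s K L' -> L = L'.
Proof.
move=> i i'; apply/eqP; apply: contrapT => /negP LL'.
apply: (no_three_cells (cellP K) (cellP L) (cellP L') _ _ _ (edge_nondegenerate adm s)).
- exact: (cell_disjoint adm (interface_neq i)).
- exact: (cell_disjoint adm (interface_neq i')).
- exact: (cell_disjoint adm LL').
- exact: interface_subl i.
- exact: interface_subr i.
- exact: interface_subr i'.
Qed.

(** A nondegenerate segment is not of zero length, so [cell_inter] provides an edge of K, which
    equals s because edges are determined by their segments. *)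
Lemma interface_mem (s : Eidx M) K L : is_interface s K L -> s \in edges_of K.
Proof.
move=> i; have [|[s' [i' sK _]]] := cell_inter adm (interface_neq i).
  rewrite (interface_closure i) => zl.
  by have := segment_not_zero_length (edge_nondegenerate adm s) zl.
by rewrite (interface_edge_unique i i').
Qed.

Lemma interface_edge_dist (s : Eidx M) K L : is_interface s K L ->
  edge_dist K s = edist (center K) (center L).
Proof.
move=> i; rewrite /edge_dist; case: pickP => [L' i'|/(_ L)]; last by rewrite i.
by rewrite (neighbour_unique i i').
Qed.

Lemma interface_lengthE (s : Eidx M) K L : is_interface s K L ->
  interface_length K L = edge_length s.
Proof.
move=> i; rewrite /interface_length (big_pred1 s)// => s' /=.
apply/andP/eqP => [[_ i']|->]; last by rewrite (interface_mem i).
exact: interface_edge_unique i' i.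
Qed.

Lemma interface_length_eq0 K L : (forall s : Eidx M, ~~ is_interface s K L) ->
  interface_length K L = 0.
Proof.
move=> H; rewrite /interface_length big1// => s /andP[_ i].
by have := H s; rewrite i.
Qed.

Lemma interface_lengthC (K L : Tidx M) : interface_length K L = interface_length L K.
Proof.
have [[s i]|H] := pselect (exists s : Eidx M, is_interface s K L).
  rewrite (interface_lengthE i) (@interface_lengthE s)//.
  by rewrite is_interface_sym.
by rewrite !interface_length_eq0// => s; apply/negP => i; apply: H; exists s;
  rewrite // is_interface_sym.
Qed.

Lemma center_dist_gt0 (K L : Tidx M) : interface_length K L != 0 ->
  0 < edist (center K) (center L).
Proof.
move=> i0; apply: edist_gt0.
have [[s i]|H] := pselect (exists s : Eidx M, is_interface s K L).
  by have [] := interface_orth adm i.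
move/negP: i0; case; apply/eqP/interface_length_eq0 => s.
by apply/negP => i; apply: H; exists s.
Qed.

Lemma sum_transmissibility (K : Tidx M) (F : Tidx M -> R) :
  \sum_(s in edges_of K) \sum_(L | is_interface s K L) transmissibility K s * F L =
  \sum_L interface_length K L / edist (center K) (center L) * F L.
Proof.
rewrite (exchange_big_dep xpredT)//=; apply: eq_bigr => L _.
rewrite mulr_suml mulr_suml; apply: eq_bigr => s /andP[_ i].
by rewrite /transmissibility (interface_edge_dist i).
Qed.

End interfaces.

(** Additivity up to null overlaps. The induction carries a set U together with the property that
    whatever meets each Q i in a null set also meets U in a null set. *)
Lemma sum_measure_le (R : realType) (I : eqType) (s : seq I)
    (Q : I -> set (R * R)) (K : set (R * R)) :
  uniq s ->
  (forall i, i \in s ->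
    measurable (Q i : set (measurableTypeR R * measurableTypeR R))) ->
  measurable (K : set (measurableTypeR R * measurableTypeR R)) ->
  (forall i, i \in s -> Q i `<=` K) ->
  (forall i j, i \in s -> j \in s -> i != j -> leb2 R (Q i `&` Q j) = 0%E) ->
  (\sum_(i <- s) leb2 R (Q i) <= leb2 R K)%E.
Proof.
move=> us mQ mK QK null.
suff [U [mU UK _ UE]] : exists U : set (R * R), [/\
    measurable (U : set (measurableTypeR R * measurableTypeR R)), U `<=` K,
    forall W : set (R * R),
      measurable (W : set (measurableTypeR R * measurableTypeR R)) ->
      (forall i, i \in s -> leb2 R (W `&` Q i) = 0%E) -> leb2 R (W `&` U) = 0%E &
    (\sum_(i <- s) leb2 R (Q i) <= leb2 R U)%E].
  by apply: le_trans UE _; apply: le_measure; rewrite ?inE.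
move: us mQ QK null; elim: s => [|i s IH] us mQ QK null.
  exists set0; split => //; last by rewrite big_nil measure0.
  by move=> W _ _; rewrite setI0 measure0.
move: us; rewrite cons_uniq => /andP[nis us].
have sub j : j \in s -> j \in i :: s by rewrite inE orbC => ->.
have [||j k js ks|U [mU UK UW UE]] := IH us.
- by move=> j /sub; exact: mQ.
- by move=> j /sub; exact: QK.
- by apply: null; exact: sub.
have iis : i \in i :: s by rewrite inE eqxx.
have mQi := mQ i iis.
exists (Q i `|` U); split; first exact: measurableU.
- by rewrite subUset; split => //; exact: QK.
- move=> W mW H; apply/eqP; rewrite eq_le measure_ge0 andbT setIUr.
  apply: (@le_trans _ _ (leb2 R (W `&` Q i) + leb2 R (W `&` U))%E).
    by apply: measureU2; exact: measurableI.
  by rewrite H// UW ?adde0// => j /sub; exact: H.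
rewrite big_cons.
have QU0 : leb2 R (Q i `&` U) = 0%E.
  by apply: UW => // j js; apply: null; [|exact: sub|apply: contraNneq nis => ->].
have -> : Q i `|` U = (Q i `\` U) `|` U.
  apply/seteqP; split => z.
    case=> [Qz|Uz]; last by right.
    by have [Uz|nUz] := pselect (U z); [right|left].
  by case=> [[Qz _]|Uz]; [left|right].
have mD := measurableD mQi mU.
rewrite measureU//; last by apply/seteqP; split => // z [[]].
apply: leeD => //.
apply: (@le_trans _ _ (leb2 R ((Q i `\` U) `|` (Q i `&` U)))).
  by rewrite setUC setUIDK.
apply: (@le_trans _ _ (leb2 R (Q i `\` U) + leb2 R (Q i `&` U))%E).
  by apply: measureU2 => //; exact: measurableI.
by rewrite QU0 adde0.
Qed.

Lemma leb2_line (R : realType) (x v : R * R) : v != 0 ->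
  exists L : set (R * R),
    [/\ measurable (L : set (measurableTypeR R * measurableTypeR R)),
      leb2 R L = 0%E & forall t, L (x + t *: v)].
Proof.
move=> v0; pose n : R * R := (- v.2, v.1).
have D0 : det2 v n != 0.
  rewrite (_ : det2 v n = dot v v); last by rewrite /det2 /dot /n /=; ring.
  by apply: contra_neq v0 => /dot_eq0.
have m0 : measurable ([set 0] : set R) by exact: measurable_set1.
have [mP lP] := leb2_pgram x D0 (@measurableT _ (measurableTypeR R)) m0.
exists (pgram x v n setT [set 0]); split => //.
  by rewrite lP lebesgue_measure_set1 !mule0.
by move=> t; exists t, 0; split => //; rewrite /pgram_pt scale0r addr0.
Qed.

Lemma leb2_segment (R : realType) (p q : R * R) : p != q ->
  leb2 R (segment p q) = 0%E.
Proof.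
move=> pq; have qp : q - p != 0 by rewrite subr_eq0 eq_sym.
have [L [mL L0 sL]] := leb2_line p qp.
apply/eqP; rewrite eq_le measure_ge0 andbT -L0; apply: le_measure; rewrite ?inE//.
  by apply: closed_measurable2; exact: closed_segment.
by move=> _ [t _ <-].
Qed.

(** Both sides are twice the area of the triangle with base s and apex at the centre. *)
Lemma edge_length_dist (R : realType) (M : mesh R) (K : Tidx M) (s : Eidx M) :
  edge_a s != edge_b s ->
  edge_length s * dist_to_edge K s =
  `|det2 (edge_a s - center K) (edge_b s - center K)|.
Proof.
move=> ab; set a := edge_a s; set b := edge_b s; set x := center K.
apply/eqP; rewrite -(eqrXn2 (n := 2))//; last by rewrite mulr_ge0 ?edist_ge0.
rewrite exprMn real_normK ?num_real// !sqr_edist -/a -/b -/x /orth_proj.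
have n0 : dot (b - a) (b - a) != 0.
  by apply: contra_neq ab => /dot_eq0/eqP; rewrite subr_eq0 => /eqP.
apply/eqP; move: n0; rewrite /det2 /dot /= => n0.
set k := (_ / _).
have -> : x.1 - (a + k *: (b - a)).1 = x.1 - (a.1 + k * (b.1 - a.1)) by [].
have -> : x.2 - (a + k *: (b - a)).2 = x.2 - (a.2 + k * (b.2 - a.2)) by [].
by rewrite /k; field.
Qed.

Lemma segment_sub (R : realType) (a b p q : R * R) :
  segment a b p -> segment a b q -> segment p q `<=` segment a b.
Proof.
move=> [s + <-] [t + <-] _ [l + <-].
rewrite /= !in_itv/= => /andP[s0 s1] /andP[t0 t1] /andP[l0 l1].
exists (s + l * (t - s)).
  by rewrite /= in_itv/=; have [st|st] := leP s t; apply/andP; split; nra.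
rewrite [LHS]surjective_pairing [RHS]surjective_pairing !(fst_addZ, snd_addZ).
rewrite (_ : (a + t *: (b - a) - (a + s *: (b - a))).1 =
  a.1 + t * (b - a).1 - (a.1 + s * (b - a).1))//.
rewrite (_ : (a + t *: (b - a) - (a + s *: (b - a))).2 =
  a.2 + t * (b - a).2 - (a.2 + s * (b - a).2))//.
by congr pair; ring.
Qed.

(** * Almost disjoint parallelograms inside a cell *)

Section corners.
Variables (R : realType) (Omega : set (R * R)) (M : mesh R).
Hypothesis adm : admissible_mesh Omega M.
Let T := (measurableTypeR R * measurableTypeR R)%type.

Lemma measurable_cell (K : Tidx M) : measurable (cell K : set T).
Proof. by apply: open_measurable2; exact: (cell_open adm). Qed.

(* The factor 1/2 keeps this parallelogram inside the triangle with apex x_K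
   and base s, hence inside K. *)
Definition corner (K : Tidx M) (s : Eidx M) : set (R * R) :=
  pgram (center K) (edge_a s - center K) (edge_b s - center K)
    `]0, 1 / 2[ `]0, 1 / 2[.

(** Radial form of a point of the corner: l is the sum of its two coordinates. *)
Lemma cornerP (K : Tidx M) (s : Eidx M) w : corner K s w ->
  exists z l, [/\ edge_seg s z, 0 < l < 1 & w = center K + l *: (z - center K)].
Proof.
move=> [u [v [+ + ->]]]; rewrite /= !in_itv/= => /andP[u0 u1] /andP[v0 v1].
have uv : u + v != 0 by rewrite gt_eqF// addr_gt0.
exists (edge_a s + (v / (u + v)) *: (edge_b s - edge_a s)), (u + v); split.
- exists (v / (u + v)) => //; rewrite /= in_itv/=; apply/andP; split.
    by apply: divr_ge0; lra.
  by rewrite ler_pdivrMr ?addr_gt0// mul1r; lra.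
- by apply/andP; split; lra.
- rewrite /pgram_pt [LHS]surjective_pairing [RHS]surjective_pairing.
  rewrite !(fst_addZ, snd_addZ).
  rewrite (_ : (edge_a s + (v / (u + v)) *: (edge_b s - edge_a s) - center K).1 =
    (edge_a s).1 + (v / (u + v)) * ((edge_b s).1 - (edge_a s).1) - (center K).1)//.
  rewrite (_ : (edge_a s + (v / (u + v)) *: (edge_b s - edge_a s) - center K).2 =
    (edge_a s).2 + (v / (u + v)) * ((edge_b s).2 - (edge_a s).2) - (center K).2)//.
  by rewrite /=; congr pair; field.
Qed.

Lemma interface_not_cell (s : Eidx M) (K L : Tidx M) z : is_interface s K L ->
  edge_seg s z -> ~ cell K z.
Proof.
move=> i sz Kz; have cz := interface_subr i sz.
have [w [Lw Kw]] : cell L `&` cell K !=set0.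
  apply: cz; apply: open_nbhs_nbhs; split => //; exact: (cell_open adm).
have := cell_disjoint adm (interface_neq i).
by move/seteqP => [/(_ w) + _]; apply.
Qed.

Lemma corner_sub (s : Eidx M) (K L : Tidx M) : is_interface s K L ->
  corner K s `<=` cell K.
Proof.
move=> i w /cornerP[z [l [sz /andP[l0 l1] ->]]].
have [oK cK _] := cellP adm K.
apply: convex_closure_segment => //; [exact: (center_in adm)| |by rewrite ltW].
exact: interface_subl i z sz.
Qed.

(** On a common ray both ratios l agree, otherwise an edge point would be interior to K. So common
    points lie on rays towards common points of the two edges; two such points would span a segment
    shared by K, L and L', hence one line contains the intersection. *)
Lemma corner_null (s s' : Eidx M) (K L L' : Tidx M) : is_interface s K L ->
  is_interface s' K L' -> s != s' ->
  measurable (corner K s : set T) -> measurable (corner K s' : set T) ->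
  leb2 R (corner K s `&` corner K s') = 0%E.
Proof.
move=> i i' ss' ms ms'; have [oK cK K0] := cellP adm K.
have common w : corner K s w -> corner K s' w ->
    exists z l, [/\ edge_seg s z, edge_seg s' z & w = center K + l *: (z - center K)].
  move=> /cornerP[z [l [sz /andP[l0 l1] wE]]] /cornerP[z' [l' [sz' /andP[l'0 l'1] wE']]].
  have wl (k k' : R) (y y' : R * R) : 0 < k' -> 0 < k ->
      center K + k *: (y - center K) = center K + k' *: (y' - center K) ->
      y = center K + (k' / k) *: (y' - center K).
    move=> k'0 k0 /addrI E; have kn : k != 0 by rewrite gt_eqF.
    by rewrite mulrC -scalerA -E scalerA mulVf// scale1r addrC subrK.
  have Ezz : center K + l *: (z - center K) = center K + l' *: (z' - center K).
    by rewrite -wE -wE'.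
  have [ll'|l'l|ll'] := ltgtP l l'.
  - case: (interface_not_cell i' sz').
    rewrite (wl _ _ _ _ l0 l'0 (esym Ezz)).
    apply: convex_closure_segment => //; first exact: (center_in adm).
      exact: interface_subl i z sz.
    by rewrite divr_ge0 ?ltW//= ltr_pdivrMr// mul1r.
  - case: (interface_not_cell i sz).
    rewrite (wl _ _ _ _ l'0 l0 Ezz).
    apply: convex_closure_segment => //; first exact: (center_in adm).
      exact: interface_subl i' z' sz'.
    by rewrite divr_ge0 ?ltW//= ltr_pdivrMr// mul1r.
  - exists z, l; split => //.
    have -> : z = z' by rewrite (wl _ _ _ _ l'0 l0 Ezz) ll' divff ?gt_eqF// scale1r addrC subrK.
    exact: sz'.
have LL' : L != L'.
  by apply: contra_neq ss' => LL; apply: (interface_edge_unique adm i); rewrite LL.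
have [[z [sz sz']]|nz] := pselect (exists z, edge_seg s z /\ edge_seg s' z); last first.
  rewrite [X in leb2 R X](_ : _ = set0) ?measure0//.
  apply/seteqP; split => // w [cw cw'].
  by have [z [l [sz sz' _]]] := common w cw cw'; apply: nz; exists z.
have zK : z - center K != 0.
  rewrite subr_eq0; apply/eqP => E; apply: (interface_not_cell i sz); rewrite E.
  exact: (center_in adm).
have [N [mN N0 sN]] := leb2_line (center K) zK.
apply/eqP; rewrite eq_le measure_ge0 andbT -N0.
apply: le_measure; rewrite ?inE//; first exact: measurableI.
move=> w [cw cw']; have [z' [l [sz1 sz1' ->]]] := common w cw cw'.
suff -> : z' = z by exact: sN.
apply/eqP; apply: contrapT => /negP zz'.
apply: (no_three_cells (cellP adm K) (cellP adm L) (cellP adm L') _ _ _ zz').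
- exact: (cell_disjoint adm (interface_neq i)).
- exact: (cell_disjoint adm (interface_neq i')).
- exact: (cell_disjoint adm LL').
- by apply: subset_trans (interface_subl i); exact: segment_sub.
- by apply: subset_trans (interface_subr i); exact: segment_sub.
- by apply: subset_trans (interface_subr i'); exact: segment_sub.
Qed.

End corners.

Section cell_areas.
Variables (R : realType) (Omega : set (R * R)) (M : mesh R).
Hypothesis adm : admissible_mesh Omega M.
Hypothesis mO : measurable (Omega : set (measurableTypeR R * measurableTypeR R)).
Hypothesis fO : (leb2 R Omega < +oo)%E.

Lemma leb2_cell (K : Tidx M) : leb2 R (cell K) = (area K)%:E.
Proof.
rewrite /area fineK// ge0_fin_numE//; apply: le_lt_trans fO.
apply: le_measure; rewrite ?inE//; first exact: (measurable_cell adm K).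
exact: (cell_sub adm).
Qed.

Lemma area_gt0 (K : Tidx M) : 0 < area K.
Proof.
rewrite -lte_fin -leb2_cell; have [oK _ _] := cellP adm K.
apply: (@nbhs_leb2_gt0 _ (center K)); first exact: (measurable_cell adm K).
by apply: open_nbhs_nbhs; split => //; exact: (center_in adm).
Qed.

Lemma leb2_corner (K : Tidx M) (s : Eidx M) :
  let D := det2 (edge_a s - center K) (edge_b s - center K) in
  D != 0 ->
  measurable (corner K s : set (measurableTypeR R * measurableTypeR R)) /\
  leb2 R (corner K s) = (`|D| / 4)%:E.
Proof.
move=> D D0; have mI : measurable (`]0, 1 / 2[%classic : set R).
  exact: measurable_itv.
have [mP lP] := leb2_pgram (center K) D0 mI mI; split => //.
rewrite /corner lP lebesgue_measure_itv/= lte_fin divr_gt0//.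
by rewrite -EFinB -!EFinM; congr (_%:E); rewrite /D; field.
Qed.

(** Regularity gives m_s d_s <= |D s| / zeta, and the corners, of area |D s| / 4, are almost
    disjoint in K. Edges with D s = 0 have no corner and contribute 0. *)
Lemma interface_area (zeta : R) (K : Tidx M) : 0 < zeta -> mesh_regular zeta M ->
  \sum_L interface_length K L * edist (center K) (center L) <= 4 / zeta * area K.
Proof.
move=> z0 reg.
pose D (s : Eidx M) := det2 (edge_a s - center K) (edge_b s - center K).
pose S := [pred s : Eidx M | [&& s \in edges_of K, [exists L, is_interface s K L] & D s != 0]].
have le1 : \sum_L interface_length K L * edist (center K) (center L) <=
    \sum_(s | S s) `|D s| / zeta.
  rewrite (eq_bigr (fun L => \sum_(s in edges_of K | is_interface s K L)
      edge_length s * edge_dist K s)); last first.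
    move=> L _; rewrite mulr_suml; apply: eq_bigr => s /andP[_ i].
    by rewrite (interface_edge_dist adm i).
  rewrite (exchange_big_dep (fun s => s \in edges_of K))/=; last by move=> L s _ /andP[].
  rewrite [leLHS]big_mkcond [leRHS]big_mkcond; apply: ler_sum => s _.
  rewrite /S /=; case: ifPn => sK /=; last by [].
  have ab := edge_nondegenerate adm s.
  have bound : edge_length s * edge_dist K s <= `|D s| / zeta.
    rewrite ler_pdivlMr// -mulrA -edge_length_dist// ler_wpM2l ?edist_ge0//.
    by rewrite mulrC; exact: reg.
  have [/existsP[L i]|/existsPn nL] := boolP [exists L, is_interface s K L] => /=.
    rewrite (big_pred1 L); last first.
      by move=> L' /=; rewrite sK /=; apply/idP/eqP => [i'|->//]; exact: (neighbour_unique adm i' i).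
    by case: ifPn => //; rewrite negbK => /eqP D0; move: bound; rewrite D0 normr0 mul0r.
  by rewrite big1// => L /andP[_ i]; have := nL L; rewrite i.
apply: le_trans le1 _.
rewrite -mulr_suml mulrAC ler_pM2r ?invr_gt0//.
have mcorner s : S s -> measurable (corner K s : set (measurableTypeR R * measurableTypeR R)).
  by move=> /and3P[_ _ D0]; have [] := leb2_corner D0.
have : (\sum_(s <- enum S) leb2 R (corner K s) <= leb2 R (cell K))%E.
  apply: sum_measure_le.
  - exact: enum_uniq.
  - by move=> s; rewrite mem_enum => /mcorner.
  - exact: (measurable_cell adm K).
  - by move=> s; rewrite mem_enum => /and3P[_ /existsP[L i] _]; exact: (corner_sub adm i).
  - move=> s s'; rewrite !mem_enum => Ss Ss' ss'.
    have /and3P[_ /existsP[L i] _] := Ss; have /and3P[_ /existsP[L' i'] _] := Ss'.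
    by apply: (corner_null adm i i' ss'); exact: mcorner.
rewrite leb2_cell big_enum_cond (eq_bigr (fun s => (`|D s| / 4)%:E)); last first.
  by move=> s /andP[/and3P[_ _ D0] _]; have [] := leb2_corner D0.
rewrite sumEFin lee_fin -mulr_suml ler_pdivrMr// mulrC => h.
by apply: le_trans h; rewrite le_eqVlt; apply/orP; left; apply/eqP; apply: eq_bigl => s; rewrite andbT.
Qed.

Lemma sum_area_le (A : {set Tidx M}) :
  ((\sum_(K in A) area K)%:E <= leb2 R (union_closure A `&` Omega))%E.
Proof.
rewrite -sumEFin -big_enum/= (eq_bigr (fun K => leb2 R (cell K))); last first.
  by move=> K _; rewrite leb2_cell.
apply: sum_measure_le.
- exact: enum_uniq.
- by move=> K _; exact: (measurable_cell adm K).
- by apply: measurableI => //; exact: measurable_union_closure.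
- move=> K; rewrite mem_enum => KA z Kz; split; last exact: (cell_sub adm Kz).
  by exists K => //; exact: subset_closure.
- by move=> K L _ _ KL; rewrite (cell_disjoint adm KL) measure0.
Qed.

Lemma sum_area_domain : \sum_(K : Tidx M) area K <= fine (leb2 R Omega).
Proof.
rewrite -lee_fin fineK ?ge0_fin_numE//.
rewrite (eq_bigl (fun K => K \in [set: Tidx M]%SET)); last by move=> K; rewrite inE.
apply: le_trans (sum_area_le _) _; apply: le_measure; rewrite ?inE//.
by apply: measurableI => //; exact: measurable_union_closure.
Qed.

End cell_areas.

(** Removes the slack: if both parts exceeded C P^2, a d slightly above P would be contradictory. *)
Lemma mesh_isoperimetry (R : realType) (Omega : set (R * R)) :
  isoperimetric Omega Omega ->
  exists2 C : R, 0 <= C & forall (M : mesh R) (A : {set Tidx M}),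
    admissible_mesh Omega M ->
    \sum_(K in A) area K <= C * perimeter A ^+ 2 \/
    \sum_(K in ~: A) area K <= C * perimeter A ^+ 2.
Proof.
move=> [mO _ fO [C C0 CO]]; exists C => // M A adm.
set P := perimeter A; have P0 : 0 <= P := perimeter_ge0 A.
set a := \sum_(K in A) _; set b := \sum_(K in ~: A) _.
have [?|aP] := leP a (C * P ^+ 2); first by left.
have [?|bP] := leP b (C * P ^+ 2); first by right.
pose m := Num.min a b; have mP : C * P ^+ 2 < m by rewrite lt_min aP.
have c0 : 0 < C * (2 * P + 1) + 1.
  by rewrite ltr_wpDl// mulr_ge0// addr_ge0// mulr_ge0.
(* Since e <= 1, (P + e)^2 <= P^2 + e (2 P + 1), which keeps C (P + e)^2 below m. *)
pose e := Num.min 1 ((m - C * P ^+ 2) / (C * (2 * P + 1) + 1)).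
have e0 : 0 < e by rewrite lt_min ltr01 divr_gt0// subr_gt0.
have e1 : e <= 1 by rewrite ge_min lexx.
have ec : e * (C * (2 * P + 1) + 1) <= m - C * P ^+ 2.
  by rewrite -ler_pdivlMr// ge_min lexx orbT.
have lt : C * (P + e) ^+ 2 < m.
  have : C * (e * e) <= C * e by rewrite ler_wpM2l// ler_piMr// ltW.
  rewrite sqrrD; nra.
have ma : m <= a by rewrite ge_min lexx.
have mb : m <= b by rewrite ge_min lexx orbT.
have Pe : P < P + e by rewrite ltrDl.
have [h|h] := CO M A (P + e) adm Pe.
  have := le_trans (sum_area_le adm mO fO A) h.
  by rewrite lee_fin -/a => /(le_trans ma); rewrite leNgt lt.
have := le_trans (sum_area_le adm mO fO (~: A)) h.
by rewrite lee_fin -/b => /(le_trans mb); rewrite leNgt lt.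
Qed.

(** * Mass of the initial datum *)

Section initial_mass.
Variables (R : realType) (Omega : set (R * R)) (M : mesh R) (u0 : R * R -> R).
Hypothesis adm : admissible_mesh Omega M.
Let T := (measurableTypeR R * measurableTypeR R)%type.
Hypothesis mO : measurable (Omega : set T).
Hypothesis fO : (leb2 R Omega < +oo)%E.
Hypothesis iu0 : initial_datum Omega u0.

Let mC (K : Tidx M) : measurable (cell K : set T).
Proof. exact: (measurable_cell adm K). Qed.

(** |f| <= 1 + f^2 on a set of finite measure. *)
Lemma datum_integrable : (leb2 R).-integrable Omega (EFin \o u0).
Proof.
have Lf := datum_L2 iu0; set f := u0 \_ Omega in Lf.
have mf : measurable_fun [set: T] (EFin \o f).
  by apply/measurable_EFinP; have := sub_Lfun_mfun Lf; rewrite inE.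
have i2 := integrableS measurableT mO (@subsetT _ _) (Lfun2_integrable_sqr Lf).
have i1 : (leb2 R).-integrable (Omega : set T) (EFin \o cst (1 : R)).
  apply/integrableP; split; first by apply: measurableT_comp => //.
  by rewrite (eq_integral (cst 1%E)) ?integral_cst ?mul1e// => x _ /=; rewrite normr1.
have := integrableD mO i1 i2 => i12.
apply: (@eq_integrable _ _ _ (leb2 R) _ mO (EFin \o f)).
  by move=> x xO /=; rewrite /f patchE xO.
apply: le_integrable i12 => //; first exact: measurable_funS mf.
move=> x _ /=; rewrite lee_fin [leRHS]ger0_norm ?addr_ge0 ?sqr_ge0//.
have := sqr_ge0 (`|f x| - 1); rewrite sqrrB real_normK ?num_real//.
have := normr_ge0 (f x); rewrite expr1n mulr1; nra.
Qed.

(** What the open cells leave out lies on their boundaries, hence on finitely many segments. *)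
Lemma cells_null : leb2 R (Omega `\` \big[setU/set0]_(K <- enum (Tidx M)) cell K) = 0%E.
Proof.
have mE s : measurable (edge_seg s : set T).
  by apply: closed_measurable2; exact: closed_segment.
have E0 (r : seq (Eidx M)) :
    measurable (\big[setU/set0]_(s <- r) edge_seg s : set T) /\
    leb2 R (\big[setU/set0]_(s <- r) edge_seg s) = 0%E.
  elim: r => [|s r [mr r0]]; first by rewrite big_nil measure0.
  rewrite big_cons; split; first exact: measurableU.
  by rewrite measureU0//; exact: (leb2_segment (edge_nondegenerate adm s)).
have [mr r0] := E0 (enum (Eidx M)).
have mU : measurable (\big[setU/set0]_(K <- enum (Tidx M)) cell K : set T).
  exact: bigsetU_measurable.
apply/eqP; rewrite eq_le measure_ge0 andbT -r0; apply: le_measure; rewrite ?inE//.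
  exact: measurableD.
move=> z [Oz nz]; have : closure Omega z by exact: subset_closure.
rewrite (cell_cover adm) => -[K _ cz].
have nKz : ~ cell K z.
  move=> Kz; apply: nz; rewrite -bigcup_seq; exists K => //=.
  by rewrite mem_enum.
have : bdry (cell K) z.
  by rewrite /bdry; have /interior_id -> := @cell_open _ _ _ adm K.
rewrite (edge_bdry adm) => -[s _ sz].
by rewrite -bigcup_seq; exists s => //=; rewrite mem_enum.
Qed.

Lemma cell_mass_ge0 (K : Tidx M) : 0 <= \int[leb2 R]_(x in cell K) u0 x.
Proof.
have [N [mN N0 sN]] := datum_ge0 iu0.
have iK := integrableS mO (mC K) (@cell_sub _ _ _ adm K) datum_integrable.
rewrite /Rintegral (negligible_integral mN (mC K) iK N0).
apply: fine_ge0; apply: integral_ge0 => x [Kx nNx]; rewrite lee_fin.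
apply: contrapT => nx; apply: nNx; apply: sN => /= h; apply: nx; apply: h.
exact: (cell_sub adm Kx).
Qed.

Lemma sum_cell_mass :
  \sum_(K : Tidx M) \int[leb2 R]_(x in cell K) u0 x = mass Omega u0.
Proof.
have mU : measurable (\big[setU/set0]_(K <- enum (Tidx M)) cell K : set T).
  exact: bigsetU_measurable.
have sU : \big[setU/set0]_(K <- enum (Tidx M)) cell K `<=` Omega.
  by rewrite -bigcup_seq => z [K _ Kz]; exact: (cell_sub adm Kz).
have iU := integrableS mO mU sU datum_integrable.
have iK (K : Tidx M) := integrableS mO (mC K) (@cell_sub _ _ _ adm K) datum_integrable.
rewrite /mass /Rintegral.
rewrite (negligible_integral (measurableD mO mU) mO datum_integrable cells_null).
rewrite setDD (setIidr sU).
rewrite integral_bigsetU_EFin//; last 3 first.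
- exact: enum_uniq.
- move=> K L _ _ KL; apply/eqP; apply: contrapT => /negP KL'.
  by move: KL; rewrite (cell_disjoint adm KL') => -[z].
- exact: (measurable_int _ iU).
rewrite big_enum/= -sum_fine//= => K _.
exact: integrable_fin_num.
Qed.

End initial_mass.

(** * Exponential decay *)

Lemma within_continuous_bounded (R : realType) (K : set (R * R)) (V : R * R -> R) :
  compact K -> {within K, continuous V} ->
  exists B : R, forall x, K x -> `|V x| <= B.
Proof.
move=> cK cV; have := compact_bounded (continuous_compact cV cK).
move=> [N [_ /(_ (N + 1))]]; rewrite ltrDl ltr01 => /(_ isT) HN.
by exists (N + 1) => x Kx; apply: HN; exists x.
Qed.

Lemma geometric_decay (R : realType) (E : nat -> R) (c : R) : 0 < c ->
  (forall n, c * E n.+1 <= E n) -> forall n, E n <= c ^- n * E 0%N.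
Proof.
move=> c0 step; elim=> [|n IH]; first by rewrite expr0 invr1 mul1r.
rewrite exprSr invfM -mulrA mulrCA mulrC ler_pdivlMr// mulrC.
exact: le_trans (step n) IH.
Qed.

(** Bernoulli with exponent dt / k <= 1: (1 + nu k)^(dt / k) <= 1 + nu dt. *)
Lemma exponential_rate (R : realType) (nu k dt : R) (n : nat) :
  0 < nu -> 0 < k -> 0 < dt <= k ->
  (1 + nu * dt) ^- n <= expR (- (ln (1 + nu * k) / k) * (n%:R * dt)).
Proof.
move=> nu0 k0 /andP[dt0 dtk].
have x0 : 0 < 1 + nu * k by rewrite addr_gt0// mulr_gt0.
have y0 : 0 < 1 + nu * dt by rewrite addr_gt0// mulr_gt0.
have q01 : 0 <= dt / k <= 1.
  by rewrite divr_ge0 ?(ltW dt0) ?(ltW k0)//= ler_pdivrMr// mul1r.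
have := powR_bernoulli x0 q01.
rewrite (_ : 1 + dt / k * (1 + nu * k - 1) = 1 + nu * dt); last first.
  by field; rewrite gt_eqF.
rewrite /powR gt_eqF// => H.
rewrite (_ : - _ * _ = - (n%:R * (dt / k * ln (1 + nu * k)))); last first.
  by field; rewrite gt_eqF.
rewrite expRN expRM_natl lef_pV2 ?posrE ?exprn_gt0 ?expR_gt0//.
by rewrite lerXn2r// nnegrE ?expR_ge0// ltW.
Qed.

(* nu is a function of the mass only, and a constant function unless p = 1; its
   place among the quantifiers gives the dependence on Omega, V, zeta and p. *)
Theorem theorem3p1 (R : realType) (Omega : set (R * R)) (V : R * R -> R)
    (zeta p : R)
    (hOmega : polygonal_domain Omega) (hV : C1_closure Omega V)
    (hzeta : 0 < zeta) (hp : 1 <= p <= 2) :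
  exists nu : R -> R,
    [/\ forall m : R, 0 < m -> 0 < nu m,
        p != 1 -> forall m m' : R, nu m = nu m'
      & forall (M : mesh R) (r : R -> R -> R) (u0 : R * R -> R) (dt : R)
               (u : nat -> Tidx M -> R),
          admissible_mesh Omega M -> mesh_regular zeta M ->
          admissible_mean r ->
          initial_datum Omega u0 -> 0 < mass Omega u0 -> 0 < dt ->
          scheme_solution V r u0 dt u ->
          let M1 := mass Omega u0 in
          let E := fun n : nat => rel_entropy V M1 p (u n) in
          (forall n : nat, E n <= (1 + nu M1 * dt) ^- n * E 0%N) /\
          (forall k : R, 0 < k -> dt <= k ->
             forall n : nat,
               E n <= expR (- (ln (1 + nu M1 * k) / k) * (n%:R * dt))
                      * E 0%N)].
Proof.
have [pO cO oO bO] := hOmega; have [cV _] := hV.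
have [Vb VVb] := within_continuous_bounded (compact_closure_bounded bO) cV.
have isoO := isoperimetric_domain oO cO pO bO.
have [mO _ fO _] := isoO; have [C0 C0_ge0 HC0] := mesh_isoperimetry isoO.
pose C1 := 4 / zeta; pose S := fine (leb2 R Omega).
have C1_ge0 : 0 <= C1 by rewrite divr_ge0// ltW.
have S_ge0 : 0 <= S by rewrite fine_ge0.
have cp_ge0 : 0 <= 144 + 8 / (p - 1).
  by rewrite addr_ge0// divr_ge0// subr_ge0; case/andP: hp.
(* S bounds the total area of the cells of any mesh; the added 1 keeps CF positive when C0 or S is
   0. *)
pose CF := (144 + 8 / (p - 1)) * C0 * C1 * S + 1.
have CF_gt0 : 0 < CF.
  by apply: ltr_wpDl => //; do 3 (apply: mulr_ge0 => //).
pose nu := expR (- Vb) / (2 * CF * expR Vb).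
have nu_gt0 : 0 < nu by rewrite divr_gt0 ?expR_gt0// !mulr_gt0// expR_gt0.
(* A constant function serves p = 1 as well, since rho has cancelled. *)
exists (fun=> nu); split => // M r u0 dt u adm reg rP iu0 M1_gt0 dt_gt0 sol M1 E.
(* Positive mass excludes a mesh without cells; the median needs one. *)
have [K0 _] : exists K0 : Tidx M, True.
  apply: contrapT => nK; move: M1_gt0; rewrite -(sum_cell_mass adm mO fO iu0).
  by rewrite big1 ?ltxx// => K _; case: nK; exists K.
pose m : Tidx M -> R := area (M := M); pose Vc K := V (center (m := M) K).
pose l : Tidx M -> Tidx M -> R := interface_length (M := M).
pose d (K L : Tidx M) := edist (center K) (center L).
pose a K L := l K L / d K L.
pose rho := M1 / \sum_(L : Tidx M) m L * expR (- Vc L).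
have m_gt0 K : 0 < m K by exact: (area_gt0 adm mO fO).
have l_ge0 K L : 0 <= l K L := interface_length_ge0 K L.
have lC K L : l K L = l L K := interface_lengthC adm K L.
have dC K L : d K L = d L K := edistC _ _.
have d_gt0 K L : l K L != 0 -> 0 < d K L := center_dist_gt0 adm (K := K) (L := L).
have a_ge0 K L : 0 <= a K L := conductance_ge0 l_ge0 d_gt0 K L.
have aC K L : a K L = a L K by rewrite /a lC dC.
have den_gt0 : 0 < \sum_(L : Tidx M) m L * expR (- Vc L).
  rewrite (bigD1 K0)//= ltr_pwDl ?mulr_gt0 ?expR_gt0//.
  by apply: sumr_ge0 => K _; rewrite mulr_ge0 ?expR_ge0// ltW.
have rho_gt0 : 0 < rho by rewrite divr_gt0.
have VcVb K : `|Vc K| <= Vb.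
  apply: VVb; apply: subset_closure; apply: (cell_sub adm); exact: (center_in adm).
have u0_ge0 K : 0 <= u 0%N K.
  rewrite (scheme_init sol) mulr_ge0 ?invr_ge0 ?(ltW (m_gt0 K))//.
  exact: (cell_mass_ge0 adm mO fO iu0).
have u_ge0 n K : 0 <= u n K by case: n => // n; rewrite ltW// (scheme_pos sol).
have scheme n K : m K * ((u n.+1 K - u n K) / dt) -
    \sum_L a K L * (r (u n.+1 K) (u n.+1 L) *
      (ln (u n.+1 L) + Vc L - ln (u n.+1 K) - Vc K)) = 0.
  rewrite -[RHS](scheme_eq sol n K); congr (_ - _).
  rewrite -(sum_transmissibility adm); apply: eq_bigr => s _; apply: eq_bigr => L _.
  by rewrite mulrA.
have massE n : \sum_K m K * u n K = \sum_K m K * equilibrium Vc rho K.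
  have -> : \sum_K m K * equilibrium Vc rho K = M1.
    rewrite (eq_bigr (fun K => rho * (m K * expR (- Vc K)))); last first.
      by move=> K _; rewrite /equilibrium mulrCA.
    by rewrite -mulr_sumr /rho divfK// gt_eqF.
  elim: n => [|n <-].
    rewrite /M1 -(sum_cell_mass adm mO fO iu0); apply: eq_bigr => K _.
    by rewrite (scheme_init sol) mulVKf// gt_eqF.
  exact: (mass_step aC rP dt_gt0 (fun K => scheme_pos sol n K) (scheme n)).
have E_ge0 n : 0 <= E n.
  exact: (entropy_ge0 hp m_gt0 rho_gt0 (u_ge0 n) (massE n)).
have contraction n : (1 + nu * dt) * E n.+1 <= E n.
  apply: (entropy_contraction hp m_gt0 a_ge0 aC rP rho_gt0 VcVb dt_gt0
    (fun K => scheme_pos sol n K) (u_ge0 n) (scheme n) CF_gt0 (massE n.+1)).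
  have h_gt0 K : 0 < u n.+1 K / equilibrium Vc rho K.
    by rewrite divr_gt0 ?(scheme_pos sol)// mulr_gt0// expR_gt0.
  have iso (A : {set Tidx M}) : \sum_(K in A) m K <= C0 * (\sum_(K in A) \sum_(L in ~: A) l K L) ^+ 2 \/
      \sum_(K in ~: A) m K <= C0 * (\sum_(K in A) \sum_(L in ~: A) l K L) ^+ 2.
    exact: HC0.
  have ld K : \sum_L l K L * d K L <= C1 * m K by exact: (interface_area adm mO fO K hzeta reg).
  have [k k_gt0 Hk] := entropy_functional_inequality hp m_gt0 l_ge0 lC dC d_gt0
    C0_ge0 C1_ge0 iso ld K0 h_gt0.
  exists k => //; apply: le_trans Hk _.
  have D_ge0 := le_trans (dirichlet_ge0 l_ge0 d_gt0 _)
    (dirichlet_le_dissipation hp l_ge0 d_gt0 h_gt0).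
  apply: (ler_wpM2r D_ge0); rewrite /CF ler_wpDr//.
  apply: ler_wpM2l; last exact: (sum_area_domain adm mO fO).
  by do 2 (apply: mulr_ge0 => //).
have c_gt0 : 0 < 1 + nu * dt by rewrite addr_gt0// mulr_gt0.
have decay := geometric_decay c_gt0 contraction.
split => // k k_gt0 dtk n; apply: le_trans (decay n) _.
by rewrite ler_wpM2r// exponential_rate// dt_gt0.
Qed.
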